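(* Consider the FSPG iterates $(\mathbf{w}^{(k)})$ with parameters $c>0$, $\beta>0$, $d\in(0,1)$ such that $\beta c\ge\frac{\lambda_{\max}(\bar{\mathbf{X}}^\top\bar{\mathbf{X}})}{2}$. Let $\rho\ge0$ be a weak convexity parameter of $P_{\lambda,\gamma}$ and assume there exists $K$ such that $\sigma^{(k+1)}\ge n\rho$ for all $k\ge K$. Then there exists a sequence $\boldsymbol{\kappa}^{(k+1)}\in\nabla\sum_{l=1}^L\tilde g_l(\mathbf{w}^{(k+1)},\mu^{(k+2)})+n\,\partial P_{\lambda,\gamma}(\mathbf{w}^{(k+1)})$ such that $$\|\boldsymbol{\kappa}^{(k+1)}\|\in o\big(k^{-\frac12+\frac d2}\big)\quad(k\to\infty).$$
   Context: Data: $L$ clients; client $l$ holds $y^{(l)}_1,\dots,y^{(l)}_{M_l}\in\mathbb{R}$ and $\bar{\mathbf{x}}^{(l)}_i=[(\mathbf{x}^{(l)}_i)^\top,1]^\top\in\mathbb{R}^{P+1}$; $n=\sum_l M_l$; $\bar{\mathbf{X}}\in\mathbb{R}^{(P+1)\times n}$ has all $\bar{\mathbf{x}}^{(l)}_i$ as columns; $\lambda_{\max}$ is the largest eigenvalue. Quantile level $\tau\in(0,1)$. Smoothing: $f(r,\mu)=|r|$ if $|r|\ge\mu$, $f(r,\mu)=\frac{r^2}{2\mu}+\frac{\mu}{2}$ if $|r|<\mu$; $\tilde g_l(\mathbf{w},\mu)=\frac12\sum_{i} f(y^{(l)}_i-(\bar{\mathbf{x}}^{(l)}_i)^\top\mathbf{w},\mu)+(\tau-\frac12)\sum_i(y^{(l)}_i-(\bar{\mathbf{x}}^{(l)}_i)^\top\mathbf{w})$;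 $\nabla$ is the gradient in $\mathbf{w}$. Penalty: $\lambda>0$, $P_{\lambda,\gamma}(\mathbf{w})=\sum_{p=1}^{P}g_{\lambda,\gamma}(w_p)$ with $g_{\lambda,\gamma}$ either MCP ($\gamma\ge1$): $\lambda|t|-\frac{t^2}{2\gamma}$ for $|t|\le\gamma\lambda$, $\frac{\gamma\lambda^2}{2}$ otherwise; or SCAD ($\gamma\ge2$): $\lambda|t|$ for $|t|\le\lambda$, $-\frac{t^2-2\gamma\lambda|t|+\lambda^2}{2(\gamma-1)}$ for $\lambda<|t|\le\gamma\lambda$, $\frac{(\gamma+1)\lambda^2}{2}$ for $|t|>\gamma\lambda$. $\partial$ denotes the (limiting/Fréchet) subdifferential, which for the weakly convex $P_{\lambda,\gamma}$ equals $\partial\big(P_{\lambda,\gamma}+\frac\rho2\|\cdot\|^2\big)(\mathbf{w})-\rho\mathbf{w}$ in the convex sense. A weak convexity parameter of $P_{\lambda,\gamma}$ is $\rho\ge0$ such that $\mathbf{w}\mapsto P_{\lambda,\gamma}(\mathbf{w})+\frac{\rho}{2}\|\mathbf{w}\|_2^2$ is convex. FSPG algorithm: choose $\mathbf{w}^{(0)}\in\mathbb{R}^{P+1}$, $c>0$, $\beta>0$, $d\in(0,1)$; set $\sigma^{(k)}=ck^d$ and $\mu^{(k)}=\beta/k^d$ for $k\ge1$; for $k=0,1,2,\dots$ let $\mathbf{w}^{(k+1)}$ be a minimizer over $\mathbf{w}\in\mathbb{R}^{P+1}$ of $\sum_{l=1}^L\langle\nabla\tilde g_l(\mathbf{w}^{(k)},\mu^{(k+1)}),\mathbf{w}-\mathbf{w}^{(k)}\rangle+nP_{\lambda,\gamma}(\mathbf{w})+\frac{\sigma^{(k+1)}}{2}\|\mathbf{w}-\mathbf{w}^{(k)}\|_2^2$.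 *)

(* Defs.v *)
From HB Require Import structures.
From mathcomp Require Import all_boot all_order all_algebra.
From mathcomp Require Import all_classical all_reals all_analysis.
Set Implicit Arguments. Unset Strict Implicit. Unset Printing Implicit Defensive.
Import Order.TTheory GRing.Theory Num.Theory.
Import numFieldNormedType.Exports.
Local Open Scope ring_scope.

(* Vectors of R^(P+1) are row vectors 'rV[R]_(P + 1); the first P coordinates
   are the feature coefficients, the last one is the intercept. *)

Definition dotv (R : realType) (m : nat) (u v : 'rV[R]_m) : R :=
  \sum_(i < m) u 0 i * v 0 i.

Definition norm2 (R : realType) (m : nat) (u : 'rV[R]_m) : R :=
  Num.sqrt (\sum_(i < m) (u 0 i) ^+ 2).

Definition xbar (R : realType) (P : nat) (x : 'rV[R]_P) : 'rV[R]_(P + 1) :=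
  row_mx x (const_mx 1).

Definition fsmooth (R : realType) (r mu : R) : R :=
  if mu <= `|r| then `|r| else r ^+ 2 / (2 * mu) + mu / 2.

(* smoothed check loss of client l *)
Definition gtilde (R : realType) (P L : nat) (M : 'I_L -> nat)
  (y : forall l : 'I_L, 'I_(M l) -> R) (x : forall l : 'I_L, 'I_(M l) -> 'rV[R]_P)
  (tau : R) (l : 'I_L) (w : 'rV[R]_(P + 1)) (mu : R) : R :=
  2^-1 * (\sum_(i < M l) fsmooth (y l i - dotv (xbar (x l i)) w) mu)
  + (tau - 2^-1) * (\sum_(i < M l) (y l i - dotv (xbar (x l i)) w)).

Inductive penalty_kind := MCP | SCAD.

Definition gpen (R : realType) (k : penalty_kind) (lam gam t : R) : R :=
  match k with
  | MCP => if `|t| <= gam * lam then lam * `|t| - t ^+ 2 / (2 * gam)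
           else gam * lam ^+ 2 / 2
  | SCAD => if `|t| <= lam then lam * `|t|
            else if `|t| <= gam * lam then
              - (t ^+ 2 - 2 * gam * lam * `|t| + lam ^+ 2) / (2 * (gam - 1))
            else (gam + 1) * lam ^+ 2 / 2
  end.

Definition Ppen (R : realType) (P : nat) (k : penalty_kind) (lam gam : R)
  (w : 'rV[R]_(P + 1)) : R :=
  \sum_(p < P) gpen k lam gam (lsubmx w 0 p).

Definition is_gradient (R : realType) (m : nat) (f : 'rV[R]_m -> R)
  (w v : 'rV[R]_m) : Prop :=
  differentiable f w /\ forall h, 'd f w h = dotv v h.

(* Frechet (regular) subdifferential:
   liminf_{u -> w, u <> w} (f u - f w - <v, u - w>) / ||u - w|| >= 0 *)
Definition frechet_subdiff (R : realType) (m : nat) (f : 'rV[R]_m -> R)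
  (w v : 'rV[R]_m) : Prop :=
  forall eps : R, 0 < eps -> exists2 delta : R, 0 < delta &
    forall u, norm2 (u - w) < delta ->
      f w + dotv v (u - w) - eps * norm2 (u - w) <= f u.

Definition convex_fun (R : realType) (m : nat) (f : 'rV[R]_m -> R) : Prop :=
  forall (a b : 'rV[R]_m) (t : R), 0 <= t <= 1 ->
    f (t *: a + (1 - t) *: b) <= t * f a + (1 - t) * f b.

Definition weak_convexity_param (R : realType) (m : nat) (f : 'rV[R]_m -> R)
  (rho : R) : Prop :=
  0 <= rho /\ convex_fun (fun w => f w + rho / 2 * norm2 w ^+ 2).

(* sigma^(k) = c k^d, mu^(k) = beta / k^d  (used for k >= 1) *)
Definition sigmak (R : realType) (c d : R) (k : nat) : R := c * (k%:R `^ d).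
Definition muk (R : realType) (beta d : R) (k : nat) : R := beta / (k%:R `^ d).

(* the data matrix Xbar, whose columns are all the xbar^(l)_i, indexed by the
   finite type of pairs (l, i) enumerated in some fixed order *)
Definition Xbar (R : realType) (P L : nat) (M : 'I_L -> nat)
  (x : forall l : 'I_L, 'I_(M l) -> 'rV[R]_P) :
  'M[R]_(P + 1, #|{: {l : 'I_L & 'I_(M l)}}|) :=
  \matrix_(p, j) (let s := enum_val (A := {: {l : 'I_L & 'I_(M l)}}) j in
                  xbar (x (tag s) (tagged s)) 0 p).

Definition fspg_iterates (R : realType) (P L : nat) (M : 'I_L -> nat)
  (y : forall l : 'I_L, 'I_(M l) -> R) (x : forall l : 'I_L, 'I_(M l) -> 'rV[R]_P)
  (tau : R) (k : penalty_kind) (lam gam c beta d : R)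
  (w : nat -> 'rV[R]_(P + 1)) : Prop :=
  let n : R := (\sum_(l < L) M l)%N%:R in
  forall (it : nat) (v : 'I_L -> 'rV[R]_(P + 1)),
    (forall l, is_gradient (fun u => gtilde y x tau l u (muk beta d it.+1)) (w it) (v l)) ->
    forall u : 'rV[R]_(P + 1),
      \sum_(l < L) dotv (v l) (w it.+1 - w it) + n * Ppen k lam gam (w it.+1)
        + sigmak c d it.+1 / 2 * norm2 (w it.+1 - w it) ^+ 2
      <= \sum_(l < L) dotv (v l) (u - w it) + n * Ppen k lam gam u
        + sigmak c d it.+1 / 2 * norm2 (u - w it) ^+ 2.

(* Main.v *)
Require Import Defs.
From HB Require Import structures.
From mathcomp Require Import all_boot all_order all_algebra.
From mathcomp Require Import all_classical all_reals all_analysis.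
From mathcomp Require Import ring lra.
Set Implicit Arguments. Unset Strict Implicit. Unset Printing Implicit Defensive.
Import Order.TTheory GRing.Theory Num.Theory.
Import numFieldNormedType.Exports.
Local Open Scope ring_scope.

(** Every residual lies below [- mu], above [mu] or in between, and every coordinate of
   [w] lies on one parabolic piece of the penalty: these finitely many choices are the
   cells. On a cell the smoothed objective is a quadratic in [w], and an expansion in
   powers of [mu] of its critical points gives a polynomial level [phi mu] such that the
   objective differs from [phi mu] by at most a constant times the squared norm of the
   stationarity residual, up to a high power of [mu]. Along the iterates the objective
   decreases by a multiple of [k^-d] times that squared norm, apart from the drift of
   the level as [mu] changes. Two distinct polynomials separate at a definite rate as
   [mu] tends to [0], so the objective stays eventually on one side of each intermediate
   polynomial; hence it may be compared with a single level throughout, and the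
   recursion for the difference gives the rate of the residual. *)

(** Summing the descent inequality only makes [k^-d] times the squared residual summable, which
    gives the rate along a subsequence. A rate for every iterate needs control of the objective gap
    itself. Bounding that gap by the squared residual is a Lojasiewicz inequality of exponent 1/2,
    but no fixed critical value can serve: smoothed critical values move with [mu], differ from cell
    to cell, and the iterates may keep changing cell. Hence the levels are functions of [mu]. The
    order of the expansion is dictated by [d]. With [Q] the integer part of [1/d], the sequence
    [E k = k^-((Q+1) d)] satisfies [k * E k -> 0], so a squared residual of order [E k / k^-d] is
    [o(k^(d-1))]; and distinct polynomials of degree at most [Q] stay apart by a multiple of [mu^Q],
    which dominates [E]. Neither convergence nor boundedness of the iterates is available, so every
    estimate holds on a whole cell, modulo directions in which the cell quadratic is constant; the
    constants are uniform because the cells are finitely many. *)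

Section Sequences.
Local Open Scope classical_set_scope.
Context {R : realType}.
Implicit Types (h E p e : nat -> R).

(** In the application [h m] is [m^-d] and [E m] is [m^-s] with [1 < s <= 2]. [scale_decr] lets a
    multiple of [E] telescope an error [E m / m]; [scale_ratio] says that [E] decays no faster than
    a power, so that a sequence contracting by [1 + 6 / m] keeps up with it. *)
Record step_scales (h E : nat -> R) : Prop := StepScales {
  scale_pos : forall m, 0 < E m;
  scale_step : forall M : R, \forall m \near \oo, M <= m%:R * h m;
  scale_small : forall eps : R, 0 < eps -> \forall m \near \oo, m%:R * E m <= eps;
  scale_decr : \forall m \near \oo, E m / m%:R <= 4 * (E m - E m.+1);
  scale_ratio : \forall m \near \oo, E m <= (1 + 6 / m%:R) * E m.+1 }.

Lemma eventually_natS (P : nat -> Prop) :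
  (\forall m \near \oo, P m) -> \forall m \near \oo, P m.+1.
Proof. by case=> N _ HN; exists N => // m /= Nm; apply: HN => /=; exact: leqW. Qed.

Lemma eventually_ind (Q : nat -> Prop) :
  (\forall m \near \oo, Q m -> Q m.+1) ->
  (forall N, exists2 m, (N <= m)%N & Q m) -> \forall m \near \oo, Q m.
Proof.
case=> N _ HN /(_ N)[m0 Nm0 Qm0]; exists m0 => // m /=.
elim: m => [|m IH]; first by rewrite leqn0 => /eqP <-.
rewrite leq_eqVlt => /predU1P[<- //|]; rewrite ltnS => m0m.
by apply: HN; [exact: leq_trans m0m | exact: IH].
Qed.

Lemma scale_lt h E (eps : R) : step_scales h E -> 0 < eps ->
  \forall m \near \oo, E m <= eps.
Proof.
move=> S eps0; near=> m.
have m1 : 1 <= m%:R :> R by rewrite ler1n; near: m; exact: nbhs_infty_ge.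
have E0 := scale_pos S m.
have H : m%:R * E m <= eps by near: m; exact: (scale_small S).
apply: le_trans H; rewrite ler_peMl //; exact: ltW.
Unshelve. all: by end_near. Qed.

(** A discrete form of [e' <= - c h p] with [e] of the order of [p]: since [m * h m] is unbounded,
    the relative decrease per step beats any multiple of [1 / m], so [e] falls until only the error
    scale [E] is left. *)
Lemma dissipation_rate h E (e p : nat -> R) (c C b : R) :
  step_scales h E -> 0 < c -> 0 < C ->
  (\forall m \near \oo, b <= e m) -> (forall m, 0 <= p m) ->
  (\forall m \near \oo, e m.+1 <= e m - c * (h m * p m) + C * (E m / m%:R)) ->
  (\forall m \near \oo, `|e m.+1| <= C * (p m + E m)) ->
  exists C', \forall m \near \oo, h m * p m <= C' * E m.
Proof.
move=> S c0 C0 eb p0 edrop esize.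
(* By [scale_decr], [K * (E m - E m.+1)] pays for the error [C * (E m / m)], so [f] decreases by the
   full dissipation. *)
pose K := 4 * C; pose f m := e m + K * E m.
have K0 : 0 < K by rewrite mulr_gt0.
have fdrop : \forall m \near \oo, f m.+1 <= f m - c * (h m * p m).
  near=> m.
  have H1 : e m.+1 <= e m - c * (h m * p m) + C * (E m / m%:R) by near: m.
  have H2 : E m / m%:R <= 4 * (E m - E m.+1) by near: m; exact: (scale_decr S).
  have H3 : C * (E m / m%:R) <= C * (4 * (E m - E m.+1)) by rewrite ler_pM2l.
  rewrite /f /K; lra.
have Edec : \forall m \near \oo, E m.+1 <= E m.
  near=> m.
  have H2 : E m / m%:R <= 4 * (E m - E m.+1) by near: m; exact: (scale_decr S).
  have : 0 <= E m / m%:R by rewrite divr_ge0 // ltW // (scale_pos S).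
  lra.
have hpos : \forall m \near \oo, 0 <= h m.
  near=> m.
  have m1 : 0 < m%:R :> R by rewrite ltr0n; near: m; exact: nbhs_infty_gt.
  have : 0 <= m%:R * h m by near: m; exact: (scale_step S).
  by rewrite pmulr_rge0.
(* A negative value of [f] cannot recover, and the size bound then keeps [p] of the order of [- f].
   The resulting decrease is at least linear in [m], against the lower bound [b]. *)
have f0 : \forall m \near \oo, 0 <= f m.
  apply: contrapT => nf0.
  have [N _ HN] : \forall m \near \oo, f m.+1 <= f m - c * (h m * p m) /\ 0 <= h m.
    by near=> m; split; near: m.
  have [M MN fM] : exists2 M, (N <= M)%N & f M < 0.
    apply: contrapT => H; apply: nf0; exists N => // m /= Nm.
    by rewrite leNgt; apply/negP => fm; apply: H; exists m.
  pose l := - f M; have l0 : 0 < l by rewrite /l oppr_gt0.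
  have fl m : (M <= m)%N -> f m <= - l.
    elim: m => [|m IH]; first by rewrite leqn0 /l opprK => /eqP <-.
    rewrite leq_eqVlt => /predU1P[<-|]; first by rewrite /l opprK.
    rewrite ltnS => Mm; have [H1 H2] := HN m (leq_trans MN Mm).
    apply: le_trans H1 _; rewrite lerBlDr (le_trans (IH Mm)) // lerDl.
    by apply: mulr_ge0; [exact: ltW | exact: mulr_ge0].
  (* while [f] is negative it is bounded away from [0], and [- f m / m] does not decrease *)
  have grow : \forall m \near \oo, - f m / m%:R <= - f m.+1 / m.+1%:R.
    near=> m.
    have m1 : 0 < m%:R :> R by rewrite ltr0n; near: m; exact: nbhs_infty_gt.
    have H1 : f m.+1 <= f m - c * (h m * p m) by near: m.
    have H2 : `|e m.+1| <= C * (p m + E m) by near: m.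
    have H3 : f m.+1 <= - l by apply: fl; apply: leqW; near: m; exact: nbhs_infty_ge.
    have H4 : E m <= l / (2 * C).
      by near: m; apply: (scale_lt S); rewrite divr_gt0 // mulr_gt0.
    have H5 : 2 * C / c <= m%:R * h m by near: m; exact: (scale_step S).
    have H6 := scale_pos S m.+1.
    have H7 : - e m.+1 <= C * (p m + E m) by apply: le_trans H2; rewrite -normrN ler_norm.
    have H8 : C * E m <= l / 2.
      have -> : l / 2 = C * (l / (2 * C)) by field; rewrite gt_eqF.
      by rewrite ler_pM2l.
    have H6' : 0 < K * E m.+1 by rewrite mulr_gt0.
    have H9 : - f m.+1 <= 2 * C * p m by rewrite /f in H3 *; lra.
    have H10 : 2 * C <= c * (m%:R * h m) by rewrite [leRHS]mulrC -ler_pdivrMr.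
    have H11 : - f m.+1 <= m%:R * (c * (h m * p m)).
      apply: le_trans H9 _.
      have -> : m%:R * (c * (h m * p m)) = (c * (m%:R * h m)) * p m by ring.
      by rewrite ler_wpM2r.
    rewrite ler_pdivrMr // mulrAC ler_pdivlMr ?ltr0n // -natr1.
    have : m%:R * f m.+1 <= m%:R * (f m - c * (h m * p m)) by rewrite ler_pM2l.
    nra.
  have [N' _ HN'] := grow.
  pose m0 := maxn M (maxn N' 1).
  have m0M : (M <= m0)%N by rewrite leq_maxl.
  have m0N : (N' <= m0)%N by rewrite /m0 maxnCA leq_maxl.
  have m01 : (0 < m0)%N by rewrite /m0 maxnA leq_max leqnn orbT.
  pose a := - f m0 / m0%:R.
  have a0 : 0 < a by rewrite divr_gt0 ?ltr0n // (lt_le_trans l0) // lerNr fl.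
  have am m : (m0 <= m)%N -> a <= - f m / m%:R.
    elim: m => [|m IH]; first by rewrite leqn0 => /eqP <-.
    rewrite leq_eqVlt => /predU1P[<- //|]; rewrite ltnS => Mm.
    by apply: le_trans (IH Mm) _; apply: HN'; exact: leq_trans Mm.
  have [k Hk] : exists k : nat, (`|b| + 1) / a <= k%:R.
    by have [k _ Hk] := nbhs_infty_ger ((`|b| + 1) / a); exists k; apply: Hk => /=.
  have [Nb _ HNb] := eb; pose m1 := maxn m0 (maxn k Nb).
  have := am m1 (leq_maxl _ _).
  rewrite ler_pdivlMr ?ltr0n ?(leq_trans m01) ?leq_maxl // => H.
  have : `|b| + 1 <= a * m1%:R.
    rewrite mulrC -ler_pdivrMr //; apply: le_trans Hk _.
    by rewrite ler_nat /m1 maxnCA leq_maxl.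
  have := HNb m1 (leq_trans (leq_maxr k Nb) (leq_maxr m0 _)); have := scale_pos S m1.
  have : - b <= `|b| by rewrite -normrN ler_norm.
  rewrite /f in H; nra.
have fE : exists C', \forall m \near \oo, f m <= C' * E m.
  pose K2 := 2 * (K + C).
  (* Above [K2 * E m] the size bound gives [f m.+1 <= 2 * C * p m], hence a drop of at least
     [6 / m * f m.+1]. By [scale_ratio], [f / E] cannot grow in that case. *)
  have [N _ HN] : \forall m \near \oo, f m.+1 <= 2 * K2 * E m.+1 \/
                    (1 + 6 / m%:R) * f m.+1 <= f m.
    near=> m.
    have m1 : 6 <= m%:R :> R by rewrite ler_nat; near: m; exact: nbhs_infty_ge.
    have H1 : f m.+1 <= f m - c * (h m * p m) by near: m.
    have H2 : `|e m.+1| <= C * (p m + E m) by near: m.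
    have H4 : E m <= (1 + 6 / m%:R) * E m.+1 by near: m; exact: (scale_ratio S).
    have H5 : 12 * C / c <= m%:R * h m by near: m; exact: (scale_step S).
    have H6 := scale_pos S m.+1.
    have H6' := scale_pos S m.
    have H7 : e m.+1 <= C * (p m + E m) by apply: le_trans H2; rewrite ler_norm.
    have H8 : E m.+1 <= E m by near: m.
    have [H|/ltW H] := leP (f m.+1) (K2 * E m); [left|right].
      apply: le_trans H _; rewrite -mulrA mulrCA ler_pM2l; last by rewrite /K2; nra.
      apply: le_trans H4 _; rewrite ler_pM2r //.
      have : 6 / m%:R <= 1 :> R by rewrite ler_pdivrMr ?mul1r // (lt_le_trans _ m1).
      lra.
    have H9 : f m.+1 <= 2 * C * p m.
      have : K * E m.+1 <= K * E m by rewrite ler_pM2l.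
      by rewrite /f /K2 in H *; nra.
    have mp : 0 < m%:R :> R by apply: lt_le_trans m1.
    have H10 : 12 * C <= c * (m%:R * h m) by rewrite [leRHS]mulrC -ler_pdivrMr.
    have H11 : 6 * f m.+1 <= m%:R * (c * (h m * p m)).
      apply: (@le_trans _ _ (12 * C * p m)); first by have := p0 m; nra.
      have -> : m%:R * (c * (h m * p m)) = (c * (m%:R * h m)) * p m by ring.
      by rewrite ler_wpM2r.
    have H12 : 6 / m%:R * f m.+1 <= c * (h m * p m).
      by rewrite mulrAC ler_pdivrMr // [_ * m%:R]mulrC.
    lra.
  have [N1 _ HN1] : \forall m \near \oo, E m <= (1 + 6 / m%:R) * E m.+1.
    exact: (scale_ratio S).
  pose m0 := maxn N N1.
  exists (Num.max (f m0 / E m0) (2 * K2)); exists m0 => // m /=.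
  elim: m => [|m IH]; first rewrite leqn0 => /eqP.
    by move=> <-; rewrite -ler_pdivrMr ?(scale_pos S) // le_max lexx.
  rewrite leq_eqVlt => /predU1P[<-|].
    by rewrite -ler_pdivrMr ?(scale_pos S) // le_max lexx.
  rewrite ltnS => m0m.
  case: (HN m (leq_trans (leq_maxl _ _) m0m)) => H.
    by apply: le_trans H _; rewrite ler_pM2r ?(scale_pos S) // le_max lexx orbT.
  have q0 : 0 < 1 + 6 / m%:R :> R by rewrite ltr_wpDr // divr_ge0.
  rewrite -(ler_pM2l q0); apply: le_trans H _; apply: le_trans (IH m0m) _.
  rewrite [leRHS]mulrCA; apply: ler_wpM2l.
    by rewrite le_max; apply/orP; right; rewrite /K2; lra.
  by apply: HN1; apply: leq_trans m0m; rewrite leq_maxr.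
have [C' fC'] := fE; exists (C' / c); near=> m.
have H1 : f m.+1 <= f m - c * (h m * p m) by near: m.
have H2 : 0 <= f m.+1 by near: m; exact: (eventually_natS f0).
have H3 : f m <= C' * E m by near: m.
rewrite mulrAC ler_pdivlMr // mulrC; lra.
Unshelve. all: by end_near. Qed.

End Sequences.

(** * Real polynomials near the origin *)

Section Polynomials.
Context {R : realType}.

Lemma poly_lipschitz (p : {poly R}) : exists2 L : R, 0 <= L &
  forall x y : R, 0 <= x <= 1 -> 0 <= y <= 1 ->
    `|p.[x]| <= L /\ `|p.[x] - p.[y]| <= L * `|x - y|.
Proof.
elim/poly_ind: p => [|p a [L L0 HL]].
  by exists 0 => // x y _ _; rewrite !horner0 subrr normr0 mul0r.
exists (2 * L + `|a|) => [|x y x01 y01]; first by rewrite addr_ge0 // mulr_ge0.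
have [px pxy] := HL x y x01 y01; have a0 := normr_ge0 a.
have xle1 : `|x| <= 1 by rewrite ger0_norm; case/andP: x01.
have yle1 : `|y| <= 1 by rewrite ger0_norm; case/andP: y01.
rewrite !hornerMXaddC; split.
  apply: le_trans (ler_normD _ _) _; rewrite lerD2r normrM.
  by apply: le_trans (ler_pM _ _ px xle1) _ => //; lra.
have -> : p.[x] * x + a - (p.[y] * y + a) = p.[x] * (x - y) + (p.[x] - p.[y]) * y.
  by ring.
apply: le_trans (ler_normD _ _) _; rewrite !normrM.
have h0 := normr_ge0 (x - y).
have : `|p.[x]| * `|x - y| <= L * `|x - y| by rewrite ler_wpM2r.
have : `|p.[x] - p.[y]| * `|y| <= L * `|x - y| * 1 by apply: ler_pM.
have : 0 <= `|a| * `|x - y| by rewrite mulr_ge0.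
nra.
Qed.

Lemma poly_near0 (p : {poly R}) : p != 0 ->
  exists q b (c C r : R), [/\ (q < size p)%N, 0 < c, 0 < C, 0 < r &
    forall x y : R, 0 < x <= r -> 0 <= y <= x ->
     [/\ c * x ^+ q <= (-1) ^+ (b : bool) * p.[x], `|p.[x]| <= C * x ^+ q &
         x * `|p.[x] - p.[y]| <= C * x ^+ q * (x - y)]].
Proof.
elim/poly_ind: p => [|p a IH]; first by rewrite eqxx.
have [-> pX0|a0 _] := eqVneq a 0.
  have {pX0} p0 : p != 0 by apply: contraNneq pX0 => ->; rewrite mul0r addr0.
  have [q [b [c [C [r [qp c0 C0 r0 H]]]]]] := IH p0.
  exists q.+1, b, c, (2 * C), r; split=> //; first by rewrite addr0 size_mulX.
    by rewrite mulr_gt0.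
  move=> x y xr yx; have [x0 _] := andP xr; have [y0 yx'] := andP yx.
  have [H1 H2 H3] := H x y xr yx; rewrite polyC0 addr0 !hornerMX !exprS.
  have xq : 0 <= C * x ^+ q by rewrite mulr_ge0 ?exprn_ge0 // ltW.
  have -> : (-1) ^+ b * (p.[x] * x) = x * ((-1) ^+ b * p.[x]) by ring.
  have -> : c * (x * x ^+ q) = x * (c * x ^+ q) by ring.
  split; first by rewrite ler_pM2l.
    rewrite normrM (gtr0_norm x0).
    have : `|p.[x]| * x <= C * x ^+ q * x by rewrite ler_pM2r.
    nra.
  have -> : p.[x] * x - p.[y] * y = p.[x] * (x - y) + (p.[x] - p.[y]) * y by ring.
  have xy0 : 0 <= x - y by rewrite subr_ge0.
  have h1 : `|p.[x] * (x - y) + (p.[x] - p.[y]) * y| <=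
         `|p.[x]| * (x - y) + `|p.[x] - p.[y]| * y.
    by apply: le_trans (ler_normD _ _) _; rewrite !normrM (ger0_norm xy0) (ger0_norm y0).
  have h2 : `|p.[x]| * (x - y) <= C * x ^+ q * (x - y) by rewrite ler_wpM2r.
  have h3 : x * `|p.[x] - p.[y]| * y <= C * x ^+ q * (x - y) * x.
    by apply: ler_pM => //; rewrite mulr_ge0 // ltW.
  have h4 : x * `|p.[x] * (x - y) + (p.[x] - p.[y]) * y| <=
            x * (`|p.[x]| * (x - y) + `|p.[x] - p.[y]| * y) by rewrite ler_pM2l.
  have h5 : x * (`|p.[x]| * (x - y)) <= x * (C * x ^+ q * (x - y)) by rewrite ler_pM2l.
  lra.
have [L L0 HL] := poly_lipschitz p.
pose A := `|a|; have A0 : 0 < A by rewrite /A normr_gt0.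
(* On this interval the part without constant term is at most half of the constant term. *)
pose r := Num.min 1 (A / (2 * (L + 1))).
have L1 : 0 < L + 1 by lra.
exists 0, (a < 0), (A / 2), (2 * (A + L)), r; split.
- by rewrite size_MXaddC (negbTE a0) andbF.
- by rewrite divr_gt0.
- by lra.
- by rewrite lt_min ltr01 divr_gt0 // mulr_gt0.
move=> x y /andP[x0]; rewrite le_min => /andP[x1 xA] /andP[y0 yx].
have x01 : 0 <= x <= 1 by rewrite ltW.
have y01 : 0 <= y <= 1 by rewrite y0 (le_trans yx).
have [px pxy] := HL x y x01 y01.
have Lx : L * x <= A / 2.
  have : x * (2 * (L + 1)) <= A by rewrite -ler_pdivlMr // mulr_gt0.
  nra.
rewrite !hornerMXaddC expr0 !mulr1.
have pxx : `|p.[x] * x| <= A / 2.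
  rewrite normrM (gtr0_norm x0); apply: le_trans Lx.
  by rewrite ler_pM2r.
have := ler_norm (p.[x] * x); have := ler_norm (- (p.[x] * x)); rewrite normrN => n1 n2.
split.
- rewrite /A in pxx *; have [a_lt|a_ge] := ltP a 0.
    by rewrite expr1 mulN1r (ltr0_norm a_lt) in pxx *; lra.
  by rewrite expr0 mul1r (ger0_norm a_ge) in pxx *; lra.
- apply: le_trans (ler_normD _ _) _; rewrite -/A; lra.
have -> : p.[x] * x + a - (p.[y] * y + a) = p.[x] * (x - y) + (p.[x] - p.[y]) * y.
  by ring.
have xy0 : 0 <= x - y by rewrite subr_ge0.
rewrite (ger0_norm xy0) in pxy.
have h1 : `|p.[x] * (x - y) + (p.[x] - p.[y]) * y| <=
       `|p.[x]| * (x - y) + `|p.[x] - p.[y]| * y.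
  by apply: le_trans (ler_normD _ _) _; rewrite !normrM (ger0_norm xy0) (ger0_norm y0).
have h2 : `|p.[x]| * (x - y) <= L * (x - y) by rewrite ler_wpM2r.
have h3 : `|p.[x] - p.[y]| * y <= L * (x - y) * 1.
  by apply: ler_pM => //; case/andP: y01.
have h4 : x * `|p.[x] * (x - y) + (p.[x] - p.[y]) * y| <=
    1 * (2 * L * (x - y)) by apply: ler_pM => //; [exact: ltW | lra].
have : 0 <= A * (x - y) by rewrite mulr_ge0 // ltW.
lra.
Qed.

End Polynomials.

(** * Barriers that a dissipating sequence crosses in one direction only *)

Section Levels.
Local Open Scope classical_set_scope.
Context {R : realType}.

(** Applied to the difference of a barrier and a level: their order is eventually fixed, their
    distance dominates [E], and this distance changes per step by a relative amount of order
    [1 / m]. *)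
Definition tame (E g : nat -> R) : Prop :=
  (exists b : bool, forall K : R, \forall m \near \oo, K * E m <= (-1) ^+ b * g m) /\
  (\forall C \near +oo, \forall m \near \oo, `|g m.+1 - g m| <= C / m%:R * `|g m|).

Lemma tame_norm (E g : nat -> R) : tame E g ->
  forall K : R, \forall m \near \oo, K * E m <= `|g m|.
Proof.
move=> [[b Hb] _] K; near=> m.
have H : K * E m <= (-1) ^+ b * g m by near: m; exact: Hb.
apply: le_trans H _; apply: le_trans (ler_norm _) _.
by rewrite normrM normrX normrN1 expr1n mul1r.
Unshelve. all: by end_near. Qed.

Lemma crossing h (E x p : nat -> R) (I : finType) (a : I -> nat -> R) (i : nat -> I)
    (chi : nat -> R) (c C : R) :
  step_scales h E -> 0 < c -> 0 < C -> (forall m, 0 <= p m) ->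
  (\forall m \near \oo,
     x m.+1 <= x m - c * (h m * p m) + (a (i m) m.+1 - a (i m) m) + C * (E m / m%:R)) ->
  (\forall m \near \oo, `|x m.+1 - a (i m) m.+1| <= C * (p m + E m)) ->
  (forall j, tame E (fun m => chi m - a j m)) ->
  (\forall m \near \oo, x m < chi m) \/ (\forall m \near \oo, chi m <= x m).
Proof.
move=> S c0 C0 p0 drop size T.
have [K [K1 TK]] : exists K : R, 1 <= K /\ forall j, \forall m \near \oo,
    `|(chi m.+1 - a j m.+1) - (chi m - a j m)| <= K / m%:R * `|chi m - a j m|.
  have /filter_ex[K [HK TK]] : \forall K \near +oo, 1 <= K /\ forall j, \forall m \near \oo,
    `|(chi m.+1 - a j m.+1) - (chi m - a j m)| <= K / m%:R * `|chi m - a j m|.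
    near=> K; split; first by near: K; exact: nbhs_pinfty_ge.
    by near: K; apply: filter_forall => j; exact: (T j).2.
  by exists K.
have stay : \forall m \near \oo, x m < chi m -> x m.+1 < chi m.+1.
  near=> m => xchi; rewrite ltNge; apply/negP => xchi'.
  have m4K : 8 * K <= m%:R :> R by near: m; exact: nbhs_infty_ger.
  have m0 : 0 < m%:R :> R by apply: lt_le_trans m4K; lra.
  have drop' : x m.+1 <= x m - c * (h m * p m) + (a (i m) m.+1 - a (i m) m) +
      C * (E m / m%:R) by near: m.
  have size' : `|x m.+1 - a (i m) m.+1| <= C * (p m + E m) by near: m.
  have DE' j : (8 * (C + 1)) * E m <= `|chi m - a j m|.
    by move: j; near: m; apply: filter_forall => j'; exact: (tame_norm (T j')).
  have TD' j : `|(chi m.+1 - a j m.+1) - (chi m - a j m)| <= K / m%:R * `|chi m - a j m|.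
    by move: j; near: m; apply: filter_forall => j'; exact: TK.
  have step : 8 * C * (K + 1) / c <= m%:R * h m by near: m; exact: (scale_step S).
  move: (i m) drop' size' (DE' (i m)) (TD' (i m)) => j drop' size' DE TD {DE' TD'}.
  set D := `|chi m - a j m| in DE TD.
  have E0 := scale_pos S m.
  have CE0 : 0 < C * E m by rewrite mulr_gt0.
  have D0 : 0 < D by apply: lt_le_trans DE; rewrite mulr_gt0 //; lra.
  have Em : C * (E m / m%:R) <= D / 8.
    have : E m / m%:R <= E m by rewrite ler_pdivrMr // ler_peMr ?(ltW E0) //; lra.
    by move=> /(ler_wpM2l (ltW C0)); lra.
  have KD : K / m%:R * D <= D / 8.
    have Km : K / m%:R <= 1 / 8 by rewrite ler_pdivrMr //; lra.
    by have := ler_wpM2r (ltW D0) Km; lra.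
  have /ler_normlP[TD1 TD2] := TD.
  have hp0 : 0 <= c * (h m * p m).
    apply: mulr_ge0; [exact: ltW | apply: mulr_ge0 => //].
    rewrite -(pmulr_rge0 _ m0) (le_trans _ step) // divr_ge0 ?(ltW c0) //.
    by rewrite !mulr_ge0 ?(ltW C0) //; lra.
  (* If the level is below [chi], then [x m.+1] is far from it because [x m.+1 >= chi m.+1]. If the
     level is above, the descent from [x m < chi m] keeps [x m.+1] far below the level. *)
  have lowp : D / 8 <= C * p m.
    have := size'; case/ler_normlP => s1 s2.
    have Ddef : D <= chi m - a j m \/ D <= - (chi m - a j m).
      by rewrite /D; case: (leP 0 (chi m - a j m)) => H;
        [left; rewrite ger0_norm | right; rewrite ltr0_norm].
    case: Ddef => Ddef; lra.
  have : c * (h m * p m) <= K / m%:R * D + C * (E m / m%:R) by lra.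
  have : C * (E m / m%:R) <= (D / 8) / m%:R by rewrite mulrA ler_pM2r ?invr_gt0 //; lra.
  move=> q1 q2; have q3 : c * (h m * p m) * m%:R <= K * D + D / 8.
    have : c * (h m * p m) <= (K * D + D / 8) / m%:R by lra.
    by rewrite ler_pdivlMr.
  have q4 : 8 * C * (K + 1) <= c * (m%:R * h m) by rewrite [leRHS]mulrC -ler_pdivrMr.
  have q5 : 8 * C * (K + 1) * p m <= c * (m%:R * h m) * p m by rewrite ler_wpM2r.
  have q6 : (K + 1) * (D / 8) <= (K + 1) * (C * p m) by rewrite ler_wpM2l //; lra.
  lra.
have [H|H] := pselect (forall N, exists2 m, (N <= m)%N & x m < chi m).
  by left; exact: eventually_ind stay H.
right; move/existsNP: H => [N HN]; exists N => // m /= Nm.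
by rewrite leNgt; apply/negP => xm; apply: HN; exists m.
Unshelve. all: by end_near. Qed.

End Levels.

(** * Comparison with a single level *)

Section NearestLevel.
Local Open Scope classical_set_scope.
Context {R : realType}.

Record smoothing_scales (E mu : nat -> R) (Q : nat) : Prop := SmoothingScales {
  smoothing_pos : \forall m \near \oo, 0 < mu m;
  smoothing_small : forall r : R, 0 < r -> \forall m \near \oo, mu m <= r;
  smoothing_decr : \forall m \near \oo, mu m.+1 <= mu m;
  smoothing_step : \forall m \near \oo, mu m - mu m.+1 <= mu m / m%:R;
  smoothing_exp : forall K : R, \forall m \near \oo, K * E m <= mu m ^+ Q }.

(** The order of vanishing of [p] at 0 is at most [Q], so [p] is at least a multiple of [mu ^ Q],
    which dominates [E]. Its relative variation is of the order of that of [mu], hence of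
    [1 / m]. *)
Lemma poly_tame (E mu : nat -> R) Q (p : {poly R}) : smoothing_scales E mu Q ->
  p != 0 -> (size p <= Q.+1)%N -> tame E (fun m => p.[mu m]).
Proof.
move=> S p0 pQ; have [q [b [c [C [r [qp c0 C0 r0 H]]]]]] := poly_near0 p0.
have qQ : (q <= Q)%N by rewrite -ltnS (leq_trans qp).
split.
  exists b => K; near=> m.
  have m0 : 0 < mu m by near: m; exact: (smoothing_pos S).
  have mr : mu m <= r by near: m; exact: (smoothing_small S).
  have m1 : mu m <= 1 by near: m; exact: (smoothing_small S).
  have KE : K / c * E m <= mu m ^+ Q by near: m; exact: (smoothing_exp S).
  have [||H1 _ _] := H (mu m) 0; rewrite ?m0 ?lexx //=; first exact: ltW.
  apply: le_trans H1; rewrite -ler_pdivrMl // mulrA [_ * K]mulrC.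
  by apply: le_trans KE _; rewrite ler_wiXn2l // ltW.
near=> C'; near=> m.
have m0 : 0 < mu m by near: m; exact: (smoothing_pos S).
have m0' : 0 < mu m.+1 by near: m; exact: (eventually_natS (smoothing_pos S)).
have mr : mu m <= r by near: m; exact: (smoothing_small S).
have mm : mu m.+1 <= mu m by near: m; exact: (smoothing_decr S).
have ms : mu m - mu m.+1 <= mu m / m%:R by near: m; exact: (smoothing_step S).
have n0 : 0 < m%:R :> R by rewrite ltr0n; near: m; exact: nbhs_infty_gt.
have CC : C / c <= C' by near: C'; apply: nbhs_pinfty_ge; exact: num_real.
have [||H1 _ H3] := H (mu m) (mu m.+1); rewrite ?m0 ?mm ?(ltW m0') //=.
rewrite distrC -(ler_pM2l m0); apply: le_trans H3 _.
have q0 : 0 <= mu m ^+ q by rewrite exprn_ge0 // ltW.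
have H1' : c * mu m ^+ q <= `|p.[mu m]|.
  by apply: le_trans H1 _; apply: le_trans (ler_norm _) _;
    rewrite normrM normrX normrN1 expr1n mul1r.
have H2 : C * mu m ^+ q * (mu m - mu m.+1) <= C * mu m ^+ q * (mu m / m%:R).
  by rewrite ler_wpM2l // mulr_ge0 // ltW.
apply: le_trans H2 _.
have -> : mu m * (C' / m%:R * `|p.[mu m]|) = C' * `|p.[mu m]| * (mu m / m%:R) by ring.
rewrite ler_pM2r ?divr_gt0 //.
apply: (@le_trans _ _ (C / c * `|p.[mu m]|)); last by rewrite ler_wpM2r.
rewrite mulrAC ler_pdivlMr // -mulrA [_ * c]mulrC; exact/ler_wpM2l/H1'/ltW.
Unshelve. all: by end_near. Qed.

(** Supplies the weight of a barrier between two levels. A weight above 1/2 puts the barrier beyond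
    the midpoint, and avoiding finitely many values keeps it distinct from every level. *)
Lemma avoid_near1 (s : seq R) :
  exists2 t : R, 1 / 2 < t < 1 & forall u, u \in s -> u != t.
Proof.
suff [t0 [t01 H]] : exists t0 : R, 1 / 2 <= t0 < 1 /\
    forall u, u \in s -> (u <= t0) || (1 <= u).
  exists ((t0 + 1) / 2) => [|u /H/orP[]]; first lra.
    by move=> ut; apply/eqP => E; lra.
  by move=> ut; apply/eqP => E; lra.
elim: s => [|v s [t0 [t01 H]]]; first by exists (1 / 2); split => //; lra.
exists (if v < 1 then Num.max t0 v else t0); split.
  case: ifP => // v1; rewrite le_max gt_max v1 !andbT; case/andP: t01 => -> ->.
  by [].
move=> u; rewrite inE => /predU1P[->|/H /orP[uv|->]]; last by rewrite orbT.
  by case: ltP => v1; rewrite ?le_max ?lexx ?orbT.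
by case: ifP; rewrite ?le_max uv.
Qed.

(** A pigeonhole argument. The nearest level could still alternate; [crossing] later turns
    infinitely often into eventually. *)
Lemma nearest_infinitely_often (I : finType) (i0 : I) (D : I -> nat -> R) :
  exists j, forall N, exists2 m, (N <= m)%N & forall i, D j m <= D i m.
Proof.
apply: contrapT => H.
have /choice[N HN] : forall j, exists N, forall m, (N <= m)%N -> ~ (forall i, D j m <= D i m).
  move=> j; apply: contrapT => H1; apply: H; exists j => N.
  apply: contrapT => H2; apply: H1; exists N => m Nm H3; apply: H2; by exists m.
pose m := (\max_j N j)%N; pose j := [arg min_(j < i0) D j m]%O.
apply: (HN j m); first exact: leq_bigmax.
by move=> i; rewrite /j; case: arg_minP => // k _; exact.
Qed.

Lemma level_dissipation h (E mu : nat -> R) Q (I : finType) (phi : I -> {poly R})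
    (i : nat -> I) (x p : nat -> R) (c C b : R) :
  step_scales h E -> smoothing_scales E mu Q -> 0 < c -> 0 < C ->
  (forall j, (size (phi j) <= Q.+1)%N) ->
  (forall m, b <= x m) -> (forall m, 0 <= p m) ->
  (\forall m \near \oo,
     x m.+1 <= x m - c * (h m * p m) +
       ((phi (i m)).[mu m.+1] - (phi (i m)).[mu m]) + C * (E m / m%:R)) ->
  (\forall m \near \oo, `|x m.+1 - (phi (i m)).[mu m.+1]| <= C * (p m + E m)) ->
  exists C', \forall m \near \oo, h m * p m <= C' * E m.
Proof.
move=> Sh Smu c0 C0 sphi xb p0 drop size.
have [j Hj] := nearest_infinitely_often (i 0%N) (fun j m => `|x m - (phi j).[mu m]|).
(* Eventually [x] stays on the side of level [j] of a barrier strictly between the levels [j] and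
   [k], so its distance to level [k] is at least a fixed fraction of their separation. *)
have far k : exists2 K : R, 0 <= K & \forall m \near \oo,
    `|(phi k).[mu m] - (phi j).[mu m]| <= K * `|x m - (phi k).[mu m]|.
  have [->|jk] := eqVneq (phi k) (phi j).
    by exists 0 => //; near=> m; rewrite subrr normr0 mul0r.
  pose D := phi k - phi j; have D0 : D != 0 by rewrite subr_eq0.
  (* The only weight, if there is one, at which the barrier would coincide with level [l]; it is
     unique since [D] is nonzero. *)
  pose f l := xget 0 [set t : R | phi l = phi j + t *: D].
  have [t t1 Ht] := avoid_near1 (map f (enum I)).
  pose chi := phi j + t *: D.
  have chiP l : tame E (fun m => chi.[mu m] - (phi l).[mu m]).
    have -> : (fun m => chi.[mu m] - (phi l).[mu m]) = (fun m => (chi - phi l).[mu m]).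
      by apply: funext => m; rewrite !hornerE.
    apply: (poly_tame Smu).
      rewrite subr_eq0; apply/eqP => chil.
      have xl : f l \in map f (enum I) by apply: map_f; rewrite mem_enum.
      have /eqP := Ht _ xl; apply.
      rewrite /f; case: xgetP => [u _ /= lu|/(_ t) nt]; last by case: nt; rewrite /= -chil.
      apply/eqP; move: lu; rewrite -chil /chi => /addrI/eqP.
      by rewrite -subr_eq0 -scalerBl scaler_eq0 (negbTE D0) orbF subr_eq0 eq_sym.
    rewrite (leq_trans (size_polyD _ _)) // size_polyN geq_max sphi andbT.
    rewrite (leq_trans (size_polyD _ _)) // geq_max sphi /=.
    rewrite (leq_trans (size_scale_leq _ _)) //.
    by rewrite (leq_trans (size_polyD _ _)) // size_polyN geq_max !sphi.
  have chiE m : chi.[mu m] = (phi j).[mu m] + t * ((phi k).[mu m] - (phi j).[mu m]).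
    by rewrite !hornerE.
  have [[s Hs] _] : tame E (fun m => D.[mu m]).
    apply: (poly_tame Smu) => //.
    by rewrite (leq_trans (size_polyD _ _)) // size_polyN geq_max !sphi.
  have Dpos : \forall m \near \oo, 0 < (-1) ^+ s * D.[mu m].
    have := Hs 1; apply: filterS => m; rewrite mul1r; apply: lt_le_trans.
    exact: (scale_pos Sh).
  have t10 : 0 < 1 - t by case/andP: t1; lra.
  exists (1 - t)^-1; first by rewrite invr_ge0 ltW.
  have [Nd _ HNd] := Dpos.
  have cr := crossing Sh c0 C0 p0 drop size chiP.
  have Dsub m : D.[mu m] = (phi k).[mu m] - (phi j).[mu m] by rewrite !hornerE.
  have done m : (1 - t) * `|(phi k).[mu m] - (phi j).[mu m]| <= `|x m - (phi k).[mu m]| ->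
      `|(phi k).[mu m] - (phi j).[mu m]| <= (1 - t)^-1 * `|x m - (phi k).[mu m]|.
    by rewrite ler_pdivlMl.
  case: s Hs Dpos HNd => Hs Dpos HNd; rewrite ?expr1 ?expr0 in Dpos HNd.
  (* Here level [k] lies below level [j]. At a time when [j] is nearest, [x] is above the midpoint
     and hence above the barrier, which rules out the other alternative of [crossing]. *)
  - have above : \forall m \near \oo, chi.[mu m] <= x m.
      case: cr => // -[N _ HN].
      have [m Nm near] := Hj (maxn N Nd); move: (near k).
      have := HN m (leq_trans (leq_maxl _ _) Nm).
      have := HNd m (leq_trans (leq_maxr _ _) Nm).
      rewrite /= mulN1r Dsub chiE.
      move: (phi k).[mu m] (phi j).[mu m] => u v uv xl.
      have : (v - u) / 2 < t * (v - u) by rewrite mulrC ltr_pM2r; lra.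
      have [xu|xu] := leP 0 (x m - u); last first.
        by rewrite (ltr0_norm xu) => tp /ler_normlP[]; lra.
      by rewrite (ger0_norm xu) => tp /ler_normlP[]; lra.
    near=> m; apply: done.
    have A : chi.[mu m] <= x m by near: m.
    have B : 0 < (-1) * D.[mu m] by near: m.
    move: A B; rewrite mulN1r chiE Dsub.
    move: (phi k).[mu m] (phi j).[mu m] => u v A B.
    by rewrite ler0_norm ?(le_trans _ (ler_norm _)) //; lra.
  have below : \forall m \near \oo, x m < chi.[mu m].
    case: cr => // -[N _ HN].
    have [m Nm near] := Hj (maxn N Nd); move: (near k).
    have := HN m (leq_trans (leq_maxl _ _) Nm).
    have := HNd m (leq_trans (leq_maxr _ _) Nm).
    rewrite /= mul1r Dsub chiE.
    move: (phi k).[mu m] (phi j).[mu m] => u v uv xl.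
    have : (u - v) / 2 < t * (u - v) by rewrite mulrC ltr_pM2r; lra.
    have [xu|xu] := leP 0 (x m - u); last first.
      by rewrite (ltr0_norm xu) => tp /ler_normlP[]; lra.
    by rewrite (ger0_norm xu) => tp /ler_normlP[]; lra.
  near=> m; apply: done.
  have A : x m < chi.[mu m] by near: m.
  have B : 0 < 1 * D.[mu m] by near: m.
  move: A B; rewrite mul1r chiE Dsub.
  move: (phi k).[mu m] (phi j).[mu m] => u v A B.
  rewrite ger0_norm; last lra.
  by rewrite -normrN (le_trans _ (ler_norm _)) //; lra.
have [K [K0 HK]] : exists K : R, 0 < K /\ forall k, \forall m \near \oo,
    `|(phi k).[mu m] - (phi j).[mu m]| <= K * `|x m - (phi k).[mu m]|.
  have /filter_ex[K HK] : \forall K \near +oo, 0 < K /\ forall k, \forall m \near \oo,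
      `|(phi k).[mu m] - (phi j).[mu m]| <= K * `|x m - (phi k).[mu m]|.
    near=> K; split; first by near: K; exact: nbhs_pinfty_gt.
    near: K; apply: filter_forall => k; have [K K0 HK] := far k.
    near=> K'; near=> m.
    have H1 : `|(phi k).[mu m] - (phi j).[mu m]| <= K * `|x m - (phi k).[mu m]| by near: m.
    by apply: le_trans H1 _; rewrite ler_wpM2r //; near: K'; apply: nbhs_pinfty_ge; exact: num_real.
  by exists K.
have [T [T0 HT]] : exists T : R, 0 < T /\ forall k, \forall m \near \oo,
    `|((phi k).[mu m.+1] - (phi j).[mu m.+1]) - ((phi k).[mu m] - (phi j).[mu m])|
      <= T / m%:R * `|(phi k).[mu m] - (phi j).[mu m]|.
  have /filter_ex[T HT] : \forall T \near +oo, 0 < T /\ forall k, \forall m \near \oo,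
      `|((phi k).[mu m.+1] - (phi j).[mu m.+1]) - ((phi k).[mu m] - (phi j).[mu m])|
      <= T / m%:R * `|(phi k).[mu m] - (phi j).[mu m]|.
    near=> T; split; first by near: T; exact: nbhs_pinfty_gt.
    near: T; apply: filter_forall => k.
    have [jk|jk] := eqVneq (phi k) (phi j).
      by near=> T; near=> m; rewrite jk !subrr normr0 mulr0.
    have [_] : tame E (fun m => (phi k - phi j).[mu m]).
      apply: (poly_tame Smu); first by rewrite subr_eq0.
      by rewrite (leq_trans (size_polyD _ _)) // size_polyN geq_max !sphi.
    apply: filterS => T; apply: filterS => m.
    by rewrite !hornerE.
  by exists T.
have [L HL] : exists L : R, \forall m \near \oo, `|(phi j).[mu m]| <= L.
  have [L L0 HL] := poly_lipschitz (phi j).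
  exists L; near=> m.
  have m0 : 0 < mu m by near: m; exact: (smoothing_pos Smu).
  have m1 : mu m <= 1 by near: m; exact: (smoothing_small Smu).
  have m01 : 0 <= mu m <= 1 by rewrite ltW.
  by case: (HL _ _ m01 m01).
(* Replacing the current level by level [j] changes the drift by at most [T / m * |g|], where [|g|
   <= 2 * |g'| <= 2 * K * C * (p m + E m)]. *)
pose A := 2 * T * K * C; have A0 : 0 < A by rewrite /A !mulr_gt0.
apply: (@dissipation_rate _ h E (fun m => x m - (phi j).[mu m]) p (c / 2)
  (C + A + (1 + K) * C) (b - L)) => //.
- by rewrite divr_gt0.
- by rewrite addr_gt0 ?mulr_gt0 // ?addr_gt0.
- near=> m.
  have : `|(phi j).[mu m]| <= L by near: m.
  by move=> /ler_normlP[_ H]; have := xb m; lra.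
- near=> m.
  have m0 : 0 < m%:R :> R by rewrite ltr0n; near: m; exact: nbhs_infty_gt.
  have m2T : 2 * T <= m%:R by near: m; exact: nbhs_infty_ger.
  have drop' : x m.+1 <= x m - c * (h m * p m) +
    ((phi (i m)).[mu m.+1] - (phi (i m)).[mu m]) + C * (E m / m%:R) by near: m.
  have size' : `|x m.+1 - (phi (i m)).[mu m.+1]| <= C * (p m + E m) by near: m.
  have HT' k : `|((phi k).[mu m.+1] - (phi j).[mu m.+1]) -
        ((phi k).[mu m] - (phi j).[mu m])|
      <= T / m%:R * `|(phi k).[mu m] - (phi j).[mu m]|.
    by move: k; near: m; apply: filter_forall => k; exact: HT.
  have HK' k : `|(phi k).[mu m.+1] - (phi j).[mu m.+1]| <=
      K * `|x m.+1 - (phi k).[mu m.+1]|.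
    by move: k; near: m; apply: filter_forall => k; exact: (eventually_natS (HK k)).
  have step : 2 * A / c <= m%:R * h m by near: m; exact: (scale_step Sh).
  move: (i m) drop' size' (HT' (i m)) (HK' (i m)) => k drop' size' {}HT' {}HK'.
  set g := (phi k).[mu m] - (phi j).[mu m] in HT'.
  set g' := (phi k).[mu m.+1] - (phi j).[mu m.+1] in HT' HK'.
  have gg' : `|g| <= 2 * `|g'|.
    have Tm : T / m%:R <= 1 / 2 by rewrite ler_pdivrMr //; lra.
    have := ler_wpM2r (normr_ge0 g) Tm.
    by have := ler_normB g' (g' - g); rewrite subKr; lra.
  have gp : `|g'| <= K * (C * (p m + E m)).
    by apply: le_trans HK' _; rewrite ler_pM2l.
  have dg : g' - g <= A * (p m + E m) / m%:R.
    apply: le_trans (ler_norm _) _; apply: le_trans HT' _.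
    rewrite mulrAC ler_pM2r ?invr_gt0 // /A.
    have : T * `|g| <= T * (2 * (K * (C * (p m + E m)))) by rewrite ler_pM2l //; lra.
    lra.
  (* The part of the drift proportional to [p] is absorbed by half of the dissipation, because
     [m * h m] is unbounded. *)
  have Ap : A * p m / m%:R <= c / 2 * (h m * p m).
    rewrite ler_pdivrMr //.
    have : 2 * A <= c * (m%:R * h m) by rewrite [leRHS]mulrC -ler_pdivrMr.
    by move=> /(ler_wpM2r (p0 m)); lra.
  have Em : 0 <= E m / m%:R by rewrite divr_ge0 // ltW // (scale_pos Sh).
  have : 0 <= (1 + K) * C * (E m / m%:R).
    by rewrite mulr_ge0 // mulr_ge0 // ?(ltW C0) //; lra.
  have Asplit : A * (p m + E m) / m%:R = A * p m / m%:R + A * (E m / m%:R) by ring.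
  rewrite Asplit in dg.
  rewrite /g /g' in dg *; lra.
near=> m.
have size' : `|x m.+1 - (phi (i m)).[mu m.+1]| <= C * (p m + E m) by near: m.
have HK' k : `|(phi k).[mu m.+1] - (phi j).[mu m.+1]| <=
    K * `|x m.+1 - (phi k).[mu m.+1]|.
  by move: k; near: m; apply: filter_forall => k; exact: (eventually_natS (HK k)).
apply: le_trans (ler_distD (phi (i m)).[mu m.+1] _ _) _.
have KC : K * `|x m.+1 - (phi (i m)).[mu m.+1]| <= K * (C * (p m + E m)).
  by rewrite ler_pM2l.
have : 0 <= (C + A) * (p m + E m).
  by rewrite mulr_ge0 ?addr_ge0 // ltW // (scale_pos Sh).
have := HK' (i m); lra.
Unshelve. all: by end_near. Qed.

End NearestLevel.

(** * The powers of the iteration counter *)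

Section PowerScales.
Local Open Scope classical_set_scope.
Context {R : realType}.

(* [m ^ -d], with value [1] at [m = 0] where [powR] would give [0]. *)
Definition invpow (d : R) (m : nat) : R := expR (- d * ln m%:R).

Lemma invpow_gt0 d m : 0 < invpow d m.
Proof. exact: expR_gt0. Qed.

Lemma invpowE d m : (0 < m)%N -> invpow d m = m%:R `^ (- d).
Proof. by move=> m0; rewrite /powR pnatr_eq0 gtn_eqF. Qed.

Lemma invpowX d m n : invpow d m ^+ n = invpow (n%:R * d) m.
Proof. by rewrite /invpow -expRM_natl mulrA mulrN. Qed.

Lemma natr_invpow d m : (0 < m)%N -> m%:R * invpow d m = invpow (d - 1) m.
Proof.
move=> m0; rewrite /invpow -[X in X * _](lnK (x := m%:R)) ?posrE ?ltr0n //.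
by rewrite -expRD; congr expR; ring.
Qed.

Lemma ln_infty (a : R) : \forall m \near \oo, a <= ln (m%:R : R).
Proof.
near=> m; rewrite -ler_expR lnK; first by near: m; exact: nbhs_infty_ger.
by rewrite posrE ltr0n; near: m; exact: nbhs_infty_gt.
Unshelve. all: by end_near. Qed.

Lemma invpow_small d (eps : R) : 0 < d -> 0 < eps -> \forall m \near \oo, invpow d m <= eps.
Proof.
move=> d0 eps0; near=> m; rewrite -[leRHS]lnK ?posrE // ler_expR.
rewrite mulNr lerNl -ler_pdivrMl //; near: m; exact: ln_infty.
Unshelve. all: by end_near. Qed.

Lemma invpow_large d (M : R) : d < 0 -> \forall m \near \oo, M <= invpow d m.
Proof.
move=> d0; near=> m; apply: (@le_trans _ _ (expR M)).
  by have := expR_ge1Dx M; lra.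
rewrite ler_expR -ler_pdivrMl ?oppr_gt0 //; near: m; exact: ln_infty.
Unshelve. all: by end_near. Qed.

Lemma invpow_ratio d m : (0 < m)%N ->
  invpow d m.+1 = invpow d m * expR (- d * ln (m.+1%:R / m%:R)).
Proof.
by move=> m0; rewrite /invpow -expRD ln_div ?posrE ?ltr0n //; congr expR; ring.
Qed.

Lemma ratio_between d e m : (0 < m)%N -> d <= e ->
  expR (- e * ln (m.+1%:R / m%:R)) <= expR (- d * ln (m.+1%:R / m%:R)) :> R.
Proof.
move=> m0 de; rewrite ler_expR ler_wpM2r ?lerN2 // ln_ge0 // ler_pdivlMr ?ltr0n //.
by rewrite mul1r ler_nat.
Qed.

Lemma ratio_nat n m : (0 < m)%N ->
  expR (- n%:R * ln (m.+1%:R / m%:R)) = (m%:R / m.+1%:R) ^+ n :> R.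
Proof.
move=> m0; rewrite mulNr expRN expRM_natl lnK ?posrE ?divr_gt0 ?ltr0n //.
by rewrite -exprVn invf_div.
Qed.

(** With [Q] the integer part of [1/d], [Q * d <= 1 < (Q+1) * d <= 2]. The first inequality gives
    [m^-1 <= invpow d m ^+ Q], the second [m * E m -> 0], and the third bounds the decay of [E] by
    that of [m^-2]. *)
Lemma power_scales (d : R) : 0 < d < 1 -> exists Q : nat,
  [/\ step_scales (invpow d) (fun m => invpow d m ^+ Q.+1),
      forall m, (0 < m)%N -> m%:R^-1 <= invpow d m ^+ Q &
      forall beta : R, 0 < beta ->
        smoothing_scales (fun m => invpow d m ^+ Q.+1) (fun m => beta * invpow d m) Q].
Proof.
case/andP=> d0 d1.
have [Q [Qd1 Qd2]] : exists Q : nat, Q%:R * d <= 1 /\ 1 < Q.+1%:R * d.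
  have i0 : 0 <= d^-1 by rewrite invr_ge0 ltW.
  exists (Num.truncn d^-1); have /andP[H1 H2] := truncn_itv i0.
  by rewrite -ler_pdivlMr // -ltr_pdivrMr // div1r.
have theta : Q.+1%:R * d <= 2 by move: Qd1; rewrite -natr1 mulrDl; lra.
have ratios m : (0 < m)%N ->
    [/\ m%:R / m.+1%:R <= expR (- d * ln (m.+1%:R / m%:R)) :> R,
     expR (- d * ln (m.+1%:R / m%:R)) <= 1 :> R,
     expR (- (Q.+1%:R * d) * ln (m.+1%:R / m%:R)) <= m%:R / m.+1%:R :> R &
     (m%:R / m.+1%:R) ^+ 2 <= expR (- (Q.+1%:R * d) * ln (m.+1%:R / m%:R)) :> R].
  move=> m0; have e n := ratio_nat n m0.
  split.
  - by rewrite -[leLHS]expr1 -e; apply: ratio_between => //; exact: ltW.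
  - by rewrite -[leRHS](expr0 (m%:R / m.+1%:R)) -e; apply: ratio_between => //; exact: ltW.
  - by rewrite -[leRHS]expr1 -e; apply: ratio_between => //; exact: ltW.
  - by rewrite -e; exact: ratio_between.
exists Q; split; [split|move=> m m0|move=> beta beta0; split].
- by move=> m; rewrite exprn_gt0 ?invpow_gt0.
- move=> M; near=> m; rewrite natr_invpow; last by near: m; exact: nbhs_infty_gt.
  by near: m; apply: invpow_large; rewrite subr_lt0.
- move=> eps eps0; near=> m.
  rewrite invpowX natr_invpow; last by near: m; exact: nbhs_infty_gt.
  by near: m; apply: invpow_small; rewrite ?subr_gt0.
- near=> m.
  have m0 : (0 < m)%N by near: m; exact: nbhs_infty_gt.
  have [_ _ H _] := ratios m m0; rewrite !invpowX (invpow_ratio _ m0).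
  have E0 := invpow_gt0 (Q.+1%:R * d) m.
  have := ler_wpM2l (ltW E0) H; set e := invpow _ m in E0 *.
  have m1 : 1 <= m%:R :> R by rewrite ler1n.
  move=> H1; rewrite ler_pdivrMr; last lra.
  have : m%:R / m.+1%:R <= 1 - 1 / (4 * m%:R) :> R.
    rewrite ler_pdivrMr ?ltr0n // -[m.+1%:R]natr1.
    have -> : (1 - 1 / (4 * m%:R)) * (m%:R + 1) =
      m%:R + 1 - (1 + m%:R^-1) / 4 :> R by field; apply/eqP; lra.
    have : m%:R^-1 <= 1 :> R by rewrite invf_le1 //; lra.
    lra.
  move=> /(ler_wpM2l (ltW E0)) H2.
  have : e * expR (- (Q.+1%:R * d) * ln (m.+1%:R / m%:R)) <= e * (1 - 1 / (4 * m%:R)).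
    exact: le_trans H1 H2.
  have -> : e * (1 - 1 / (4 * m%:R)) = e - e / (4 * m%:R) by field; apply/eqP; lra.
  set u := e * expR _ => u1.
  have : e / (4 * m%:R) <= e - u by lra.
  by rewrite ler_pdivrMr; lra.
- near=> m.
  have m0 : (0 < m)%N by near: m; exact: nbhs_infty_gt.
  have [_ _ _ H] := ratios m m0; rewrite !invpowX (invpow_ratio _ m0).
  have E0 := invpow_gt0 (Q.+1%:R * d) m.
  have m1 : 1 <= m%:R :> R by rewrite ler1n.
  rewrite mulrCA ler_peMr ?(ltW E0) //.
  have q0 : 0 < 1 + 6 / m%:R :> R by rewrite ltr_wpDr // divr_ge0.
  apply: le_trans (ler_wpM2l (ltW q0) H).
  have -> : (1 + 6 / m%:R) * (m%:R / m.+1%:R) ^+ 2 =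
      ((m%:R + 6) * m%:R) / (m.+1%:R ^+ 2) :> R.
    by rewrite -[m.+1%:R]natr1; field; apply/andP; split; apply/eqP; lra.
  rewrite ler_pdivlMr ?exprn_gt0 ?ltr0n // mul1r -[m.+1%:R]natr1; nra.
- have -> : m%:R^-1 = invpow 1 m :> R by rewrite invpowE // powR_inv1.
  rewrite invpowX /invpow ler_expR ler_wpM2r ?lerN2 // ln_ge0 //.
  by rewrite ler1n.
- by near=> m; rewrite mulr_gt0 ?invpow_gt0.
- move=> r r0; near=> m; rewrite -ler_pdivlMl //; near: m.
  by apply: invpow_small => //; rewrite mulr_gt0 ?invr_gt0.
- near=> m.
  have m0 : (0 < m)%N by near: m; exact: nbhs_infty_gt.
  have [_ H _ _] := ratios m m0; rewrite (invpow_ratio _ m0) ler_pM2l //.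
  by rewrite ger_pMr // invpow_gt0.
- near=> m.
  have m0 : (0 < m)%N by near: m; exact: nbhs_infty_gt.
  have [H _ _ _] := ratios m m0; rewrite (invpow_ratio _ m0) -mulrBr -mulrA ler_pM2l //.
  rewrite -{1}[invpow d m]mulr1 -mulrBr ler_pM2l ?invpow_gt0 //.
  have mE : m%:R / m.+1%:R = 1 - m.+1%:R^-1 :> R by rewrite -[m.+1%:R]natr1; field; rewrite natr1 pnatr_eq0.
  have : m.+1%:R^-1 <= m%:R^-1 :> R by rewrite lef_pV2 ?posrE ?ltr0n // ler_nat.
  rewrite mE in H; move: (m.+1%:R^-1) (m%:R^-1) H => u v; lra.
move=> K; have K1 : 0 < `|K| + 1 by rewrite ltr_wpDl.
near=> m; rewrite exprMn exprS mulrA ler_pM2r ?exprn_gt0 ?invpow_gt0 //.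
have H : invpow d m <= beta ^+ Q / (`|K| + 1).
  near: m; apply: invpow_small => //; rewrite divr_gt0 ?exprn_gt0 //.
rewrite ler_pdivlMr // in H.
apply: le_trans H; rewrite mulrC ler_pM2l ?invpow_gt0 //.
by rewrite (le_trans (ler_norm K)) // lerDl.
Unshelve. all: by end_near. Qed.

End PowerScales.

(** * Row vectors with the supremum norm and the inner product [dotv] *)

Section Vectors.
Context {R : realType}.

Lemma coord_le_norm p q (u : 'M[R]_(p, q)) i j : `|u i j| <= `|u|.
Proof.
rewrite [leRHS]/Num.Def.normr /= mx_normrE.
by apply/bigmax_geP; right => /=; exists (i, j).
Qed.

Lemma mx_norm_le p q (u : 'M[R]_(p, q)) (a : R) : 0 <= a ->
  (forall i j, `|u i j| <= a) -> `|u| <= a.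
Proof.
move=> a0 ua; rewrite [leLHS]/Num.Def.normr /= mx_normrE.
by rewrite (bigmax_le _ a0) //= => -[i j] _.
Qed.

Lemma norm_mulmx_le p q r (u : 'M[R]_(p, q)) (A : 'M[R]_(q, r)) :
  `|u *m A| <= q%:R * `|A| * `|u|.
Proof.
apply: mx_norm_le => [|i j]; first by rewrite !mulr_ge0.
rewrite mxE (le_trans (ler_norm_sum _ _ _)) // -mulrA mulr_natl.
rewrite -[X in _ *+ X]card_ord -sumr_const; apply: ler_sum => k _.
by rewrite normrM mulrC ler_pM ?coord_le_norm.
Qed.

Lemma dotvC n (u v : 'rV[R]_n) : dotv u v = dotv v u.
Proof. by apply: eq_bigr => i _; rewrite mulrC. Qed.

Lemma dotvDl n (u v w : 'rV[R]_n) : dotv (u + v) w = dotv u w + dotv v w.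
Proof. by rewrite -big_split; apply: eq_bigr => i _; rewrite mxE mulrDl. Qed.

Lemma dotvZl n a (u w : 'rV[R]_n) : dotv (a *: u) w = a * dotv u w.
Proof. by rewrite mulr_sumr; apply: eq_bigr => i _; rewrite mxE mulrA. Qed.

Lemma dotvNl n (u w : 'rV[R]_n) : dotv (- u) w = - dotv u w.
Proof. by rewrite -scaleN1r dotvZl mulN1r. Qed.

Lemma dotvBl n (u v w : 'rV[R]_n) : dotv (u - v) w = dotv u w - dotv v w.
Proof. by rewrite dotvDl dotvNl. Qed.

Lemma dotvDr n (u v w : 'rV[R]_n) : dotv w (u + v) = dotv w u + dotv w v.
Proof. by rewrite !(dotvC w) dotvDl. Qed.

Lemma dotvZr n a (u w : 'rV[R]_n) : dotv w (a *: u) = a * dotv w u.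
Proof. by rewrite !(dotvC w) dotvZl. Qed.

Lemma dotvNr n (u w : 'rV[R]_n) : dotv w (- u) = - dotv w u.
Proof. by rewrite !(dotvC w) dotvNl. Qed.

Lemma dotvBr n (u v w : 'rV[R]_n) : dotv w (u - v) = dotv w u - dotv w v.
Proof. by rewrite !(dotvC w) dotvBl. Qed.

Lemma dotv0r n (w : 'rV[R]_n) : dotv w 0 = 0.
Proof. by rewrite -(scale0r 0) dotvZr mul0r. Qed.

Lemma dotvE n (u v : 'rV[R]_n) : dotv u v = (u *m v^T) 0 0.
Proof. by rewrite mxE; apply: eq_bigr => i _; rewrite mxE. Qed.

Lemma dotv_mull n k (u : 'rV[R]_n) (A : 'M[R]_(n, k)) v :
  dotv (u *m A) v = dotv u (v *m A^T).
Proof. by rewrite !dotvE trmx_mul trmxK mulmxA. Qed.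

Lemma dotv_ge0 n (u : 'rV[R]_n) : 0 <= dotv u u.
Proof. by apply: sumr_ge0 => i _; rewrite -expr2 sqr_ge0. Qed.

Lemma dotv_eq0 n (u : 'rV[R]_n) : dotv u u = 0 -> u = 0.
Proof.
move=> /eqP; rewrite psumr_eq0 => [/allP u0|i _]; last by rewrite -expr2 sqr_ge0.
apply/rowP => i; rewrite mxE; apply/eqP.
by have := u0 i (mem_index_enum i); rewrite -expr2 sqrf_eq0.
Qed.

Lemma norm_dotv_le n (u v : 'rV[R]_n) : `|dotv u v| <= n%:R * `|u| * `|v|.
Proof.
rewrite (le_trans (ler_norm_sum _ _ _)) // -mulrA mulr_natl.
rewrite -[X in _ *+ X]card_ord -sumr_const; apply: ler_sum => k _.
by rewrite normrM ler_pM ?coord_le_norm.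
Qed.

Lemma sqr_norm_le_dotv n (u : 'rV[R]_n) : `|u| ^+ 2 <= dotv u u.
Proof.
rewrite -(@ler_sqrt _ (_ ^+ 2)) ?dotv_ge0 // sqrtr_sqr ger0_norm //.
apply: mx_norm_le => [|i j]; first exact: sqrtr_ge0.
rewrite ord1 -sqrtr_sqr ler_sqrt ?dotv_ge0 // /dotv (bigD1 j) //= -expr2 lerDl.
by apply: sumr_ge0 => k _; rewrite -expr2 sqr_ge0.
Qed.

Lemma gram_eq0 p q (A : 'M[R]_(p, q)) : A^T *m A = 0 -> A = 0.
Proof.
move=> AA; apply: trmx_inj; rewrite trmx0; apply/row_matrixP => i.
rewrite row0; apply: dotv_eq0.
have := congr1 (fun B : 'M[R]_q => B i i) AA; rewrite !mxE => H.
by rewrite /dotv -[RHS]H; apply: eq_bigr => j _; rewrite !mxE.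
Qed.

End Vectors.

(** * The singular block system behind the expansion in powers of [mu] *)

Section BlockSystem.
Context {R : realType} {m N k : nat} (X : 'M[R]_(m, N)) (E : 'M[R]_(m, k)).

(** A KKT matrix acting on a multiplier [a] and a primal vector [w]: as [mu] tends to 0, the
    quadratic term of a cell becomes a constraint on [w *m X]. *)
Definition saddle : 'M[R]_(m + m) := block_mx 0 (X *m X^T) (X *m X^T) (E *m E^T).

Lemma tr_saddle : saddle^T = saddle.
Proof. by rewrite /saddle tr_block_mx trmx0 !trmx_mul !trmxK. Qed.

Lemma mul_saddle n (a w : 'M[R]_(n, m)) : row_mx a w *m saddle =
  row_mx (w *m X *m X^T) (a *m X *m X^T + w *m E *m E^T).
Proof. by rewrite mul_row_block mulmx0 add0r !mulmxA. Qed.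

(** The first block gives [w *m X = 0]. Pairing the second with [w] turns the square of [w *m E]
    into minus the product of [a *m X] and [w *m X], which vanishes; then [a *m X = 0] follows. *)
Lemma saddle_ker n (a w : 'M[R]_(n, m)) : row_mx a w *m saddle = 0 ->
  [/\ a *m X = 0, w *m X = 0 & w *m E = 0].
Proof.
rewrite mul_saddle -[0]row_mx0 => /eq_row_mx[wX aw].
have gram p (B : 'M[R]_(n, p)) : B *m B^T = 0 -> B = 0.
  by move=> BB; apply: trmx_inj; rewrite trmx0; apply: gram_eq0; rewrite trmxK.
have X0 : w *m X = 0 by apply: gram; rewrite trmx_mul mulmxA wX mul0mx.
have E0 : w *m E = 0.
  apply: gram; have -> : w *m E *m (w *m E)^T = - (a *m X *m (w *m X)^T).
    have eE : w *m E *m E^T = - (a *m X *m X^T) by apply/eqP; rewrite -addr_eq0 addrC aw.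
    by rewrite !trmx_mul !mulmxA eE mulNmx.
  by rewrite X0 trmx0 mulmx0 oppr0.
split=> //; apply: gram; move: aw; rewrite E0 mul0mx addr0 trmx_mul mulmxA => ->.
by rewrite mul0mx.
Qed.

Definition saddle_solve n (r : 'M[R]_(n, m + m)) := r *m pinvmx saddle.

(** The matrix is symmetric, so its range is the annihilator of its kernel; by [saddle_ker] that
    kernel annihilates every right-hand side of this shape. *)
Lemma saddle_solveP (s : 'rV[R]_N) (al : 'rV[R]_N) (be : 'rV[R]_k) :
  let z := saddle_solve (row_mx (s *m X^T) (al *m X^T + be *m E^T)) in
  lsubmx z *m X *m X^T + rsubmx z *m E *m E^T = al *m X^T + be *m E^T /\
  rsubmx z *m X *m X^T = s *m X^T.
Proof.
move=> z; suff : z *m saddle = row_mx (s *m X^T) (al *m X^T + be *m E^T).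
  by rewrite -[z in z *m _]hsubmxK mul_saddle => /eq_row_mx[].
rewrite mulmxKpV // submxE; set C := cokermx _.
have : row_mx (usubmx C)^T (dsubmx C)^T *m saddle = 0.
  rewrite -tr_col_mx vsubmxK -tr_saddle -trmx_mul.
  by rewrite mulmx_coker trmx0.
case/saddle_ker => /(congr1 trmx) + /(congr1 trmx) + /(congr1 trmx).
rewrite !trmx_mul !trmxK !trmx0 => aX wX wE.
rewrite -[C]vsubmxK mul_row_col mulmxDl -!mulmxA aX wX wE !mulmx0 !addr0.
by rewrite eqxx.
Qed.

Lemma eq_of_mul_tr n p q (u v : 'M[R]_(n, p)) (A : 'M[R]_(p, q)) :
  u *m A *m A^T = v *m A *m A^T -> u *m A = v *m A.
Proof.
move=> /eqP; rewrite -subr_eq0 -!mulmxBl => /eqP uv; apply/eqP.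
rewrite -subr_eq0 -mulmxBl; apply/eqP; apply: trmx_inj; rewrite trmx0.
by apply: gram_eq0; rewrite trmxK trmx_mul mulmxA uv mul0mx.
Qed.

(* Applied to [(z / (2 mu), - z)], the block system has right-hand side
   [(- z X X^T, g)], and the first component is small with [z]. *)
Lemma saddle_stability : exists C r : R, [/\ 0 < C, 0 < r &
  forall (mu : R) (z : 'rV[R]_m), 0 < mu <= r ->
    let g := (2 * mu)^-1 *: (z *m X *m X^T) - z *m E *m E^T in
    `|mu^-1 *: (z *m X)| <= C * `|g| /\
    exists z', [/\ z' *m X = z *m X, z' *m E = z *m E & `|z'| <= C * `|g|]].
Proof.
have bounded p q (A : 'M[R]_(p, q)) : exists2 K : R, 0 < K &
    forall n (u : 'M[R]_(n, p)), `|u *m A| <= K * `|u|.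
  exists (p%:R * `|A| + 1) => [|n u]; first by rewrite ltr_wpDl // mulr_ge0.
  by rewrite (le_trans (norm_mulmx_le _ _)) // ler_wpM2r // lerDl.
have [K1 K10 H1] := bounded _ _ (pinvmx saddle).
have [K2 K20 H2] := bounded _ _ X^T.
have [K3 K30 H3] := bounded _ _ X.
pose K4 := K3 * (K1 * (K2 + 1)).
have K40 : 0 < K4 by rewrite !mulr_gt0 // addr_gt0.
have K44 : 0 < 4 * K4 by rewrite mulr_gt0.
pose C := 4 * K4 + K1 * (K2 * (4 * K4) + 1).
have C1 : 0 < K1 * (K2 * (4 * K4) + 1).
  by apply: mulr_gt0 => //; apply: addr_gt0 => //; exact: mulr_gt0.
have C0 : 0 < C by exact: addr_gt0.
exists C, (Num.min 1 (4 * K4)^-1); split=> //.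
  by rewrite lt_min ltr01 invr_gt0 mulr_gt0.
move=> mu z /andP[mu0]; rewrite le_min => /andP[mu1 muK] g.
pose v := row_mx ((2 * mu)^-1 *: z) (- z).
have vE : v *m saddle = row_mx (- (z *m X *m X^T)) g.
  by rewrite mul_saddle !mulNmx -!scalemxAl.
(* A representative of [v] modulo the kernel whose norm is bounded by the right-hand side; [X] and
   [E] do not see the difference. *)
pose v' := v *m saddle *m pinvmx saddle.
have v'E : (v - v') *m saddle = 0.
  by rewrite /v' mulmxBl mulmxKpV ?submxMl // subrr.
have := v'E; rewrite -[v']hsubmxK /v opp_row_mx add_row_mx.
case/saddle_ker; rewrite !mulmxBl => /subr0_eq e1 /subr0_eq e2 /subr0_eq e3.
have nv' : `|v'| <= K1 * (K2 * `|z *m X| + `|g|).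
  rewrite (le_trans (H1 _ _)) // ler_pM2l // vE.
  apply: mx_norm_le => [|i j]; first by rewrite addr_ge0 // mulr_ge0 // ltW.
  rewrite mxE; case: splitP => l _; rewrite (le_trans (coord_le_norm _ _ _)) //.
    by rewrite normrN (le_trans (H2 _ _)) // lerDl.
  by rewrite lerDr mulr_ge0 // ltW.
have nl : `|lsubmx v'| <= `|v'|.
  by apply: mx_norm_le => // i j; rewrite mxE coord_le_norm.
have nr : `|rsubmx v'| <= `|v'|.
  by apply: mx_norm_le => // i j; rewrite mxE coord_le_norm.
(* The norm of [z *m X] occurs on both sides, on the right with a factor [2 * mu * K4]; since
   [4 * K4 * mu <= 1], half of the left side absorbs it. *)
have zX : `|z *m X| <= mu * (4 * K4 * `|g|).
  have h : `|z *m X| <= 2 * mu * (K3 * (K1 * (K2 * `|z *m X| + `|g|))).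
    have zE : z *m X = (2 * mu) *: (lsubmx v' *m X).
      by rewrite -e1 -scalemxAl scalerA divff ?scale1r // mulf_neq0 // gt_eqF.
    rewrite {1}zE mx_normZ gtr0_norm ?mulr_gt0 // ler_pM2l ?mulr_gt0 //.
    rewrite (le_trans (H3 _ _)) // ler_pM2l //; exact: le_trans nv'.
  have muK' : mu * (4 * K4) <= 1.
    by move: muK; rewrite -[(4 * K4)^-1]mul1r ler_pdivlMr.
  have := normr_ge0 (z *m X); have := normr_ge0 g.
  move: (`|z *m X|) (`|g|) h => a e h e0 a0.
  have h1 : 2 * mu * (K3 * (K1 * (K2 * a + e))) <= 2 * mu * (K4 * (a + e)).
    rewrite ler_pM2l ?mulr_gt0 // /K4 -!mulrA !ler_pM2l //.
    have := mulr_ge0 (ltW K20) e0; lra.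
  have h2 : mu * (4 * K4) * a <= 1 * a by rewrite ler_wpM2r.
  lra.
have nz : `|z *m X| <= 4 * K4 * `|g|.
  apply: le_trans zX _; rewrite -[leRHS]mul1r ler_wpM2r //.
  exact: mulr_ge0 (ltW K44) (normr_ge0 _).
split.
  rewrite mx_normZ gtr0_norm ?invr_gt0 // ler_pdivrMl //.
  apply: le_trans zX _; rewrite ler_pM2l // ler_wpM2r // /C lerDl; exact: ltW.
exists (- rsubmx v'); split.
- by rewrite mulNmx -e2 mulNmx opprK.
- by rewrite mulNmx -e3 mulNmx opprK.
rewrite normrN (le_trans nr) // (le_trans nv') // /C mulrDl.
have h : K1 * (K2 * `|z *m X| + `|g|) <= K1 * (K2 * (4 * K4 * `|g|) + `|g|).
  by rewrite ler_pM2l // lerD2r ler_pM2l.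
apply: le_trans h _; have := mulr_ge0 (ltW K44) (normr_ge0 g); lra.
Qed.

End BlockSystem.

Ltac nonneg := solve [repeat first
  [done | exact: ltW | exact: sqr_ge0 | apply: mulr_ge0 | apply: addr_ge0]].

Lemma curve_lipschitz {R : realType} n (v : nat -> 'rV[R]_n) k : exists2 L : R, 0 < L &
  forall x y : R, 0 <= x <= 1 -> 0 <= y <= 1 ->
    `|\sum_(q < k) x ^+ q *: v q| <= L /\
    `|\sum_(q < k) x ^+ q *: v q - \sum_(q < k) y ^+ q *: v q| <= L * `|x - y|.
Proof.
elim: k => [|k [L L0 HL]].
  by exists 1 => // x y _ _; rewrite !big_ord0 subrr normr0 mul1r.
have [K K0 HK] := poly_lipschitz ('X^k : {poly R}).
exists (L + K * `|v k|) => [|x y x01 y01]; first by rewrite ltr_wpDr // mulr_ge0.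
have [Lx Lxy] := HL x y x01 y01; have [] := HK x y x01 y01.
rewrite !hornerXn !big_ord_recr /= => Kx Kxy; split.
  by rewrite (le_trans (ler_normD _ _)) // lerD // mx_normZ ler_wpM2r.
rewrite opprD addrACA -scalerBl (le_trans (ler_normD _ _)) // mulrDl lerD //.
by rewrite mx_normZ mulrAC ler_wpM2r.
Qed.

(** * The quadratic of one cell, its approximate critical curve and its level *)

Section CellQuadratic.
Context {R : realType} {m N k : nat} (X : 'M[R]_(m, N)) (E : 'M[R]_(m, k)).
Context (y : 'rV[R]_N) (b : 'rV[R]_m) (c0 kap : R).
Implicit Types (mu : R) (w : 'rV[R]_m).

(** In the application [X] and [y] keep only the residuals in the quadratic band and [kap] counts
    them; the negative square is the concave part of the penalty, and [b] and [c0] collect the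
    affine parts. *)
Definition cellq mu w : R :=
  dotv (y - w *m X) (y - w *m X) / (4 * mu) + kap * mu / 4 + dotv b w + c0
  - dotv (w *m E) (w *m E) / 2.

Definition cellg mu w : 'rV[R]_m :=
  b - (2 * mu)^-1 *: ((y - w *m X) *m X^T) - w *m E *m E^T.

Definition slope mu w : 'rV[R]_N := mu^-1 *: (y - w *m X).

Lemma cellq_slope mu w : mu != 0 -> cellq mu w =
  mu / 4 * dotv (slope mu w) (slope mu w) + kap * mu / 4 + dotv b w + c0
  - dotv (w *m E) (w *m E) / 2.
Proof. by move=> mu0; rewrite /cellq /slope dotvZl dotvZr; field. Qed.

(** In [w] this is the trapezoidal rule, exact for quadratics. The last term is the chord version of
    the derivative in [mu], which is a quarter of [kap] minus the squared slope. *)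
Lemma cellq_two_point mu mu' w w' : mu != 0 -> mu' != 0 ->
  cellq mu' w' - cellq mu w = dotv (cellg mu w + cellg mu' w') (w' - w) / 2
    + (mu' - mu) / 4 * (kap - dotv (slope mu w) (slope mu' w')).
Proof.
move=> mu0 mu'0; rewrite /cellg /slope /cellq.
have dX : (w' - w) *m X = (y - w *m X) - (y - w' *m X).
  by rewrite mulmxBl opprB [RHS]addrC addrA subrK.
move: (y - w *m X) (y - w' *m X) dX => r r' dX.
rewrite !(dotvDl, dotvNl, dotvZl) !(dotv_mull _ X^T) !(dotv_mull _ E^T) !trmxK dX.
rewrite !(mulmxBl, dotvBr) !dotvZr (dotvC r' r) (dotvC (w' *m E) (w *m E)).
by field; rewrite mu0 mu'0.
Qed.

Hypothesis y_range : (y <= X)%MS.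
Hypothesis b_range : (b <= col_mx X^T E^T)%MS.

Lemma cellg_orth mu w v : v *m X = 0 -> v *m E = 0 -> dotv (cellg mu w) v = 0.
Proof.
move=> vX vE; have /submxP[ab bE] := b_range; rewrite /cellg bE -[ab]hsubmxK mul_row_col.
rewrite !(dotvDl, dotvNl, dotvZl) !(dotv_mull _ X^T) !(dotv_mull _ E^T) !trmxK vX vE.
by rewrite !dotv0r mulr0 !oppr0 !addr0.
Qed.

(** A critical point satisfies [w X = y - 2 mu a X] and [a X X^T + w E E^T = b], where [a X] is half
    of the slope. Comparing powers of [mu] gives one block system per order, fed by the multiplier
    of the previous order. *)
Fixpoint expansion q : 'rV[R]_(m + m) := saddle_solve X E
  (if q is q'.+1 then row_mx (- (2 *: (lsubmx (expansion q') *m X)) *m X^T) 0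
   else row_mx (y *m X^T) b).

Notation acoef q := (lsubmx (expansion q)).
Notation wcoef q := (rsubmx (expansion q)).

Lemma expansion0 : wcoef 0%N *m X = y /\
  acoef 0%N *m X *m X^T + wcoef 0%N *m E *m E^T = b.
Proof.
have /submxP[ab bE] := b_range; have /submxP[om yE] := y_range.
rewrite -[ab]hsubmxK mul_row_col in bE.
have [] := saddle_solveP X E y (lsubmx ab) (rsubmx ab).
rewrite -bE => ? wX; split=> //.
by rewrite [RHS]yE; apply: eq_of_mul_tr; rewrite wX yE.
Qed.

Lemma expansionS q : wcoef q.+1 *m X = - (2 *: (acoef q *m X)) /\
  acoef q.+1 *m X *m X^T + wcoef q.+1 *m E *m E^T = 0.
Proof.
have := saddle_solveP X E (- (2 *: (acoef q *m X))) 0 0.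
rewrite !mul0mx addr0 => -[? wX]; split=> //.
have sE : - (2 *: (acoef q *m X)) = (- (2 *: acoef q)) *m X.
  by rewrite mulNmx scalemxAl.
by rewrite [RHS]sE; apply: eq_of_mul_tr; rewrite wX sE.
Qed.

Definition wcurve n mu := \sum_(q < n.+1) mu ^+ q *: wcoef q.
Definition scurve n mu := \sum_(q < n) mu ^+ q *: (2 *: (acoef q *m X)).

Lemma wcurve_residual n mu : y - wcurve n mu *m X = mu *: scurve n mu.
Proof.
rewrite /wcurve /scurve mulmx_suml big_ord_recl expr0 scale1r expansion0.1 opprD addrA.
rewrite subrr sub0r scaler_sumr -sumrN; apply: eq_bigr => q _.
by rewrite -scalemxAl (expansionS q).1 scalerN opprK scalerA -exprS.
Qed.

Lemma slope_wcurve n mu : mu != 0 -> slope mu (wcurve n mu) = scurve n mu.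
Proof. by move=> mu0; rewrite /slope wcurve_residual scalerA mulVf // scale1r. Qed.

(** All orders below [n.+1] cancel by the recursion. The last primal coefficient is left without a
    multiplier of its order to balance it. *)
Lemma cellg_wcurve n mu : mu != 0 ->
  cellg mu (wcurve n.+1 mu) = - (mu ^+ n.+1 *: (wcoef n.+1 *m E *m E^T)).
Proof.
move=> mu0; rewrite /cellg wcurve_residual -scalemxAl scalerA invfM mulfVK // /wcurve.
rewrite big_ord_recr /=.
have half (s : 'rV[R]_N) : 2^-1 *: ((2 *: s) *m X^T) = s *m X^T.
  by rewrite -scalemxAl scalerA mulVf // scale1r.
have HA : 2^-1 *: (scurve n.+1 mu *m X^T) +
    (\sum_(q < n.+1) mu ^+ q *: wcoef q) *m E *m E^T = b.
  rewrite /scurve !mulmx_suml scaler_sumr -big_split big_ord_recl /=.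
  rewrite expr0 !scale1r half expansion0.2 big1 ?addr0 // => q _.
  rewrite -[in X in X + _]scalemxAl scalerA mulrC -scalerA half.
  by rewrite -!scalemxAl -scalerDr (expansionS q).2 scaler0.
rewrite !mulmxDl -!scalemxAl -[X in X - _ - _]HA.
by rewrite [X in X - _]addrAC subrr add0r opprD addrA subrr sub0r.
Qed.

(** No negative power of [mu] survives: the residual along the curve is [mu] times the polynomial
    [scurve], so its square over [4 * mu] is again a polynomial. *)
Lemma level_poly n : exists phi : {poly R}, forall mu, mu != 0 ->
  phi.[mu] = cellq mu (wcurve n mu).
Proof.
pose wp i : {poly R} := \poly_(q < n.+1) wcoef q 0 i.
pose sp j : {poly R} := \poly_(q < n) (2 *: (acoef q *m X)) 0 j.
exists ((4^-1)%:P * 'X * (\sum_j sp j ^+ 2) + (kap / 4)%:P * 'X +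
  (\sum_i (b 0 i)%:P * wp i) + c0%:P -
  (2^-1)%:P * \sum_l (\sum_i (E i l)%:P * wp i) ^+ 2) => mu mu0.
have wE i : wcurve n mu 0 i = (wp i).[mu].
  by rewrite horner_poly summxE; apply: eq_bigr => q _; rewrite mxE mulrC.
have sE j : scurve n mu 0 j = (sp j).[mu].
  by rewrite horner_poly summxE; apply: eq_bigr => q _; rewrite mxE mulrC.
rewrite cellq_slope // slope_wcurve // !hornerE !horner_sum.
have -> : dotv (scurve n mu) (scurve n mu) = \sum_j (sp j ^+ 2).[mu].
  by apply: eq_bigr => j _; rewrite sE !hornerE expr2.
have -> : dotv b (wcurve n mu) = \sum_i ((b 0 i)%:P * wp i).[mu].
  by apply: eq_bigr => i _; rewrite wE !hornerE.
have -> : dotv (wcurve n mu *m E) (wcurve n mu *m E) =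
    \sum_l ((\sum_i (E i l)%:P * wp i) ^+ 2).[mu].
  apply: eq_bigr => l _; rewrite horner_exp expr2 horner_sum mxE.
  by congr (_ * _); apply: eq_bigr => i _; rewrite wE !hornerE mulrC.
ring.
Qed.

Lemma cellg_diff mu w w' : mu != 0 -> cellg mu w' - cellg mu w =
  (2 * mu)^-1 *: ((w' - w) *m X *m X^T) - (w' - w) *m E *m E^T.
Proof.
move=> mu0; rewrite /cellg !mulmxBl !scalerBr.
move: (_ *: (y *m X^T)) (_ *: (w *m X *m X^T)) (_ *: (w' *m X *m X^T)) => A B C.
move: (w *m E *m E^T) (w' *m E *m E^T) => F G.
by apply/rowP => i; rewrite !mxE; ring.
Qed.

Lemma slope_diff mu w w' : slope mu w' - slope mu w = - (mu^-1 *: ((w' - w) *m X)).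
Proof.
rewrite /slope -scalerBr -scalerN; congr (_ *: _); rewrite mulmxBl.
by apply/rowP => i; rewrite !mxE; ring.
Qed.

(** Both estimates compare [w] with the curve point for the same [mu]. By [saddle_stability] the
    slopes, and the displacement modulo the kernel, differ by a multiple of the gradient norm plus
    [mu ^+ n.+1]. The first estimate is then the trapezoidal rule; the second holds because the
    derivative in [mu] depends on the slope alone, up to errors of second order. *)
Lemma cell_level_regular n : exists (phi : {poly R}) (C r : R), [/\ 0 < C, 0 < r &
  forall mu w, 0 < mu <= r -> `|slope mu w| <= 1 ->
    `|cellq mu w - phi.[mu]| <= C * (`|cellg mu w| ^+ 2 + (mu ^+ n.+1) ^+ 2) /\
    forall mu', 0 < mu' <= mu -> cellq mu' w - cellq mu w <= phi.[mu'] - phi.[mu]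
      + C * (mu - mu') * (`|cellg mu w| + mu ^+ n.+1 + (mu - mu') / mu')].
Proof.
have [phi phiE] := level_poly n.+1.
have [Cs [r [Cs0 r0 stab]]] := saddle_stability X E.
have [Lw Lw0 HLw] := curve_lipschitz (fun q => wcoef q) n.+2.
have [Ls Ls0 HLs] := curve_lipschitz (fun q => 2 *: (acoef q *m X)) n.+1.
pose Lg := `|wcoef n.+1 *m E *m E^T|; have Lg0 : 0 <= Lg by exact: normr_ge0.
pose M := m%:R : R; pose K := N%:R : R.
have M0 : 0 <= M by []. have K0 : 0 <= K by [].
pose C1 := M * Cs * (1 + 4 * Lg ^+ 2).
pose C2 := K * Cs * (1 + Ls) * (1 + Lg) + K * (1 + Ls * Ls) + M * Lg * Lw.
have C10 : 0 <= C1 by rewrite /C1; nonneg.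
have C20 : 0 <= C2.
  by rewrite /C2; nonneg.
exists phi, (C1 + C2 + 1), (Num.min 1 r); split; first by rewrite ltr_wpDl // addr_ge0.
  by rewrite lt_min ltr01.
move=> mu w /andP[mu0]; rewrite le_min => /andP[mu1 mur] s1.
have mun0 : mu != 0 by rewrite gt_eqF.
have mu01 : 0 <= mu <= 1 by rewrite ltW.
set wc := wcurve n.+1 mu; set a := `|cellg mu w|; set e := mu ^+ n.+1.
have e0 : 0 <= e by rewrite exprn_ge0 // ltW.
have a0 : 0 <= a by exact: normr_ge0.
have gc : forall nu, 0 < nu <= mu -> `|cellg nu (wcurve n.+1 nu)| <= Lg * e.
  move=> nu /andP[nu0 numu]; rewrite cellg_wcurve ?gt_eqF // normrN mx_normZ mulrC.
  rewrite ler_wpM2l // normrX ger0_norm ?(ltW nu0) // /e lerXn2r // nnegrE ltW //.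
have gcm := gc mu; rewrite mu0 lexx in gcm; move/(_ isT) : gcm => gcm.
have gd : `|cellg mu w - cellg mu wc| <= a + Lg * e.
  by rewrite (le_trans (ler_normB _ _)) // lerD.
have murP : 0 < mu <= r by rewrite mu0.
have [sz [z' [z'X z'E nz']]] := stab mu (w - wc) murP.
rewrite -cellg_diff // in sz nz'.
have sd : `|slope mu w - slope mu wc| <= Cs * (a + Lg * e).
  by rewrite slope_diff normrN (le_trans sz) // ler_pM2l.
have nz : `|z'| <= Cs * (a + Lg * e) by rewrite (le_trans nz') // ler_pM2l.
split.
  rewrite phiE // cellq_two_point // subrr mul0r mul0r addr0.
  (* The displacement may be arbitrarily large along the common kernel of [X] and [E], but gradients
     are orthogonal to that kernel, so the bounded representative [z'] may replace it. *)
  have -> : dotv (cellg mu wc + cellg mu w) (w - wc) =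
      dotv (cellg mu wc + cellg mu w) z'.
    apply/eqP; rewrite -subr_eq0 -dotvBr dotvDl !cellg_orth ?addr0 //.
    - by rewrite mulmxBl z'X subrr.
    - by rewrite mulmxBl z'E subrr.
    - by rewrite mulmxBl z'X subrr.
    - by rewrite mulmxBl z'E subrr.
  rewrite normrM [`|2^-1|]ger0_norm ?invr_ge0 // ler_pdivrMr //.
  rewrite (le_trans (norm_dotv_le _ _)) //.
  have h1 : `|cellg mu wc + cellg mu w| <= a + Lg * e.
    by rewrite (le_trans (ler_normD _ _)) // addrC lerD.
  have h2 : M * `|cellg mu wc + cellg mu w| * `|z'| <=
      M * (a + Lg * e) * (Cs * (a + Lg * e)).
    by rewrite ler_pM ?mulr_ge0 // ler_wpM2l.
  apply: le_trans h2 _.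
  have h3 : (a + Lg * e) ^+ 2 <= 2 * (a ^+ 2 + Lg ^+ 2 * e ^+ 2).
    have := sqr_ge0 (a - Lg * e); lra.
  have MC : 0 <= M * Cs by nonneg.
  have h4 := ler_wpM2l MC h3.
  have h5 : 0 <= M * Cs * a ^+ 2 by nonneg.
  have h6 : 0 <= M * Cs * e ^+ 2 by nonneg.
  have h7 : 0 <= M * Cs * Lg ^+ 2 * a ^+ 2 by nonneg.
  have h8 : 0 <= M * Cs * Lg ^+ 2 * e ^+ 2 by nonneg.
  have h9 : 0 <= (C2 + 1) * (a ^+ 2 + e ^+ 2).
    by nonneg.
  rewrite /C1; lra.
move=> mu' /andP[mu'0 mu'mu].
have mu'n0 : mu' != 0 by rewrite gt_eqF.
have mu'01 : 0 <= mu' <= 1 by rewrite ltW //= (le_trans mu'mu).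
set wc' := wcurve n.+1 mu'.
have D0 : 0 <= mu - mu' by rewrite subr_ge0.
have gc' : `|cellg mu' wc'| <= Lg * e by apply: gc; rewrite mu'0.
have [_ dw] := HLw mu mu' mu01 mu'01.
have [ls _] := HLs mu mu mu01 mu01.
have [_ ds] := HLs mu mu' mu01 mu'01.
rewrite (ger0_norm D0) in ds dw.
rewrite -/(scurve n.+1 mu) -/(scurve n.+1 mu') in ls ds.
rewrite distrC -/(wcurve n.+1 mu) -/(wcurve n.+1 mu') -/wc -/wc' in dw.
rewrite -!slope_wcurve // -/wc -/wc' in ls ds.
have e1 : cellq mu' w - cellq mu w =
    (mu - mu') / 4 * (mu / mu' * dotv (slope mu w) (slope mu w) - kap).
  rewrite /cellq /slope dotvZl dotvZr; field; exact/andP.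
have e2 := cellq_two_point wc wc' mun0 mu'n0.
rewrite !phiE // e2 e1.
set S := dotv (slope mu w) (slope mu w); set S' := dotv _ (slope mu' wc').
have b1 : `|dotv (cellg mu wc + cellg mu' wc') (wc' - wc)| <=
    M * (2 * Lg * e) * (Lw * (mu - mu')).
  rewrite (le_trans (norm_dotv_le _ _)) // ler_pM ?mulr_ge0 //.
  by rewrite ler_wpM2l // (le_trans (ler_normD _ _)) // -mulrA mulr_natl mulr2n lerD.
have b2 : S <= K.
  rewrite (le_trans (ler_norm _)) // (le_trans (norm_dotv_le _ _)) // -mulrA.
  by rewrite ler_piMr // mulr_ile1.
have b3 : S - S' <= K * (Cs * (a + Lg * e)) * (1 + Ls) + K * Ls * (Ls * (mu - mu')).
  have -> : S - S' = dotv (slope mu w - slope mu wc) (slope mu w + slope mu wc) +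
      dotv (slope mu wc) (slope mu wc - slope mu' wc').
    rewrite !(dotvDl, dotvDr, dotvNl, dotvNr) (dotvC (slope mu wc) (slope mu w)) /S /S'; ring.
  rewrite lerD // (le_trans (ler_norm _)) // (le_trans (norm_dotv_le _ _)) //.
    rewrite ler_pM ?mulr_ge0 // ?ler_wpM2l //.
    by rewrite (le_trans (ler_normD _ _)) // lerD.
  by rewrite ler_pM ?mulr_ge0 // ler_wpM2l.
set q := (mu - mu') / mu'.
have q0 : 0 <= q by rewrite divr_ge0 // ltW.
have Dq : mu - mu' <= q.
  by rewrite ler_pdivlMr // ler_piMr //; case/andP: mu'01.
have qE : mu / mu' = 1 + q by rewrite /q; field.
have S0 : 0 <= S by exact: dotv_ge0.
(* The drift of the quadratic at fixed [w] involves [mu / mu' * S], that of the level [S']; their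
   difference comes from the factor [mu / mu' = 1 + q] and from the closeness of the slopes. *)
have b4 : mu / mu' * S - S' <= (K * Cs * (1 + Ls) * (1 + Lg) + K * (1 + Ls * Ls)) * (a + e + q).
  rewrite qE.
  have t1 : q * S <= q * K by rewrite ler_wpM2l.
  have t2 : K * Ls * (Ls * (mu - mu')) <= K * Ls * (Ls * q).
    by rewrite ler_wpM2l ?mulr_ge0 // ?ler_wpM2l // ltW.
  have KC : 0 <= K * Cs * (1 + Ls) by nonneg.
  have t3 : 0 <= K * Cs * (1 + Ls) * q by rewrite mulr_ge0.
  have t4 : 0 <= K * Cs * (1 + Ls) * (Lg * (a + q)) by nonneg.
  have t5 : 0 <= K * Cs * (1 + Ls) * e by rewrite mulr_ge0.
  have t6 : 0 <= K * (1 + Ls * Ls) * (a + e).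
    by nonneg.
  lra.
have b5 : - (dotv (cellg mu wc + cellg mu' wc') (wc' - wc)) / 2 <=
    (mu - mu') * (M * Lg * Lw * (a + e + q)).
  have := ler_norm (- dotv (cellg mu wc + cellg mu' wc') (wc' - wc)).
  rewrite normrN => t1.
  have t2 : 0 <= (mu - mu') * (M * Lg * Lw * (a + q)).
    by nonneg.
  lra.
have b6 := ler_wpM2l D0 b4.
have b7 : 0 <= (mu - mu') * ((K * Cs * (1 + Ls) * (1 + Lg) + K * (1 + Ls * Ls)) * (a + e + q)).
  by nonneg.
have b8 : 0 <= (C1 + 1) * ((mu - mu') * (a + e + q)).
  by nonneg.
rewrite /C2; lra.
Qed.

End CellQuadratic.

(** The expansion exists only if [y] and [b] are in range. If [y] is not, the slope bound would put
    [w *m X] within [mu] of [y], which fails for small [mu]. If [b] is not, the gradient is bounded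
    away from 0; then 0 is a placeholder level. *)
Lemma cell_level {R : realType} m N k (X : 'M[R]_(m, N)) (E : 'M[R]_(m, k))
    (y : 'rV[R]_N) (b : 'rV[R]_m) (c0 kap : R) n :
  exists (phi : {poly R}) (C r : R), [/\ 0 < C, 0 < r &
  forall mu w, 0 < mu <= r -> `|slope X y mu w| <= 1 ->
    let q := cellq X E y b c0 kap in let g := `|cellg X E y b mu w| in
    phi = 0 /\ 1 <= C * g \/
    `|q mu w - phi.[mu]| <= C * (g ^+ 2 + (mu ^+ n.+1) ^+ 2) /\
    forall mu', 0 < mu' <= mu -> q mu' w - q mu w <= phi.[mu'] - phi.[mu]
      + C * (mu - mu') * (g + mu ^+ n.+1 + (mu - mu') / mu')].
Proof.
have [yX|yX] := boolP (y <= X)%MS; last first.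
  move: yX; rewrite submxE -normr_gt0 => yc.
  pose K := N%:R * `|cokermx X| + 1.
  have K0 : 0 < K by rewrite ltr_wpDl // mulr_ge0.
  exists 0, 1, (`|y *m cokermx X| / (2 * K)); split=> //.
    by rewrite divr_gt0 // mulr_gt0.
  move=> mu w /andP[mu0 muy] s1; exfalso.
  have : (y - w *m X) *m cokermx X = y *m cokermx X.
    by rewrite mulmxBl -mulmxA mulmx_coker mulmx0 subr0.
  have -> : y - w *m X = mu *: slope X y mu w.
    by rewrite /slope scalerA divff ?scale1r // gt_eqF.
  move=> ye; have := norm_mulmx_le (mu *: slope X y mu w) (cokermx X).
  rewrite ye mx_normZ gtr0_norm // => h.
  have h1 : mu * `|slope X y mu w| <= mu by rewrite ger_pMr.
  have h2 : N%:R * `|cokermx X| * (mu * `|slope X y mu w|) <= K * mu.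
    by rewrite ler_pM ?mulr_ge0 // ?(ltW mu0) // /K lerDl.
  by move: muy; rewrite ler_pdivlMr ?mulr_gt0 //; lra.
have [bX|bX] := boolP (b <= col_mx X^T E^T)%MS.
  have [phi [C [r [C0 r0 H]]]] := cell_level_regular c0 kap yX bX n.
  by exists phi, C, r; split=> // mu w mur s1 /=; right; exact: H.
move: bX; rewrite submxE -normr_gt0 => bc.
set c := cokermx _ in bc.
have cX : X^T *m c = 0 /\ E^T *m c = 0.
  have := mulmx_coker (col_mx X^T E^T); rewrite mul_col_mx -[0]col_mx0.
  by move=> /eq_col_mx.
pose K := m%:R * `|c| + 1.
have K0 : 0 < K by rewrite ltr_wpDl // mulr_ge0.
exists 0, (K / `|b *m c|), 1; split=> //; first by rewrite divr_gt0.
move=> mu w mu1 s1 /=; left; split=> //.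
have gc : cellg X E y b mu w *m c = b *m c.
  by rewrite /cellg !mulmxBl -scalemxAl ?mulmxBl -!mulmxA cX.1 cX.2 !mulmx0 ?subrr scaler0 !subr0.
rewrite mulrAC ler_pdivlMr // mul1r -gc (le_trans (norm_mulmx_le _ _)) //.
by rewrite ler_wpM2r // /K lerDl.
Qed.

(** * Gradients from quadratic remainders, and the largest eigenvalue *)

Section Gradient.
Local Open Scope classical_set_scope.
Context {R : realType}.

Lemma is_gradient_quadratic n (f : 'rV[R]_n -> R) (w v : 'rV[R]_n) (K : R) :
  (forall h, `|f (w + h) - f w - dotv v h| <= K * `|h| ^+ 2) -> is_gradient f w v.
Proof.
move=> H.
have [df dfE] : exists df : {linear 'rV[R]_n -> R}, forall h, df h = dotv v h.
  have lin : GRing.linear_for *%R (dotv v) by move=> a x y; rewrite dotvDr dotvZr.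
  pose g : {linear 'rV[R]_n -> R} :=
    HB.pack (dotv v) (GRing.isLinear.Build _ _ _ _ (dotv v) lin).
  by exists g.
have dfc : continuous df.
  apply: bounded_linear_continuous; apply/linear_boundedP.
  exists (n%:R * `|v|); split=> [|M /ltW vM h]; first exact: num_real.
  by rewrite dfE (le_trans (norm_dotv_le _ _)) // ler_wpM2r.
have dfo : (f : 'rV[R]_n -> R^o) \o shift w = cst (f w : R^o) + (df : 'rV[R]_n -> R^o) +o_ (0 : 'rV[R]_n) id.
  have K0 : 0 < `|K| + 1 by rewrite ltr_wpDl.
  apply/eqaddoP => _/posnumP[e]; apply/(@nbhs_norm0P _ 'rV[R]_n).
  exists (e%:num / (`|K| + 1)) => /=; first exact: divr_gt0.
  move=> h /=; rewrite ltr_pdivlMr // => /ltW he.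
  have -> : (f \o shift w - (cst (f w) + df)) h = f (w + h) - f w - dotv v h.
    by rewrite !fctE /= dfE [h + w]addrC opprD addrA.
  rewrite (le_trans (H h)) // expr2 mulrA ler_wpM2r //.
  apply: le_trans he; rewrite mulrC ler_wpM2l // (le_trans (ler_norm K)) //.
  by rewrite lerDl.
have dE := diff_unique dfc dfo.
split; last by move=> h; rewrite dE dfE.
by apply/diff_locallyP; rewrite dE.
Qed.

Lemma quadratic_continuous n k (B : 'M[R]_(n, k)) :
  continuous (fun x : 'rV[R]_n => dotv (x *m B) (x *m B)).
Proof.
move=> w; apply: differentiable_continuous.
have [] // := @is_gradient_quadratic n (fun x => dotv (x *m B) (x *m B)) w
  (2 *: (w *m B *m B^T)) (k%:R * (n%:R * `|B|) ^+ 2).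
move=> h; rewrite dotvZl (dotv_mull _ B^T) trmxK mulmxDl !(dotvDl, dotvDr).
rewrite (dotvC (h *m B) (w *m B)).
have -> (a b c : R) : a + b + (b + c) - a - 2 * b = c by ring.
have hB := norm_mulmx_le h B.
rewrite (le_trans (norm_dotv_le _ _)) // -[leLHS]mulrA -[leRHS]mulrA ler_wpM2l //.
by rewrite (le_trans (ler_pM _ _ hB hB)) // -expr2 exprMn.
Qed.

(** A maximizer of the Rayleigh quotient of [A^T *m A] on the compact unit sphere is an eigenvector,
    which bounds [z *m A^T]. The bound passes to [u *m A] by expanding the square of
    [a *: u - z *m A^T] with [z = u *m A]. *)
Lemma rayleigh m N (A : 'M[R]_(m, N)) (a : R) : 0 < a ->
  (forall l, eigenvalue (A^T *m A) l -> l <= a) ->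
  forall u : 'rV[R]_m, dotv (u *m A) (u *m A) <= a * dotv u u.
Proof.
move=> a0 eig.
have top z : dotv (z *m A^T) (z *m A^T) <= a * dotv z z.
  have [z0|z0] := eqVneq (dotv z z) 0.
    by rewrite (dotv_eq0 z0) mul0mx !dotv0r mulr0.
  pose S := [set x : 'rV[R]_N | dotv x x = 1].
  have cS : compact S.
    apply: bounded_closed_compact.
      exists 1; split => // M M1 x /= x1; apply: le_trans (ltW M1).
      by rewrite -(@ler_pXn2r _ 2%N) ?nnegrE // expr1n -x1 sqr_norm_le_dotv.
    have -> : S = (fun x : 'rV[R]_N => dotv (x *m 1%:M) (x *m 1%:M)) @^-1` [set 1].
      by apply: funext => x /=; rewrite mulmx1.
    apply: closed_comp => [x _|]; last exact: closed_eq.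
    exact: quadratic_continuous.
  have S0 : S !=set0.
    exists ((Num.sqrt (dotv z z))^-1 *: z).
    rewrite /S /= dotvZl dotvZr mulrA -invfM -expr2 sqr_sqrtr ?dotv_ge0 //.
    by rewrite mulVf.
  have cf : continuous (fun x : 'rV[R]_N => dotv (x *m A^T) (x *m A^T)).
    exact: quadratic_continuous.
  have [e /set_mem eS emax] := EVT_max_rV S0 cS (continuous_subspaceT cf).
  set l := dotv (e *m A^T) (e *m A^T) in emax.
  have lmax x : dotv (x *m A^T) (x *m A^T) <= l * dotv x x.
    have [x0|x0] := eqVneq (dotv x x) 0.
      by rewrite (dotv_eq0 x0) mul0mx !dotv0r mulr0.
    have xp : 0 < dotv x x by rewrite lt_def x0 dotv_ge0.
    have := emax ((Num.sqrt (dotv x x))^-1 *: x).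
    rewrite inE /S /= -scalemxAl !dotvZl !dotvZr !mulrA -!invfM -!expr2.
    rewrite sqr_sqrtr ?dotv_ge0 // mulVf // => /(_ erefl).
    by rewrite mulrC ler_pdivrMr.
  have eigl : eigenvalue (A^T *m A) l.
    apply/eigenvalueP; exists e; last first.
      apply/eqP => e0; move: eS; rewrite /S /= e0 dotv0r => /eqP.
      by rewrite eq_sym oner_eq0.
    rewrite mulmxA; have [g gE] : exists g, g = e *m A^T *m A - l *: e by eexists.
    suff : dotv g g = 0 by move=> /dotv_eq0; rewrite gE => /subr0_eq.
    (* Perturbing the maximizer along its eigenvalue defect [g] gains at first order in [t], so [g]
       has to vanish. *)
    have quad t : 2 * t * dotv g g <= t ^+ 2 * (l * dotv g g - dotv (g *m A^T) (g *m A^T)).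
      have := lmax (e + t *: g).
      rewrite mulmxDl -scalemxAl !(dotvDl, dotvDr, dotvZl, dotvZr) -/l eS.
      rewrite (dotvC (g *m A^T)) (dotvC g e).
      have -> : dotv g g = dotv (e *m A^T) (g *m A^T) - l * dotv e g.
        by rewrite {1}gE dotvBl dotvZl (dotv_mull _ A).
      lra.
    apply/eqP; rewrite eq_le dotv_ge0 andbT leNgt; apply/negP => g0.
    set B := l * dotv g g - _ in quad.
    have [B0|B0] := leP B 0.
      by have := quad 1; rewrite expr1n; lra.
    have tB : dotv g g / B * B = dotv g g by rewrite divfK ?gt_eqF.
    have := quad (dotv g g / B); rewrite expr2 -[leRHS]mulrA tB.
    have : 0 < dotv g g / B * dotv g g by rewrite mulr_gt0 // divr_gt0.
    lra.
  apply: le_trans (lmax z) _; rewrite ler_wpM2r ?dotv_ge0 //; exact: eig.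
move=> u; set z := u *m A.
have z2 : dotv z z = dotv u (z *m A^T) by rewrite {1}/z dotv_mull.
have := dotv_ge0 (a *: u - z *m A^T).
rewrite !(dotvDl, dotvDr, dotvNl, dotvNr, dotvZl, dotvZr) (dotvC (z *m A^T) u) -z2.
have := top z => tz h; rewrite -(ler_pM2l a0); lra.
Qed.

End Gradient.

(** * The smoothed absolute value *)

Section Huber.
Context {R : realType}.
Implicit Types r s t h mu : R.

(** The derivative of [fsmooth] in [r]: the ratio [r / mu] clipped to the interval from -1 to 1. *)
Definition dsmooth r mu : R :=
  if mu <= r then 1 else if r <= - mu then -1 else r / mu.

Lemma dsmooth_bound r mu : 0 < mu -> -1 <= dsmooth r mu <= 1.
Proof.
move=> mu0; rewrite /dsmooth; case: (leP mu r) => [_|r1]; first lra.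
case: (leP r (- mu)) => [_|r2]; first lra.
by rewrite ler_pdivlMr // ler_pdivrMr // mulN1r mul1r !ltW.
Qed.

(* [fsmooth r mu] is the maximum of [s r + mu (1 - s^2) / 2] over [-1 <= s <= 1],
   attained at [s = dsmooth r mu]. *)
Lemma fsmoothE r mu : 0 < mu ->
  fsmooth r mu = dsmooth r mu * r + mu * (1 - dsmooth r mu ^+ 2) / 2.
Proof.
move=> mu0; rewrite /fsmooth /dsmooth.
case: (leP mu r) => [r1|r1].
  by rewrite ger0_norm ?r1 //; [ring | lra].
case: (leP r (- mu)) => [r2|r2].
  by rewrite ler0_norm; [have -> : mu <= - r by lra | lra]; ring.
rewrite leNgt ltr_norml r2 r1 /=; field; lra.
Qed.

(** The first-order optimality condition of the concave maximization over [s] that defines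
    [fsmooth], whose derivative is [r - mu * s]. *)
Lemma dsmooth_opt r mu t : 0 < mu -> -1 <= t <= 1 ->
  (t - dsmooth r mu) * (r - mu * dsmooth r mu) <= 0.
Proof.
move=> mu0 /andP[t1 t2]; rewrite /dsmooth; case: (leP mu r) => [r1|r1].
  by rewrite mulr_le0_ge0 //; lra.
case: (leP r (- mu)) => [r2|r2].
  by rewrite mulr_ge0_le0 //; lra.
by rewrite mulrCA divff ?gt_eqF // mulr1 subrr mulr0.
Qed.

Lemma fsmooth_ge r mu t : 0 < mu -> -1 <= t <= 1 ->
  t * r + mu * (1 - t ^+ 2) / 2 <= fsmooth r mu.
Proof.
move=> mu0 t1; rewrite fsmoothE //.
have := dsmooth_opt r mu0 t1; set s := dsmooth r mu => opt.
have : 0 <= mu * (s - t) ^+ 2 by rewrite mulr_ge0 ?sqr_ge0 // ltW.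
lra.
Qed.

Lemma fsmooth_tangent r h mu : 0 < mu ->
  fsmooth r mu + dsmooth r mu * h <= fsmooth (r + h) mu.
Proof.
move=> mu0; have := fsmooth_ge (r + h) mu0 (dsmooth_bound r mu0).
by rewrite (fsmoothE r mu0); lra.
Qed.

Lemma fsmooth_upper r h mu : 0 < mu ->
  fsmooth (r + h) mu <= fsmooth r mu + dsmooth r mu * h + h ^+ 2 / (2 * mu).
Proof.
move=> mu0; rewrite !fsmoothE //.
have := dsmooth_opt r mu0 (dsmooth_bound (r + h) mu0).
set s := dsmooth r mu; set s' := dsmooth (r + h) mu => opt.
have : 0 <= (mu * (s' - s) - h) ^+ 2 / (2 * mu).
  by rewrite divr_ge0 ?sqr_ge0 // mulr_ge0 // ltW.
have -> : (mu * (s' - s) - h) ^+ 2 / (2 * mu) =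
    mu * (s' - s) ^+ 2 / 2 - (s' - s) * h + h ^+ 2 / (2 * mu) by field; lra.
lra.
Qed.

Lemma dsmooth_lipschitz r r' mu : 0 < mu ->
  `|dsmooth r mu - dsmooth r' mu| <= `|r - r'| / mu.
Proof.
move=> mu0; rewrite ler_pdivlMr //.
have := dsmooth_opt r mu0 (dsmooth_bound r' mu0).
have := dsmooth_opt r' mu0 (dsmooth_bound r mu0).
set s := dsmooth r mu; set s' := dsmooth r' mu => o1 o2.
have [->|ss] := eqVneq s s'; first by rewrite subrr normr0 mul0r.
have ss0 : 0 < `|s - s'| by rewrite normr_gt0 subr_eq0.
rewrite -(ler_pM2l ss0) mulrA -expr2 real_normK ?num_real // -normrM.
apply: le_trans (ler_norm _); lra.
Qed.

(** Adding the optimality conditions at [mu] and [mu'] cancels [r] and leaves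
    [mu' (s' - s)^2 <= (s' - s) s (mu - mu')], where [s] is at most 1 in absolute value. *)
Lemma dsmooth_mu r mu mu' : 0 < mu' -> mu' <= mu ->
  `|dsmooth r mu' - dsmooth r mu| <= (mu - mu') / mu'.
Proof.
move=> mu0' mm; have mu0 : 0 < mu by exact: lt_le_trans mm.
rewrite ler_pdivlMr //.
have := dsmooth_opt r mu0 (dsmooth_bound r mu0').
have := dsmooth_opt r mu0' (dsmooth_bound r mu0).
have /andP[s1 s2] := dsmooth_bound r mu0.
set s := dsmooth r mu in s1 s2 *; set s' := dsmooth r mu' => o1 o2.
have [->|ss] := eqVneq s' s; first by rewrite subrr normr0 mul0r subr_ge0.
have ss0 : 0 < `|s' - s| by rewrite normr_gt0 subr_eq0.
rewrite -(ler_pM2l ss0) mulrA -expr2 real_normK ?num_real //.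
apply: (@le_trans _ _ (`|(s' - s) * s| * (mu - mu'))).
  apply: (@le_trans _ _ ((s' - s) * s * (mu - mu'))); first lra.
  by rewrite ler_wpM2r ?subr_ge0 // ler_norm.
rewrite normrM -mulrA ler_pM2l // ler_piMl ?subr_ge0 //.
by rewrite ler_norml s1 s2.
Qed.

Lemma fsmooth_mono r mu mu' : 0 < mu' -> mu' <= mu -> fsmooth r mu' <= fsmooth r mu.
Proof.
move=> mu0' mm; have mu0 : 0 < mu by exact: lt_le_trans mm.
have := fsmooth_ge r mu0 (dsmooth_bound r mu0'); apply: le_trans.
rewrite fsmoothE // lerD2l ler_pM2r // ler_wpM2r // subr_ge0.
have /andP[s1 s2] := dsmooth_bound r mu0'.
by rewrite -(real_normK (num_real _)) expr_le1 // ler_norml s1.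
Qed.

Lemma fsmooth_gap r mu mu' : 0 < mu' -> mu' <= mu ->
  fsmooth r mu <= fsmooth r mu' + (mu - mu') / 2.
Proof.
move=> mu0' mm; have mu0 : 0 < mu by exact: lt_le_trans mm.
have := fsmooth_ge r mu0' (dsmooth_bound r mu0); rewrite (fsmoothE r mu0).
set s := dsmooth r mu => h.
have : 0 <= (mu - mu') * s ^+ 2 by rewrite mulr_ge0 ?sqr_ge0 // subr_ge0.
lra.
Qed.

Lemma fsmooth_ge_norm r mu : 0 < mu -> `|r| <= fsmooth r mu.
Proof.
move=> mu0; rewrite /fsmooth; case: (leP mu `|r|) => // rm.
have -> : r ^+ 2 / (2 * mu) + mu / 2 = `|r| + (`|r| - mu) ^+ 2 / (2 * mu).
  by rewrite -(real_normK (num_real r)); field; lra.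
by rewrite lerDl divr_ge0 ?sqr_ge0 // mulr_ge0 // ltW.
Qed.

Lemma fsmooth_le_parabola r mu : 0 < mu -> fsmooth r mu <= r ^+ 2 / (2 * mu) + mu / 2.
Proof.
move=> mu0; rewrite /fsmooth; case: (leP mu `|r|) => // rm.
have -> : r ^+ 2 / (2 * mu) + mu / 2 = `|r| + (`|r| - mu) ^+ 2 / (2 * mu).
  by rewrite -(real_normK (num_real r)); field; lra.
by rewrite lerDl divr_ge0 ?sqr_ge0 // mulr_ge0 // ltW.
Qed.

Definition zone r mu : option bool :=
  if mu <= r then Some true else if r <= - mu then Some false else None.

Definition zone_sign (z : option bool) : R :=
  if z is Some b then (if b then 1 else -1) else 0.

Definition zone_band (z : option bool) : R := if z is Some _ then 0 else 1.

Lemma zone_band_sqr z : zone_band z * zone_band z = zone_band z.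
Proof. by case: z => [[]|]; rewrite /zone_band /= ?mul0r ?mul1r. Qed.

Lemma zone_dsmooth r mu : 0 < mu ->
  dsmooth r mu = zone_sign (zone r mu) + zone_band (zone r mu) * r / mu.
Proof.
move=> mu0; rewrite /dsmooth /zone; case: ifP => _; first by rewrite /= !mul0r addr0.
by case: ifP => _; rewrite /= ?mul0r ?addr0 // add0r mul1r.
Qed.

Lemma zone_band_le r mu : 0 < mu -> `|zone_band (zone r mu) * r| <= mu.
Proof.
move=> mu0; rewrite /zone; case: (leP mu r) => [_|r1]; first by rewrite /= mul0r normr0 ltW.
case: (leP r (- mu)) => [_|r2]; first by rewrite /= mul0r normr0 ltW.
by rewrite /= mul1r ler_norml !ltW.
Qed.

(** Linear zones remain linear when [mu] decreases, and the parabola lies above [fsmooth]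
    everywhere. So keeping the old zone overestimates the new value, the direction needed for the
    drift. *)
Lemma zone_fsmooth_le r mu mu' : 0 < mu' -> mu' <= mu ->
  let z := zone r mu in
  fsmooth r mu' <= zone_sign z * r + zone_band z * (r ^+ 2 / (2 * mu') + mu' / 2).
Proof.
move=> mu0' mm /=; rewrite /zone; case: (leP mu r) => [r1|r1].
  rewrite /= mul0r addr0 mul1r /fsmooth ger0_norm; last lra.
  by rewrite ifT //; lra.
case: (leP r (- mu)) => [r2|r2].
  rewrite /= mul0r addr0 mulN1r /fsmooth ler0_norm; last lra.
  by rewrite ifT //; lra.
by rewrite /= mul0r add0r mul1r fsmooth_le_parabola.
Qed.

Lemma zone_fsmooth r mu : 0 < mu ->
  let z := zone r mu in
  fsmooth r mu = zone_sign z * r + zone_band z * (r ^+ 2 / (2 * mu) + mu / 2).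
Proof.
move=> mu0; rewrite /= /zone /fsmooth; case: (leP mu r) => [r1|r1].
  by rewrite /= mul0r addr0 mul1r ger0_norm ?r1 //; lra.
case: (leP r (- mu)) => [r2|r2].
  rewrite /= mul0r addr0 mulN1r ler0_norm; last lra.
  by have -> : mu <= - r by lra.
by rewrite leNgt ltr_norml r2 r1 /= mul0r add0r mul1r.
Qed.

End Huber.

(** * The smoothed quantile loss *)

Section SmoothedLoss.
Context {R : realType} {m N : nat} (X : 'M[R]_(m, N)) (y : 'rV[R]_N) (tau : R).
Implicit Types (w h : 'rV[R]_m) (mu : R).

Definition smoothed_loss mu w : R :=
  \sum_j (2^-1 * fsmooth ((y - w *m X) 0 j) mu + (tau - 2^-1) * (y - w *m X) 0 j).

Definition loss_slopes mu w : 'rV[R]_N :=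
  \row_j (2^-1 * dsmooth ((y - w *m X) 0 j) mu + (tau - 2^-1)).

Lemma loss_slopesE mu w i j : loss_slopes mu w i j =
  2^-1 * dsmooth ((y - w *m X) 0 j) mu + (tau - 2^-1).
Proof. by rewrite mxE. Qed.

Definition loss_gradient mu w : 'rV[R]_m := - (loss_slopes mu w *m X^T).

Lemma dotv_loss_gradient mu w h : dotv (loss_gradient mu w) h =
  - \sum_j (2^-1 * dsmooth ((y - w *m X) 0 j) mu + (tau - 2^-1)) * (h *m X) 0 j.
Proof.
rewrite /loss_gradient dotvNl dotv_mull trmxK; congr (- _).
by apply: eq_bigr => j _; rewrite mxE.
Qed.

Lemma residualD w h j : (y - (w + h) *m X) 0 j = (y - w *m X) 0 j + - (h *m X) 0 j.
Proof. by rewrite mulmxDl !mxE; ring. Qed.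

Lemma smoothed_loss_tangent mu w h : 0 < mu ->
  smoothed_loss mu w + dotv (loss_gradient mu w) h <= smoothed_loss mu (w + h).
Proof.
move=> mu0; rewrite dotv_loss_gradient -sumrN -big_split; apply: ler_sum => j _ /=.
rewrite residualD; move: ((y - w *m X) 0 j) ((h *m X) 0 j) => r e.
have := fsmooth_tangent r (- e) mu0; lra.
Qed.

Lemma smoothed_loss_upper mu w h : 0 < mu ->
  smoothed_loss mu (w + h) <= smoothed_loss mu w + dotv (loss_gradient mu w) h
    + dotv (h *m X) (h *m X) / (4 * mu).
Proof.
move=> mu0; rewrite dotv_loss_gradient -sumrN mulr_suml -!big_split.
apply: ler_sum => j _ /=.
rewrite residualD; move: ((y - w *m X) 0 j) ((h *m X) 0 j) => r e.
have := fsmooth_upper r (- e) mu0.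
have -> : (- e) ^+ 2 / (2 * mu) = 2 * (e * e / (4 * mu)) by field; lra.
lra.
Qed.

Lemma smoothed_loss_is_gradient mu w : 0 < mu ->
  is_gradient (smoothed_loss mu) w (loss_gradient mu w).
Proof.
move=> mu0.
apply: (@is_gradient_quadratic _ _ _ _ _ (N%:R * (m%:R * `|X|) ^+ 2 / (4 * mu))) => h.
have t := smoothed_loss_tangent w h mu0; have u := smoothed_loss_upper w h mu0.
have mu4 : 0 < 4 * mu by rewrite mulr_gt0.
rewrite ger0_norm; last lra.
apply: (@le_trans _ _ (dotv (h *m X) (h *m X) / (4 * mu))); first lra.
rewrite mulrAC ler_pM2r ?invr_gt0 //.
apply: le_trans (ler_norm _) _; apply: le_trans (norm_dotv_le _ _) _.
have hX := norm_mulmx_le h X.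
rewrite -[leLHS]mulrA -[leRHS]mulrA ler_wpM2l //.
by rewrite (le_trans (ler_pM _ _ hX hX)) // -expr2 exprMn.
Qed.

Lemma loss_gradient_lipschitz : exists2 C : R, 0 <= C & forall mu w w', 0 < mu ->
  `|loss_gradient mu w - loss_gradient mu w'| <= C / mu * `|w - w'|.
Proof.
exists (N%:R * `|X^T| * (m%:R * `|X|)) => [|mu w w' mu0]; first by rewrite !mulr_ge0.
rewrite /loss_gradient -opprB opprK addrC -mulmxBl normrN.
rewrite (le_trans (norm_mulmx_le _ _)) // -!mulrA ler_wpM2l // ler_wpM2l //.
apply: mx_norm_le => [|i j]; first by rewrite !mulr_ge0 // invr_ge0 ltW.
have -> : (loss_slopes mu w - loss_slopes mu w') i j =
    loss_slopes mu w i j - loss_slopes mu w' i j by rewrite !mxE.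
rewrite !loss_slopesE.
have -> (a b : R) : 2^-1 * a + (tau - 2^-1) - (2^-1 * b + (tau - 2^-1)) = 2^-1 * (a - b).
  by ring.
rewrite normrM ger0_norm ?invr_ge0 //.
apply: (@le_trans _ _ `|dsmooth ((y - w *m X) 0 j) mu - dsmooth ((y - w' *m X) 0 j) mu|).
  by rewrite ler_piMl // invf_le1 // ler1n.
rewrite (le_trans (dsmooth_lipschitz _ _ mu0)) //.
have -> : (y - w *m X) 0 j - (y - w' *m X) 0 j = - ((w - w') *m X) 0 j.
  by rewrite mulmxBl !mxE; ring.
rewrite normrN ler_pdivrMr // (le_trans (coord_le_norm _ _ _)) //.
apply: le_trans (norm_mulmx_le _ _) _.
by rewrite le_eqVlt; apply/orP; left; apply/eqP; field; rewrite gt_eqF.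
Qed.

Lemma loss_gradient_mu : exists2 C : R, 0 <= C & forall mu mu' w, 0 < mu' -> mu' <= mu ->
  `|loss_gradient mu' w - loss_gradient mu w| <= C * ((mu - mu') / mu').
Proof.
exists (N%:R * `|X^T|) => [|mu mu' w mu0' mm]; first by rewrite !mulr_ge0.
rewrite /loss_gradient -opprB opprK addrC -mulmxBl normrN.
rewrite (le_trans (norm_mulmx_le _ _)) // ler_wpM2l //.
have q0 : 0 <= (mu - mu') / mu' by rewrite divr_ge0 ?subr_ge0 // ltW.
apply: mx_norm_le => // i j.
have -> : (loss_slopes mu' w - loss_slopes mu w) i j =
    loss_slopes mu' w i j - loss_slopes mu w i j by rewrite !mxE.
rewrite !loss_slopesE.
have -> (a b : R) : 2^-1 * a + (tau - 2^-1) - (2^-1 * b + (tau - 2^-1)) = 2^-1 * (a - b).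
  by ring.
rewrite normrM ger0_norm ?invr_ge0 //.
have := dsmooth_mu ((y - w *m X) 0 j) mu0' mm.
move: (`|_|) => a.
by have := q0; lra.
Qed.

Lemma smoothed_loss_mono mu mu' w : 0 < mu' -> mu' <= mu ->
  smoothed_loss mu' w <= smoothed_loss mu w.
Proof.
move=> mu0' mm; apply: ler_sum => j _; rewrite lerD2r ler_pM2l ?invr_gt0 //.
exact: fsmooth_mono.
Qed.

Lemma smoothed_loss_gap mu mu' w : 0 < mu' -> mu' <= mu ->
  smoothed_loss mu w <= smoothed_loss mu' w + N%:R * (mu - mu').
Proof.
move=> mu0' mm; have -> : N%:R * (mu - mu') = \sum_(j < N) (mu - mu').
  by rewrite sumr_const card_ord mulr_natl.
rewrite -big_split; apply: ler_sum => j _ /=.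
have := fsmooth_gap ((y - w *m X) 0 j) mu0' mm.
have : 0 <= mu - mu' by rewrite subr_ge0.
lra.
Qed.

Lemma smoothed_loss_ge0 mu w : 0 < tau < 1 -> 0 < mu -> 0 <= smoothed_loss mu w.
Proof.
move=> /andP[t0 t1] mu0; apply: sumr_ge0 => j _.
have := fsmooth_ge_norm ((y - w *m X) 0 j) mu0; move: ((y - w *m X) 0 j) => r h.
have [r0|r0] := leP 0 r.
  by have := mulr_ge0 (ltW t0) r0; rewrite ger0_norm // in h; lra.
have : 0 <= (1 - tau) * - r by rewrite mulr_ge0 //; lra.
by rewrite ltr0_norm // in h; lra.
Qed.

End SmoothedLoss.

(* A function made of finitely many concave parabolas; a frozen piece is a single
   point [t = 0] at which the function may have a convex kink. *)
Record concave_pieces (R : realType) (g : R -> R) := ConcavePieces {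
  piece : finType;
  piece_of : R -> piece;
  frozen : piece -> bool;
  coef0 : piece -> R;
  coef1 : piece -> R;
  coef2 : piece -> R;
  coef2_ge0 : forall j, 0 <= coef2 j;
  piecesE : forall t, g t =
    coef0 (piece_of t) + coef1 (piece_of t) * t - coef2 (piece_of t) / 2 * t ^+ 2;
  frozen0 : forall t, frozen (piece_of t) -> t = 0;
  piece_tangent : forall t, ~~ frozen (piece_of t) -> exists2 delta : R, 0 < delta &
    forall u, `|u - t| < delta ->
      g u <= g t + (coef1 (piece_of t) - coef2 (piece_of t) * t) * (u - t) }.

(** * The objective on a cell *)

Section Cells.
Context {R : realType} {m N : nat} (X : 'M[R]_(m, N)) (y : 'rV[R]_N) (tau : R).
Context (g : R -> R) (cp : concave_pieces g) (pe : pred 'I_m) (nn : R).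
Hypothesis nn_ge0 : 0 <= nn.
Implicit Types (w : 'rV[R]_m) (mu : R).

Definition separable w : R := \sum_(i | pe i) g (w 0 i).
Definition objective mu w : R := smoothed_loss X y tau mu w + nn * separable w.

Definition cell := ({ffun 'I_N -> option bool} * {ffun 'I_m -> piece cp})%type.

Definition cell_of mu w : cell :=
  ([ffun j => zone ((y - w *m X) 0 j) mu], [ffun i => piece_of cp (w 0 i)]).

Section OneCell.
Variable C : cell.

(** A frozen coordinate is 0 throughout the cell, so its rows can be erased from the cell data
    without changing values; the cell gradient then ignores the kink there. *)
Definition free i := ~~ (pe i && frozen (C.2 i)).
Definition cell_slopes : 'rV[R]_N :=
  \row_j (2^-1 * zone_sign (C.1 j) + (tau - 2^-1)).
Definition cell_X : 'M[R]_(m, N) :=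
  \matrix_(i, j) ((free i)%:R * (zone_band (C.1 j) * X i j)).
Definition cell_y : 'rV[R]_N := \row_j (zone_band (C.1 j) * y 0 j).
Definition cell_b : 'rV[R]_m := \row_i ((free i)%:R *
  (nn * ((pe i)%:R * coef1 (C.2 i)) - (cell_slopes *m X^T) 0 i)).
(** The square root makes [E *m E^T] the diagonal matrix of penalty curvatures, real because they
    are nonnegative, as concavity of the pieces ensures. *)
Definition cell_E : 'M[R]_m := diag_mx (\row_i ((free i)%:R *
  Num.sqrt (nn * ((pe i)%:R * coef2 (C.2 i))))).
Definition cell_c : R :=
  dotv cell_slopes y + nn * \sum_(i | pe i) coef0 (C.2 i).
Definition cell_k : R := \sum_j zone_band (C.1 j).

Definition cell_q := cellq cell_X cell_E cell_y cell_b cell_c cell_k.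
Definition cell_g := cellg cell_X cell_E cell_y cell_b.

End OneCell.

Lemma free_mul mu w i : (free (cell_of mu w) i)%:R * w 0 i = w 0 i.
Proof.
rewrite /free /= ffunE; case: (boolP (frozen _)) => [/frozen0 ->|_]; first by rewrite mulr0.
by rewrite andbF mul1r.
Qed.

Lemma cell_residual mu w j : let C := cell_of mu w in
  (cell_y C - w *m cell_X C) 0 j = zone_band (C.1 j) * (y - w *m X) 0 j.
Proof.
move=> C; rewrite !mxE mulrBr; congr (_ - _); rewrite mulr_sumr; apply: eq_bigr => i _.
by rewrite mxE mulrA [w 0 i * _]mulrC free_mul mulrCA.
Qed.

Lemma cell_slope_le mu w : 0 < mu ->
  `|slope (cell_X (cell_of mu w)) (cell_y (cell_of mu w)) mu w| <= 1.
Proof.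
move=> mu0; rewrite /slope mx_normZ gtr0_norm ?invr_gt0 // ler_pdivrMl // mulr1.
apply: mx_norm_le => [|i j]; first exact: ltW.
by rewrite ord1 cell_residual /= ffunE zone_band_le.
Qed.

Lemma sum_pe (f : 'I_m -> R) : \sum_(i | pe i) f i = \sum_i (pe i)%:R * f i.
Proof. by rewrite big_mkcond; apply: eq_bigr => i _; case: (pe i); rewrite ?mul1r ?mul0r. Qed.

Lemma coef_sqrt_sqr (C : cell) i :
  Num.sqrt (nn * ((pe i)%:R * coef2 (C.2 i))) ^+ 2 = nn * ((pe i)%:R * coef2 (C.2 i)).
Proof. by rewrite sqr_sqrtr // !mulr_ge0 // coef2_ge0. Qed.

Lemma cell_EE mu w i : let C := cell_of mu w in
  (w *m cell_E C) 0 i = w 0 i * Num.sqrt (nn * ((pe i)%:R * coef2 (C.2 i))).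
Proof. by move=> C; rewrite mul_mx_diag !mxE [LHS]mulrA [w 0 i * (free C i)%:R]mulrC free_mul. Qed.

Lemma cell_qE mu mu' w : let C := cell_of mu w in 0 < mu' ->
  cell_q C mu' w = \sum_j (2^-1 * (zone_sign (C.1 j) * (y - w *m X) 0 j +
      zone_band (C.1 j) * ((y - w *m X) 0 j ^+ 2 / (2 * mu') + mu' / 2))
      + (tau - 2^-1) * (y - w *m X) 0 j) + nn * separable w.
Proof.
move=> C mu0'; rewrite /cell_q /cellq.
have -> : dotv (cell_y C - w *m cell_X C) (cell_y C - w *m cell_X C) / (4 * mu') =
    \sum_j zone_band (C.1 j) * ((y - w *m X) 0 j ^+ 2 / (4 * mu')).
  rewrite mulr_suml; apply: eq_bigr => j _; rewrite cell_residual mulrACA zone_band_sqr.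
  by rewrite -/C expr2 [RHS]mulrA.
have -> : dotv (w *m cell_E C) (w *m cell_E C) / 2 =
    nn * \sum_(i | pe i) coef2 (C.2 i) / 2 * w 0 i ^+ 2.
  rewrite sum_pe mulr_suml mulr_sumr; apply: eq_bigr => i _.
  rewrite cell_EE; move: (coef_sqrt_sqr C i); set s := Num.sqrt _ => sq.
  have -> : w 0 i * s * (w 0 i * s) / 2 = s ^+ 2 * w 0 i ^+ 2 / 2 by ring.
  by rewrite sq; ring.
have -> : dotv (cell_b C) w = nn * \sum_(i | pe i) coef1 (C.2 i) * w 0 i
    - dotv (cell_slopes C) (w *m X).
  rewrite -[X in w *m X]trmxK -dotv_mull sum_pe mulr_sumr -sumrB; apply: eq_bigr => i _.
  by rewrite mxE [_%:R * _]mulrC -mulrA free_mul; ring.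
have sepE : separable w = \sum_(i | pe i) coef0 (C.2 i) +
    \sum_(i | pe i) coef1 (C.2 i) * w 0 i -
    \sum_(i | pe i) coef2 (C.2 i) / 2 * w 0 i ^+ 2.
  rewrite -big_split -sumrB; apply: eq_bigr => i _ /=.
  by rewrite (piecesE cp) ffunE.
have slopesE : dotv (cell_slopes C) y - dotv (cell_slopes C) (w *m X) =
    \sum_j (2^-1 * zone_sign (C.1 j) + (tau - 2^-1)) * (y - w *m X) 0 j.
  by rewrite -dotvBr; apply: eq_bigr => j _; rewrite mxE.
have sumE : \sum_j (2^-1 * (zone_sign (C.1 j) * (y - w *m X) 0 j +
      zone_band (C.1 j) * ((y - w *m X) 0 j ^+ 2 / (2 * mu') + mu' / 2))
      + (tau - 2^-1) * (y - w *m X) 0 j) =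
    \sum_j (2^-1 * zone_sign (C.1 j) + (tau - 2^-1)) * (y - w *m X) 0 j +
    \sum_j zone_band (C.1 j) * ((y - w *m X) 0 j ^+ 2 / (4 * mu')) + cell_k C * mu' / 4.
  rewrite /cell_k !mulr_suml -!big_split; apply: eq_bigr => j _ /=.
  by field; lra.
rewrite sumE -slopesE sepE /cell_c; ring.
Qed.

Lemma objective_cell mu w : 0 < mu -> objective mu w = cell_q (cell_of mu w) mu w.
Proof.
move=> mu0; rewrite cell_qE // /objective; congr (_ + _); apply: eq_bigr => j _.
by rewrite ffunE -zone_fsmooth.
Qed.

Lemma objective_cell_le mu mu' w : 0 < mu' -> mu' <= mu ->
  objective mu' w <= cell_q (cell_of mu w) mu' w.
Proof.
move=> mu0' mm; rewrite cell_qE // /objective lerD2r; apply: ler_sum => j _.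
rewrite ffunE lerD2r ler_pM2l ?invr_gt0 //; exact: (zone_fsmooth_le _ mu0' mm).
Qed.

Lemma cell_gE mu w i : 0 < mu -> let C := cell_of mu w in
  cell_g C mu w 0 i = (free C i)%:R * (loss_gradient X y tau mu w 0 i +
    nn * ((pe i)%:R * (coef1 (C.2 i) - coef2 (C.2 i) * w 0 i))).
Proof.
move=> mu0 C; rewrite /cell_g /cellg.
have subE (u v : 'rV[R]_m) : (u - v) 0 i = u 0 i - v 0 i by rewrite !mxE.
have scaleE a (u : 'rV[R]_m) : (a *: u) 0 i = a * u 0 i by rewrite mxE.
have oppE (u : 'rV[R]_m) : (- u) 0 i = - u 0 i by rewrite mxE.
rewrite !subE scaleE.
have -> : (w *m cell_E C *m (cell_E C)^T) 0 i =
    (free C i)%:R * (nn * ((pe i)%:R * (coef2 (C.2 i) * w 0 i))).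
  rewrite tr_diag_mx mul_mx_diag mxE cell_EE [(\row__ _) 0 i]mxE.
  move: (coef_sqrt_sqr C i); set s := Num.sqrt _ => sq.
  have -> (a : R) : w 0 i * s * (a * s) = a * (s ^+ 2 * w 0 i) by ring.
  by rewrite sq; ring.
have -> : ((cell_y C - w *m cell_X C) *m (cell_X C)^T) 0 i =
    (free C i)%:R * \sum_j zone_band (C.1 j) * (y - w *m X) 0 j * X i j.
  rewrite [LHS]mxE mulr_sumr; apply: eq_bigr => j _; rewrite cell_residual [_^T j i]mxE.
  rewrite [cell_X C i j]mxE -/C.
  have -> (a b c e : R) : b * c * (a * (b * e)) = a * ((b * b) * c * e) by ring.
  by rewrite zone_band_sqr.
have -> : cell_b C 0 i = (free C i)%:R * (nn * ((pe i)%:R * coef1 (C.2 i)) -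
    \sum_j (2^-1 * zone_sign (C.1 j) + (tau - 2^-1)) * X i j).
  by rewrite mxE [(_ *m X^T) 0 i]mxE; congr (_ * (_ - _)); apply: eq_bigr => j _; rewrite !mxE.
have -> : loss_gradient X y tau mu w 0 i =
    - (\sum_j (2^-1 * zone_sign (C.1 j) + (tau - 2^-1)) * X i j +
    (2 * mu)^-1 * \sum_j zone_band (C.1 j) * (y - w *m X) 0 j * X i j).
  rewrite /loss_gradient oppE [(_ *m X^T) 0 i]mxE; congr (- _).
  rewrite mulr_sumr -big_split; apply: eq_bigr => j _.
  rewrite loss_slopesE [X^T j i]mxE zone_dsmooth // /C /= ffunE.
  by field; lra.
ring.
Qed.

Lemma cell_level_ex n (C : cell) : exists (phi : {poly R}) (K r : R), [/\ 0 < K, 0 < r &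
  forall mu w, 0 < mu <= r -> cell_of mu w = C ->
    let G := `|cell_g C mu w| in
    phi = 0 /\ 1 <= K * G \/
    `|objective mu w - phi.[mu]| <= K * (G ^+ 2 + (mu ^+ n.+1) ^+ 2) /\
    forall mu', 0 < mu' <= mu -> objective mu' w - objective mu w <= phi.[mu'] - phi.[mu]
      + K * (mu - mu') * (G + mu ^+ n.+1 + (mu - mu') / mu')].
Proof.
have [phi [K [r [K0 r0 H]]]] :=
  cell_level (cell_X C) (cell_E C) (cell_y C) (cell_b C) (cell_c C) (cell_k C) n.
exists phi, K, r; split=> // mu w mur wC /=.
have mu0 : 0 < mu by case/andP: mur.
have s1 : `|slope (cell_X C) (cell_y C) mu w| <= 1 by rewrite -wC cell_slope_le.
have oE := objective_cell w mu0; rewrite wC /cell_q in oE; rewrite oE.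
have [?|[H1 H2]] := H mu w mur s1; [by left | right; split=> // mu' mu'mu].
have [mu0' mm] := andP mu'mu.
have := objective_cell_le w mu0' mm; rewrite wC /cell_q => le.
by apply: le_trans (H2 mu' mu'mu); rewrite lerD2r.
Qed.

End Cells.

(** * Truncated levels and the estimates for one step *)

Lemma poly_truncation {R : realType} (p : {poly R}) n :
  let q := take_poly n p in exists2 L : R, 0 < L &
  forall x y : R, 0 < x <= 1 -> 0 <= y <= x ->
    [/\ `|p.[x] - q.[x]| <= L * x ^+ n, `|q.[x] - q.[y]| <= L * (x - y) &
        x * `|(p.[x] - q.[x]) - (p.[y] - q.[y])| <= L * x ^+ n * (x - y)].
Proof.
rewrite /=.
have [L1 L10 H1] := poly_lipschitz (take_poly n p).
have [L2 L20 H2] := poly_lipschitz (drop_poly n p).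
exists (L1 + L2 * n.+1%:R + 1) => [|x y /andP[x0 x1] /andP[y0 yx]].
  by rewrite ltr_wpDl // addr_ge0 // mulr_ge0.
have x01 : 0 <= x <= 1 by rewrite ltW.
have y01 : 0 <= y <= 1 by rewrite y0 (le_trans yx).
have xy0 : 0 <= x - y by rewrite subr_ge0.
have [_ t1] := H1 x y x01 y01; have [t2 t3] := H2 x y x01 y01.
rewrite (ger0_norm xy0) in t1 t3.
have e z : p.[z] - (take_poly n p).[z] = (drop_poly n p).[z] * z ^+ n.
  by rewrite -{1}(poly_take_drop n p) !hornerE addrC addKr.
have xn0 : 0 <= x ^+ n by rewrite exprn_ge0 // ltW.
have L2n : 0 <= L2 * n.+1%:R by rewrite mulr_ge0.
have pow : x * (x ^+ n - y ^+ n) <= n%:R * x ^+ n * (x - y).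
  elim: n {e t2 t3 H2 L2 L20 H1 L1 L10 t1 L2n} xn0 => [|n IH] _; first by rewrite subrr mulr0 !mul0r.
  have xn0 : 0 <= x ^+ n by rewrite exprn_ge0 // ltW.
  have yxn : y ^+ n <= x ^+ n by rewrite lerXn2r // nnegrE // ltW.
  have := ler_wpM2l (ltW x0) (IH xn0).
  have : x * ((x - y) * y ^+ n) <= x * ((x - y) * x ^+ n).
    by rewrite ler_pM2l // ler_wpM2l.
  rewrite -natr1 !exprS; lra.
split.
- rewrite e normrM (ger0_norm xn0) ler_wpM2r // (le_trans t2) //.
  by have := L2n; rewrite -natr1 mulrDr mulr1; have := mulr_ge0 L20 (ler0n R n); lra.
- by rewrite (le_trans t1) // ler_wpM2r //; lra.
rewrite !e.
have -> : (drop_poly n p).[x] * x ^+ n - (drop_poly n p).[y] * y ^+ n =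
    (drop_poly n p).[x] * (x ^+ n - y ^+ n) + ((drop_poly n p).[x] - (drop_poly n p).[y]) * y ^+ n.
  by ring.
have yn0 : 0 <= y ^+ n by rewrite exprn_ge0.
have yxn : y ^+ n <= x ^+ n by rewrite lerXn2r // nnegrE // ltW.
have s1 : `|(drop_poly n p).[x] * (x ^+ n - y ^+ n) +
    ((drop_poly n p).[x] - (drop_poly n p).[y]) * y ^+ n| <=
    L2 * (x ^+ n - y ^+ n) + L2 * (x - y) * x ^+ n.
  apply: le_trans (ler_normD _ _) _; apply: lerD; rewrite normrM.
    by rewrite ler_pM // ger0_norm // subr_ge0.
  by rewrite ler_pM // ger0_norm.
apply: le_trans (ler_wpM2l (ltW x0) s1) _.
have s2 := ler_wpM2l L20 pow.
have s3 : x * (L2 * (x - y) * x ^+ n) <= 1 * (L2 * (x - y) * x ^+ n).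
  by rewrite ler_wpM2r // !mulr_ge0.
have s4 : 0 <= (L1 + 1) * x ^+ n * (x - y) by rewrite !mulr_ge0 // addr_ge0.
rewrite -natr1; lra.
Qed.

Lemma amgm_scaled {R : realType} (a i P k t : R) : 0 < a -> 0 <= i -> k != 0 ->
  t * (i / k) * P <= a * (i * P ^+ 2) + t ^+ 2 / (2 * a) * ((i / k) / k).
Proof.
move=> a0 i0 k0; have an0 : a != 0 by rewrite gt_eqF.
have sq : 0 <= i * (2 * a * P - t / k) ^+ 2 / (4 * a).
  apply: divr_ge0; last by rewrite mulr_ge0 // ltW.
  by apply: mulr_ge0 => //; exact: sqr_ge0.
have -> : a * (i * P ^+ 2) + t ^+ 2 / (2 * a) * ((i / k) / k) = t * (i / k) * P
    + i * (2 * a * P - t / k) ^+ 2 / (4 * a) + t ^+ 2 * i / (4 * a) / k ^+ 2.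
  by field; rewrite k0 an0.
rewrite -addrA lerDl; apply: addr_ge0 => //; apply: divr_ge0; last exact: sqr_ge0.
apply: divr_ge0; last by rewrite mulr_ge0 // ltW.
by apply: mulr_ge0 => //; exact: sqr_ge0.
Qed.

(** The degree bound [Q] is what makes differences of levels tame. The first alternative belongs to
    cells where the gradient is bounded away from 0. *)
Definition is_level {R : realType} m N (X : 'M[R]_(m, N)) (y : 'rV[R]_N) (tau : R)
    (g : R -> R) (cp : concave_pieces g) (pe : pred 'I_m) (nn : R) (Q : nat)
    (C : @cell R m N g cp) (q : {poly R}) (K r : R) : Prop :=
  let F := objective X y tau g pe nn in
  [/\ (size q <= Q.+1)%N, 0 < K, 0 < r &
  forall mu v, 0 < mu <= r -> cell_of X y cp mu v = C ->
    let G := `|cell_g X y tau pe nn C mu v| in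
    q = 0 /\ 1 <= K * G \/
    `|F mu v - q.[mu]| <= K * (G ^+ 2 + mu ^+ Q.+1) /\
    forall mu', 0 < mu' <= mu -> `|q.[mu'] - q.[mu]| <= K * (mu - mu') /\
      F mu' v - F mu v <= q.[mu'] - q.[mu]
        + K * (mu - mu') * (G + mu ^+ Q + (mu - mu') / mu')].

(** Cutting the level at degree [Q] costs [mu ^+ Q.+1] in value and [mu ^+ Q * (mu - mu')] in
    variation, which is the tolerated accuracy. *)
Lemma cell_truncation {R : realType} m N (X : 'M[R]_(m, N)) (y : 'rV[R]_N) (tau : R)
    (g : R -> R) (cp : concave_pieces g) (pe : pred 'I_m) (nn : R) (Q : nat)
    (C : @cell R m N g cp) : 0 <= nn ->
  exists z : {poly R} * R * R, is_level X y tau pe nn Q C z.1.1 z.1.2 z.2.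
Proof.
move=> nn0; have [phi [K [r [K0 r0 H]]]] := cell_level_ex X y tau pe nn0 Q C.
have [L L0 HL] := poly_truncation phi Q.+1.
exists (take_poly Q.+1 phi, K + L, Num.min 1 r); split=> /=.
- exact: size_take_poly.
- exact: addr_gt0.
- by rewrite lt_min ltr01.
move=> mu v /andP[mu0]; rewrite le_min => /andP[mu1 mur] vC.
set G := `|cell_g _ _ _ _ _ _ _ _|.
have G0 : 0 <= G by exact: normr_ge0.
have m0r : 0 < mu <= r by rewrite mu0.
have mu01 : 0 < mu <= 1 by rewrite mu0.
case: (H mu v m0r vC) => [[-> KG]|[H1 H2]]; [left|right].
  by rewrite raddf0; split=> //; rewrite mulrDl (le_trans KG) // lerDl mulr_ge0 // ltW.
have muQ : 0 <= mu ^+ Q.+1 by rewrite exprn_ge0 // ltW.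
have muQ' : 0 <= mu ^+ Q by rewrite exprn_ge0 // ltW.
have muQ1 : mu ^+ Q.+1 <= 1 by rewrite exprn_ile1 // ltW.
split.
  have [||t1 _ _] := HL mu 0; rewrite ?lexx ?(ltW mu0) //.
  have t2 := ler_distD phi.[mu] (objective X y tau g pe nn mu v) (take_poly Q.+1 phi).[mu].
  apply: le_trans t2 _; apply: le_trans (lerD H1 t1) _.
  have t3 : (mu ^+ Q.+1) ^+ 2 <= mu ^+ Q.+1 by rewrite expr2 ler_piMr.
  have t4 : K * (mu ^+ Q.+1) ^+ 2 <= K * mu ^+ Q.+1 by rewrite ler_pM2l.
  have t5 : 0 <= L * G ^+ 2 by rewrite mulr_ge0 ?sqr_ge0 // ltW.
  rewrite -/G; lra.
move=> mu' mm'; have [mu0' m'm] := andP mm'.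
have m'm0 : 0 <= mu' <= mu by rewrite ltW.
have [_ t2 t3] := HL mu mu' mu01 m'm0.
have D0 : 0 <= mu - mu' by rewrite subr_ge0.
split; first by rewrite distrC mulrDl (le_trans t2) // lerDr mulr_ge0 // ltW.
have t4 : `|phi.[mu] - (take_poly Q.+1 phi).[mu] -
    (phi.[mu'] - (take_poly Q.+1 phi).[mu'])| <= L * mu ^+ Q * (mu - mu').
  by rewrite -(ler_pM2l mu0) (le_trans t3) // exprS le_eqVlt; apply/orP; left; apply/eqP; ring.
have t5 := H2 mu' mm'; rewrite -/G in t5.
have q0 : 0 <= (mu - mu') / mu' by rewrite divr_ge0 // ltW.
have t6 : 0 <= L * (mu - mu') * (G + (mu - mu') / mu') by nonneg.
have t7 : K * (mu - mu') * mu ^+ Q.+1 <= K * (mu - mu') * mu ^+ Q.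
  by rewrite ler_wpM2l ?exprS ?ler_piMl // mulr_ge0 // ltW.
move: t4; rewrite ler_norml => /andP[t4 _].
move: (phi.[mu]) (phi.[mu']) (take_poly Q.+1 phi).[mu] (take_poly Q.+1 phi).[mu']
  t4 t5 => e1 e2 e3 e4 t4 t5; lra.
Qed.

Lemma relative_step {R : realType} (a a' k : R) : 0 < a' -> a' <= a -> 2 <= k ->
  a - a' <= a / k -> (a - a') / a' <= 2 / k.
Proof.
move=> a'0 a'a k2 ms; have k0 : 0 < k by lra.
rewrite ler_pdivrMr //.
have w1 : a / k <= a / 2 by rewrite ler_pM2l ?(lt_le_trans a'0) // lef_pV2 ?posrE.
have w2 : a <= 2 * a' by lra.
by apply: le_trans ms _; rewrite [leRHS]mulrAC ler_pM2r ?invr_gt0.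
Qed.

(** Here [a] and [a'] are successive values of [mu], [i] is [k^-d], [e] is [E k], [P] and [G] are
    the norms of the stationarity residual and of the cell gradient. The value goes from [x0] to [f]
    by the proximal step and from [f] to [x1] by lowering [mu]; [q0] and [q1] are the levels before
    and after. *)
Lemma cell_step_estimates {R : realType}
    (f x0 x1 q0 q1 G P a a' aQ bQ i e k K M N B beta c1 A : R) :
  A = M ^+ 2 * beta ^+ 2 / (2 * c1) + M * bQ + 2 * (M * beta)
    + (M + N) * beta + M + B * M ^+ 2 ->
  0 < i -> 0 < e -> 2 <= k -> 0 < a' -> a' <= a -> a - a' <= a / k -> a = beta * i ->
  0 <= aQ -> a * aQ = bQ * e -> i / k <= e -> 0 <= G -> G <= P -> 0 < K -> K <= M ->
  0 <= N -> 0 < beta -> 0 <= bQ -> 0 < c1 -> 0 <= B ->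
  x1 <= f -> f <= x0 - 2 * c1 * (i * P ^+ 2) -> f <= x1 + N * (a - a') ->
  `|f - q0| <= K * (G ^+ 2 + a * aQ) -> `|q1 - q0| <= K * (a - a') ->
  x1 - f <= q1 - q0 + K * (a - a') * (G + aQ + (a - a') / a') ->
  x1 <= x0 - c1 * (i * P ^+ 2) + (q1 - q0) + A * (e / k) /\
  `|x1 - q1| <= A * (P ^+ 2 + e).
Proof.
move=> AE i0 e0 k2 a'0 a'a ms aE aQ0 aQE ie G0 GP K0 KM N0 beta0 bQ0 c10 B0.
move=> h1 h2 gap s1 s3 s4.
have kR : 0 < k by apply: lt_le_trans k2.
have M0 : 0 < M by apply: lt_le_trans KM.
have a0 : 0 < a by apply: lt_le_trans a'a.
have P0 : 0 <= P by apply: le_trans GP.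
have D0 : 0 <= a - a' by rewrite subr_ge0.
have p0 : 0 <= P ^+ 2 by exact: sqr_ge0.
have t1 : 0 <= M ^+ 2 * beta ^+ 2 / (2 * c1) by apply: divr_ge0; nonneg.
have t2 : 0 <= M * bQ by nonneg.
have t3 : 0 <= M * beta by nonneg.
have t4 : 0 <= N * beta by nonneg.
have t5 : 0 <= B * M ^+ 2 by nonneg.
have DE : a - a' <= beta * e.
  by apply: le_trans ms _; rewrite aE -mulrA ler_pM2l.
split; last first.
  have u1 : `|f - q0| <= M * P ^+ 2 + M * bQ * e.
    apply: le_trans s1 _; rewrite aQE -mulrA -mulrDr ler_pM //; first exact: ltW.
      by nonneg.
    by rewrite lerD2r lerXn2r // nnegrE.
  have u2 : `|x1 - f| <= N * beta * e.
    have u3 : N * (a - a') <= N * (beta * e) by rewrite ler_wpM2l.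
    by rewrite ler_norml; apply/andP; split; clear -u3 gap h1 t4 e0 P0; [lra | nra].
  have u4 : `|q1 - q0| <= M * beta * e.
    by apply: le_trans s3 _; rewrite -mulrA ler_pM // ltW.
  have e1 : x1 - q1 = (x1 - f) + ((f - q0) - (q1 - q0)) by ring.
  rewrite e1; apply: le_trans (ler_normD _ _) _.
  have := ler_normB (f - q0) (q1 - q0).
  have : 0 <= (A - M) * P ^+ 2 by rewrite mulr_ge0 // AE; lra.
  have : 0 <= (A - (M * bQ + N * beta + M * beta)) * e.
    by rewrite mulr_ge0 ?(ltW e0) // AE; lra.
  clear -u1 u2 u4; lra.
have v1 : (a - a') / a' <= 2 / k by exact: relative_step.
have v2 : K * (a - a') * (G + aQ + (a - a') / a') <= M * (a / k) * (P + aQ + 2 / k).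
  apply: ler_pM.
  - by rewrite mulr_ge0 // ltW.
  - by apply: addr_ge0; [exact: addr_ge0 | apply: divr_ge0 => //; exact: ltW].
  - by rewrite ler_pM // ltW.
  - by rewrite lerD // lerD2r.
have v3 : M * (a / k) * (P + aQ + 2 / k) =
    M * beta * (i / k) * P + M * bQ * (e / k) + 2 * (M * beta) * ((i / k) / k).
  have -> : M * bQ * (e / k) = M * (a * aQ) / k by rewrite aQE; field; rewrite gt_eqF.
  by rewrite aE; field; rewrite gt_eqF.
have v4 : (i / k) / k <= e / k by rewrite ler_pM2r ?invr_gt0.
(* The cross term of drift and residual is split by Young's inequality: half of the descent absorbs
   one part, and the other is at most a multiple of [e / k] because [i / k <= e]. *)
have v5 : M * beta * (i / k) * P <= c1 * (i * P ^+ 2) +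
    M ^+ 2 * beta ^+ 2 / (2 * c1) * ((i / k) / k).
  by rewrite -[M ^+ 2 * _]exprMn; apply: amgm_scaled; rewrite ?(ltW i0) ?gt_eqF.
have v6 := ler_wpM2l t1 v4; have v7 := ler_wpM2l t3 v4.
have v8 : 0 <= ((M + N) * beta + M + B * M ^+ 2) * (e / k).
  apply: mulr_ge0; last by rewrite divr_ge0 // ltW.
  by clear -t3 t4 t5 M0; lra.
rewrite AE; clear -v2 v3 v5 v6 v7 v8 s4 h1 h2; lra.
Qed.

(** With the gradient bounded below, [P ^+ 2] is at least a positive constant, so the bounded value
    [x1] is itself at most a multiple of it; the level 0 then serves. *)
Lemma far_step_estimates {R : realType} (f x0 x1 G P i e k K M B c1 A : R) :
  B * M ^+ 2 <= A -> 0 < i -> 0 < e -> 0 < k -> 0 <= G -> G <= P -> 0 < K -> K <= M ->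
  0 < c1 -> 0 <= B -> 0 <= x1 -> x1 <= B -> x1 <= f ->
  f <= x0 - 2 * c1 * (i * P ^+ 2) -> 1 <= K * G ->
  x1 <= x0 - c1 * (i * P ^+ 2) + A * (e / k) /\ `|x1| <= A * (P ^+ 2 + e).
Proof.
move=> BA i0 e0 k0 G0 GP K0 KM c10 B0 x10 x1B h1 h2 KG.
have M0 : 0 < M by apply: lt_le_trans KM.
have A0 : 0 <= A by apply: le_trans BA; nonneg.
have p0 : 0 <= c1 * (i * P ^+ 2) by nonneg.
have ek : 0 <= e / k by rewrite divr_ge0 // ltW.
have Ae : 0 <= A * (e / k) by exact: mulr_ge0.
split; first by clear -h1 h2 p0 Ae; lra.
have P0 : 0 <= P by apply: le_trans GP.
have MP : 1 <= M * P by apply: le_trans KG _; rewrite ler_pM // ltW.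
have MP2 : 1 <= M ^+ 2 * P ^+ 2 by rewrite -exprMn exprn_ege1.
rewrite ger0_norm //; apply: le_trans x1B _.
have t1 := ler_wpM2l B0 MP2.
have t2 := ler_wpM2r (sqr_ge0 P) BA.
have t3 := mulr_ge0 A0 (ltW e0).
clear -t1 t2 t3; lra.
Qed.

(** * Descent and rate along the proximal iterates *)

Section ProximalIterates.
Local Open Scope classical_set_scope.
Context {R : realType} {m N : nat} (X : 'M[R]_(m, N)) (y : 'rV[R]_N) (tau : R).
Context (g : R -> R) (cp : concave_pieces g) (pe : pred 'I_m) (nn : R).
Context (c beta d rho : R) (w : nat -> 'rV[R]_m).
Hypothesis nn_ge0 : 0 <= nn.
Hypothesis tau01 : 0 < tau < 1.
Hypotheses (c0 : 0 < c) (beta0 : 0 < beta) (d01 : 0 < d < 1).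
Hypothesis g_ge0 : forall t, 0 <= g t.

Notation mu k := (beta * invpow d k).
Notation sigma k := (c / invpow d k).
Notation sep := (separable g pe).
Notation F := (objective X y tau g pe nn).
Notation dG := (loss_gradient X y tau).
Notation step k := (w k - w k.-1).

Hypothesis spectral : forall h, dotv (h *m X) (h *m X) <= 2 * (beta * c) * dotv h h.
Hypothesis rho_ge0 : 0 <= rho.
Hypothesis weakly_convex : convex_fun (fun v => sep v + rho / 2 * dotv v v).
Hypothesis minimal : forall k (u : 'rV[R]_m), (0 < k)%N ->
  dotv (dG (mu k) (w k.-1)) (step k) + nn * sep (w k) + sigma k / 2 * dotv (step k) (step k)
  <= dotv (dG (mu k) (w k.-1)) (u - w k.-1) + nn * sep u
     + sigma k / 2 * dotv (u - w k.-1) (u - w k.-1).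

(** Optimality of the subproblem makes minus the old gradient minus the proximal term a subgradient
    of the weighted penalty; adding the gradient at the new point gives a subgradient of the
    objective for [mu k]. *)
Definition stationarity k : 'rV[R]_m :=
  dG (mu k) (w k) - dG (mu k) (w k.-1) - sigma k *: step k.

Let mu_gt0 k : 0 < mu k. Proof. by rewrite mulr_gt0 ?invpow_gt0. Qed.

(** Comparing with [w k.-1] gains only [sigma k / 2] times the squared step, which the quadratic
    upper bound of the loss may consume entirely. Comparing with the midpoint and using weak
    convexity gains [5/8] instead, once [nn * rho <= sigma k / 2]. *)
Lemma proximal_descent : \forall k \near \oo,
  F (mu k) (w k) <= F (mu k) (w k.-1) - sigma k / 8 * dotv (step k) (step k).
Proof.
near=> k.
have k0 : (0 < k)%N by near: k; exact: nbhs_infty_gt.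
have i0 := invpow_gt0 d k.
have large : nn * rho <= sigma k / 2.
  have q0 : 0 < 2 * (nn * rho + 1) by rewrite mulr_gt0 // ltr_wpDl // mulr_ge0.
  have : invpow d k <= c / (2 * (nn * rho + 1)).
    near: k; apply: invpow_small; first by case/andP: d01.
    by rewrite divr_gt0 // mulr_gt0 // ltr_wpDl // mulr_ge0.
  rewrite ler_pdivlMr // => h.
  rewrite mulrAC ler_pdivlMr //.
  have : nn * rho * invpow d k <= (nn * rho + 1) * invpow d k by rewrite ler_wpM2r ?ltW // ltrDl.
  lra.
set a := w k.-1; set b := w k.
have up := smoothed_loss_upper X y tau a (b - a) (mu_gt0 k); rewrite addrC subrK in up.
have half_in : 0 <= (2^-1 : R) <= 1 by lra.
have conv := weakly_convex a b half_in.
have := minimal (2^-1 *: a + (1 - 2^-1) *: b) k0.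
rewrite -/a -/b.
have -> : 2^-1 *: a + (1 - 2^-1) *: b - a = 2^-1 *: (b - a).
  by apply/rowP => i; rewrite !mxE; lra.
rewrite dotvZr (dotvZr _ (b - a)) (dotvZl _ (b - a)).
have par : dotv (2^-1 *: a + (1 - 2^-1) *: b) (2^-1 *: a + (1 - 2^-1) *: b) =
    dotv a a / 2 + dotv b b / 2 - dotv (b - a) (b - a) / 4.
  rewrite !(dotvDl, dotvDr, dotvZl, dotvZr, dotvNl, dotvNr) (dotvC a b); lra.
rewrite par in conv.
have sp := spectral (b - a).
have e4 : dotv ((b - a) *m X) ((b - a) *m X) / (4 * mu k) <=
    sigma k / 2 * dotv (b - a) (b - a).
  rewrite ler_pdivrMr ?mulr_gt0 //.
  have -> : sigma k / 2 * dotv (b - a) (b - a) * (4 * mu k) =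
    2 * (beta * c) * dotv (b - a) (b - a) by field; rewrite gt_eqF.
  exact: sp.
move: (dotv_ge0 (b - a)) => D0.
have conv' := ler_wpM2l nn_ge0 conv.
have large' := ler_wpM2r D0 large.
rewrite /objective.
move: (dotv (dG (mu k) a) (b - a)) (dotv (b - a) (b - a)) up e4 D0 conv' large' =>
  v D up e4 D0 conv' large' mn.
lra.
Unshelve. all: by end_near. Qed.

(** Both the Lipschitz constant of the gradient, of order [1 / mu k], and [sigma k] grow like [k^d],
    so the residual is at most a multiple of [k^d] times the step. *)
Lemma stationarity_le : exists2 K : R, 0 < K & forall k,
  invpow d k * `|stationarity k| ^+ 2 <= K * (sigma k / 8 * dotv (step k) (step k)).
Proof.
have [C C0 HC] := loss_gradient_lipschitz X y tau.
pose C1 := C / beta + c.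
have C10 : 0 < C1 by rewrite ltr_wpDl // divr_ge0 // ltW.
exists (8 * C1 ^+ 2 / c) => [|k]; first by rewrite divr_gt0 // mulr_gt0 // exprn_gt0.
have i0 := invpow_gt0 d k.
have st : `|stationarity k| <= C1 / invpow d k * `|step k|.
  apply: le_trans (ler_normB _ _) _.
  rewrite mx_normZ gtr0_norm ?divr_gt0 //.
  have -> : C1 / invpow d k * `|step k| = C / (beta * invpow d k) * `|step k|
      + c / invpow d k * `|step k| by rewrite /C1; field; rewrite !gt_eqF.
  by rewrite lerD2r HC.
have sq : `|stationarity k| ^+ 2 <= (C1 / invpow d k * `|step k|) ^+ 2.
  by rewrite lerXn2r // nnegrE // mulr_ge0 // divr_ge0 // ltW.
have dot := sqr_norm_le_dotv (step k).
apply: le_trans (ler_wpM2l (ltW i0) sq) _.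
have -> : 8 * C1 ^+ 2 / c * (sigma k / 8 * dotv (step k) (step k)) =
    C1 ^+ 2 / invpow d k * dotv (step k) (step k) by field; rewrite !gt_eqF.
have -> : invpow d k * (C1 / invpow d k * `|step k|) ^+ 2 =
    C1 ^+ 2 / invpow d k * `|step k| ^+ 2 by field; rewrite !gt_eqF.
by rewrite ler_wpM2l // divr_ge0 ?sqr_ge0 // ltW.
Qed.

Lemma linear_coef_eq0 (a b delta : R) : 0 < delta ->
  (forall s, `|s| < delta -> 0 <= s * a + b * s ^+ 2) -> a = 0.
Proof.
move=> delta0 H; apply/eqP/negPn/negP => a0.
have a0' : 0 < `|a| by rewrite normr_gt0.
pose M := Num.max (`|a| * 2 / delta) (`|b| + 1).
have M0 : 0 < M by rewrite lt_max; apply/orP; right; rewrite ltr_wpDl.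
have Mb : b < M.
  by rewrite lt_max; apply/orP; right; rewrite (le_lt_trans (ler_norm b)) // ltrDl.
have Md : `|a| / M < delta.
  rewrite ltr_pdivrMr // mulrC -ltr_pdivrMr //.
  have : `|a| * 2 / delta <= M by rewrite le_max lexx.
  by apply: lt_le_trans; rewrite ltr_pM2r ?invr_gt0 //; lra.
have := H (- (a / M)).
rewrite normrN normrM normfV (gtr0_norm M0) => /(_ Md).
have -> : - (a / M) * a + b * (- (a / M)) ^+ 2 = (a / M) ^+ 2 * (b - M).
  by field; rewrite gt_eqF.
rewrite pmulr_rge0; first by lra.
by rewrite exprn_even_gt0 //= mulf_neq0 // invr_neq0 // gt_eqF.
Qed.

(** Moving a single free coordinate, the penalty lies locally below its tangent, so minimality
    forces the linear coefficient of the subproblem to vanish. There the cell gradient equals the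
    residual, and on frozen coordinates it is 0. *)
Lemma cell_g_le k : (0 < k)%N ->
  `|cell_g X y tau pe nn (cell_of X y cp (mu k) (w k)) (mu k) (w k)| <= `|stationarity k|.
Proof.
move=> k0; apply: mx_norm_le => // i j; rewrite ord1 {i}.
set C := cell_of _ _ _ _ _; rewrite cell_gE //; case: (boolP (free pe C j)) => fj; last first.
  by rewrite mul0r normr0.
rewrite mul1r; set e := _ + _.
suff -> : e = stationarity k 0 j by exact: coord_le_norm.
have subE (u v : 'rV[R]_m) : (u - v) 0 j = u 0 j - v 0 j by rewrite !mxE.
have scaleE a (u : 'rV[R]_m) : (a *: u) 0 j = a * u 0 j by rewrite mxE.
rewrite /stationarity !subE scaleE.
pose l := coef1 (C.2 j) - coef2 (C.2 j) * w k 0 j.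
suff E0 : dG (mu k) (w k.-1) 0 j + sigma k * (step k) 0 j + nn * ((pe j)%:R * l) = 0.
  by rewrite /e -/l; lra.
have [delta delta0 Hd] : exists2 delta : R, 0 < delta & forall s, `|s| < delta ->
    (pe j)%:R * (g (w k 0 j + s) - g (w k 0 j)) <= (pe j)%:R * l * s.
  move: fj; rewrite /free; case: (pe j) => /= fj; last first.
    by exists 1 => // s _; rewrite !mul0r.
  move: fj; rewrite /l ffunE => /piece_tangent[delta delta0 H]; exists delta => // s sd.
  have := H (w k 0 j + s); rewrite [w k 0 j + s]addrC addrK => /(_ sd); lra.
apply: (linear_coef_eq0 (b := sigma k / 2) delta0) => s sd.
pose ej : 'rV[R]_m := delta_mx 0 j.
have := minimal (w k + s *: ej) k0.
have -> : w k + s *: ej - w k.-1 = step k + s *: ej by rewrite addrAC.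
have dote (u : 'rV[R]_m) : dotv u ej = u 0 j.
  rewrite /dotv (bigD1 j) //= mxE !eqxx mulr1 big1 ?addr0 // => i ij.
  by rewrite mxE eqxx /= (negbTE ij) mulr0.
have sepE : sep (w k + s *: ej) = sep (w k) + (pe j)%:R * (g (w k 0 j + s) - g (w k 0 j)).
  rewrite /separable !(sum_pe pe) [LHS](bigD1 j) //= [in RHS](bigD1 j) //=.
  have -> : (w k + s *: ej) 0 j = w k 0 j + s by rewrite !mxE !eqxx mulr1.
  have -> : \sum_(i | i != j) (pe i)%:R * g ((w k + s *: ej) 0 i) =
      \sum_(i | i != j) (pe i)%:R * g (w k 0 i).
    by apply: eq_bigr => i ij; rewrite !mxE eqxx /= (negbTE ij) mulr0 addr0.
  ring.
have [D DE] : exists D, D = step k by eexists.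
rewrite sepE -!DE !(dotvDl, dotvDr, dotvZl, dotvZr) (dotvC ej) !dote.
have -> : ej 0 j = 1 by rewrite mxE !eqxx.
have := ler_wpM2l nn_ge0 (Hd s sd); lra.
Qed.

Lemma stationarity_rate (eps : R) : 0 < eps ->
  \forall k \near \oo, `|stationarity k| <= eps * invpow ((1 - d) / 2) k.
Proof.
move=> eps0; have [Q [Sh hQ /(_ _ beta0) Smu]] := power_scales d01.
pose E k := invpow d k ^+ Q.+1.
have E_gt0 k : 0 < E k by rewrite exprn_gt0 ?invpow_gt0.
(* The value just after [mu] has been lowered: one step of [x] is a proximal step at fixed [mu k]
   followed by a change of [mu] at fixed [w k]. *)
pose x k := F (mu k) (w k.-1).
pose p k := `|stationarity k| ^+ 2.
have p0 k : 0 <= p k by exact: sqr_ge0.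
have x0 k : 0 <= x k.
  rewrite addr_ge0 // ?smoothed_loss_ge0 //.
  by rewrite mulr_ge0 //; apply: sumr_ge0 => i _.
have [K1 K10 HK1] := stationarity_le.
have drop0 : \forall k \near \oo, F (mu k) (w k) <= x k - K1^-1 * (invpow d k * p k).
  near=> k; have : F (mu k) (w k) <= x k - sigma k / 8 * dotv (step k) (step k).
    by near: k; exact: proximal_descent.
  move=> /le_trans; apply; rewrite lerD2l lerN2 ler_pdivrMl //; exact: HK1.
have mono : \forall k \near \oo, x k.+1 <= F (mu k) (w k).
  near=> k; rewrite /x /= /objective lerD2r; apply: smoothed_loss_mono => //.
  by near: k; exact: (smoothing_decr Smu).
have [B B0 xB] : exists2 B : R, 0 <= B & \forall k \near \oo, x k <= B.
  have [M _ HM] : \forall k \near \oo, x k.+1 <= x k.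
    near=> k; have h1 : x k.+1 <= F (mu k) (w k) by near: k.
    have h2 : F (mu k) (w k) <= x k - K1^-1 * (invpow d k * p k) by near: k.
    apply: le_trans h1 (le_trans h2 _); rewrite gerBl; apply: mulr_ge0; first by rewrite invr_ge0 ltW.
    by rewrite mulr_ge0 // ltW // invpow_gt0.
  exists (x M) => //; exists M => // k /=; elim: k => [|k IH].
    by rewrite leqn0 => /eqP <-.
  rewrite leq_eqVlt => /predU1P[<- //|]; rewrite ltnS => Mk.
  exact: le_trans (HM k Mk) (IH Mk).
have [z Hz] : {z : @cell R m N g cp -> {poly R} * R * R & forall C,
    is_level X y tau pe nn Q C (z C).1.1 (z C).1.2 (z C).2}.
  apply: (choice (P := fun C z => is_level X y tau pe nn Q C z.1.1 z.1.2 z.2)) => C.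
  exact: cell_truncation.
pose q C := (z C).1.1; pose K C := (z C).1.2; pose r C := (z C).2.
have {}Hz C : is_level X y tau pe nn Q C (q C) (K C) (r C) by exact: Hz.
pose i k := cell_of X y cp (mu k) (w k).
have [M [M0 KM]] : exists M : R, 0 < M /\ forall C, K C <= M.
  exists (1 + \sum_C K C); split.
    by rewrite ltr_wpDr // sumr_ge0 // => C _; have [_ /ltW] := Hz C.
  move=> C; rewrite (bigD1 C) //= addrCA lerDl addr_ge0 // sumr_ge0 // => C' _.
  by have [_ /ltW] := Hz C'.
(* Half of the descent constant; the other half pays for the cross term of drift and residual. *)
pose c1 := K1^-1 / 2; have c10 : 0 < c1 by rewrite divr_gt0 // invr_gt0.
pose A := M ^+ 2 * beta ^+ 2 / (2 * c1) + M * beta ^+ Q.+1 + 2 * (M * beta)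
  + (M + N%:R) * beta + M + B * M ^+ 2.
have t1 : 0 <= M ^+ 2 * beta ^+ 2 / (2 * c1).
  by apply: divr_ge0; nonneg.
have t2 : 0 <= M * beta ^+ Q.+1 by rewrite mulr_ge0 ?exprn_ge0 // ltW.
have t3 : 0 <= M * beta by rewrite mulr_ge0 // ltW.
have t4 : 0 <= N%:R * beta by rewrite mulr_ge0 // ltW.
have t5 : 0 <= B * M ^+ 2 by rewrite mulr_ge0 ?sqr_ge0.
have A0 : 0 < A by rewrite /A; lra.
have BA : B * M ^+ 2 <= A by rewrite /A; lra.
have [AE c1E] : A = M ^+ 2 * beta ^+ 2 / (2 * c1) + M * beta ^+ Q.+1 + 2 * (M * beta)
    + (M + N%:R) * beta + M + B * M ^+ 2 /\ K1^-1 = 2 * c1.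
  by split=> //; rewrite /c1; field; rewrite gt_eqF.
clearbody A c1.
have local : \forall k \near \oo,
    x k.+1 <= x k - c1 * (invpow d k * p k) +
      ((q (i k)).[mu k.+1] - (q (i k)).[mu k]) + A * (E k / k%:R) /\
    `|x k.+1 - (q (i k)).[mu k.+1]| <= A * (p k + E k).
  near=> k.
  have k0 : (0 < k)%N by near: k; exact: nbhs_infty_gt.
  have kR : 0 < k%:R :> R by rewrite ltr0n.
  have k2 : 2 <= k%:R :> R by near: k; exact: nbhs_infty_ger.
  have ki0 := invpow_gt0 d k; have Ek := E_gt0 k; have pk := p0 k.
  have mu1 : mu k <= 1 by near: k; exact: (smoothing_small Smu).
  have mur C : mu k <= r C.
    move: C; near: k; apply: filter_forall => C; apply: (smoothing_small Smu).
    by have [] := Hz C.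
  have mm : mu k.+1 <= mu k by near: k; exact: (smoothing_decr Smu).
  have ms : mu k - mu k.+1 <= mu k / k%:R by near: k; exact: (smoothing_step Smu).
  have h1 : x k.+1 <= F (mu k) (w k) by near: k.
  have h2 : F (mu k) (w k) <= x k - K1^-1 * (invpow d k * p k) by near: k.
  have h3 : x k.+1 <= B by near: k; exact: (eventually_natS xB).
  have gap : F (mu k) (w k) <= x k.+1 + N%:R * (mu k - mu k.+1).
    by have := smoothed_loss_gap X y tau (w k) (mu_gt0 k.+1) mm; rewrite /x /= /objective; lra.
  have Gle := cell_g_le k0; rewrite -/(i k) in Gle.
  have [_ K0 r0 HC] := Hz (i k).
  have mur' : 0 < mu k <= r (i k) by rewrite mu_gt0 mur.
  have := HC (mu k) (w k) mur' erefl.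
  set G := `|cell_g _ _ _ _ _ _ _ _| in Gle *.
  set P := `|stationarity k| in Gle; have P0 : 0 <= P by exact: normr_ge0.
  have G0 : 0 <= G by exact: normr_ge0.
  have pE : p k = P ^+ 2 by [].
  have ikE : invpow d k / k%:R <= E k.
    by rewrite /E exprS ler_pM2l // hQ.
  have Ek0 : 0 <= E k / k%:R by rewrite divr_ge0 // ltW.
  have ip0 : 0 <= invpow d k * p k by rewrite mulr_ge0 // ltW.
  have c1ip : 0 <= c1 * (invpow d k * p k) by rewrite mulr_ge0 // ltW.
  rewrite c1E in h2.
  have KMi := KM (i k).
  case=> [[-> KG]|[s1 s2]].
    rewrite !horner0 !subr0 addr0.
    exact: (far_step_estimates BA ki0 Ek kR G0 Gle K0 KMi c10 B0 (x0 _) h3 h1 h2 KG).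
  have mm' : 0 < mu k.+1 <= mu k by rewrite mu_gt0.
  have [s3 s4] := s2 (mu k.+1) mm'.
  apply: (cell_step_estimates (aQ := mu k ^+ Q) AE ki0 Ek k2 (mu_gt0 _) mm ms erefl _ _
    ikE G0 Gle K0 KMi (ler0n R N) beta0 _ c10 B0 h1 h2 gap _ s3 s4).
  - by rewrite exprn_ge0 // ltW.
  - by rewrite -exprS exprMn.
  - by rewrite exprn_ge0 // ltW.
  - by rewrite -exprS.
have [C' HC'] : exists C' : R, \forall k \near \oo, invpow d k * p k <= C' * E k.
  apply: (@level_dissipation R (invpow d) E _ Q _ q i x p c1 A 0 Sh Smu c10 A0 _ x0 p0).
  - by move=> C; have [] := Hz C.
  - by apply: filterS local => k [].
  - by apply: filterS local => k [].
near=> k.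
have k0 : (0 < k)%N by near: k; exact: nbhs_infty_gt.
have kR : 0 < k%:R :> R by rewrite ltr0n.
have h1 : invpow d k * p k <= C' * E k by near: k.
have h2 : k%:R * E k <= eps ^+ 2 / (`|C'| + 1).
  near: k; apply: (scale_small Sh).
  by rewrite divr_gt0 ?exprn_gt0 // ltr_wpDl.
rewrite -(@ler_pXn2r _ 2%N) ?nnegrE //; last first.
  by rewrite mulr_ge0 // ltW // invpow_gt0.
rewrite exprMn invpowX.
have -> : 2%:R * ((1 - d) / 2) = 1 - d by field.
(* Multiplying the bound on [k^-d * p k] by [k] gives [k^(1-d) * p k <= C' * (k * E k)], whose
   right-hand side tends to 0. *)
have e1 : invpow (1 - d) k * (k%:R * invpow d k) = 1.
  by rewrite natr_invpow // /invpow -expRD -mulrDl (_ : _ + _ = 0) ?mul0r ?expR0 //; ring.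
have q0 : 0 < k%:R * invpow d k by rewrite mulr_gt0 // invpow_gt0.
rewrite -(ler_pM2r q0) -[leRHS]mulrA e1 mulr1.
apply: (@le_trans _ _ (C' * (k%:R * E k))).
  have -> : `|stationarity k| ^+ 2 * (k%:R * invpow d k) = k%:R * (invpow d k * p k).
    by rewrite /p; ring.
  by rewrite [leRHS]mulrCA ler_pM2l.
have kE0 : 0 <= k%:R * E k by rewrite mulr_ge0 // ltW.
have C1 : 0 < `|C'| + 1 by rewrite ltr_wpDl.
apply: (@le_trans _ _ ((`|C'| + 1) * (k%:R * E k))).
  by rewrite ler_wpM2r // (le_trans (ler_norm _)) // lerDl.
by rewrite mulrC -ler_pdivlMr.
Unshelve. all: by end_near. Qed.

End ProximalIterates.

(** * MCP and SCAD as concave parabolic pieces *)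

Section Penalties.
Context {R : realType}.

(* The penalty [gpen] as a function of [|t|], on each of its (at most) three pieces
   a parabola [a0 + a1 x - a2 x^2 / 2]. *)
Definition profile_piece (k : penalty_kind) (lam gam x : R) : 'I_3 :=
  match k with
  | MCP => if x <= gam * lam then @Ordinal 3 0 isT else @Ordinal 3 2 isT
  | SCAD => if x <= lam then @Ordinal 3 0 isT
            else if x <= gam * lam then @Ordinal 3 1 isT else @Ordinal 3 2 isT
  end.

Definition profile_coef (k : penalty_kind) (lam gam : R) (i : 'I_3) : R * R * R :=
  match k, val i with
  | MCP, 0%N => (0, lam, gam^-1)
  | MCP, _ => (gam * lam ^+ 2 / 2, 0, 0)
  | SCAD, 0%N => (0, lam, 0)
  | SCAD, 1%N => (- lam ^+ 2 / (2 * (gam - 1)), gam * lam / (gam - 1), (gam - 1)^-1)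
  | SCAD, _ => ((gam + 1) * lam ^+ 2 / 2, 0, 0)
  end.

(** Half of the largest second-order coefficient among the pieces, that is, the coefficient of the
    quadratic correction in the lower tangent bound. *)
Definition curvature (k : penalty_kind) (gam : R) : R :=
  match k with MCP => (2 * gam)^-1 | SCAD => (2 * (gam - 1))^-1 end.

Section OnePenalty.
Variables (k : penalty_kind) (lam gam : R).
Hypotheses (lam_gt0 : 0 < lam) (mcp : k = MCP -> 1 <= gam) (scad : k = SCAD -> 2 <= gam).

Notation g := (gpen k lam gam).
Notation coef x := (profile_coef k lam gam (profile_piece k lam gam x)).

Lemma curvature_ge0 : 0 <= curvature k gam.
Proof.
by rewrite /curvature; case: k mcp scad => [/(_ erefl) h _|_ /(_ erefl) h];
  rewrite invr_ge0; lra.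
Qed.

Lemma gpen_norm t : g `|t| = g t.
Proof. by rewrite /gpen normr_id real_normK ?num_real. Qed.

Lemma gpen_ge0 t : 0 <= g t.
Proof.
rewrite -gpen_norm; have := normr_ge0 t; move: `|t| => x x0.
rewrite /gpen ger0_norm //; case: k mcp scad => [/(_ erefl) h _|_ /(_ erefl) h].
  have gam0 : 0 < gam by lra.
  case: (leP x (gam * lam)) => [xg|_].
    have -> : lam * x - x ^+ 2 / (2 * gam) = x * (2 * (gam * lam) - x) / (2 * gam).
      by field; rewrite gt_eqF.
    by rewrite divr_ge0 ?mulr_ge0 //; lra.
  by apply: divr_ge0 => //; apply: mulr_ge0; [exact: ltW | exact: sqr_ge0].
have e0 : 0 < gam - 1 by lra.
case: (leP x lam) => [_|xl]; first by rewrite mulr_ge0 // ltW.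
case: (leP x (gam * lam)) => [xg|_]; last first.
  by apply: divr_ge0 => //; apply: mulr_ge0; [lra | exact: sqr_ge0].
have -> : - (x ^+ 2 - 2 * gam * lam * x + lam ^+ 2) / (2 * (gam - 1)) =
    (2 * (gam - 1) * lam ^+ 2 + (x - lam) * (2 * (gam * lam) - lam - x)) / (2 * (gam - 1)).
  by field; rewrite gt_eqF.
have lg : lam <= gam * lam by rewrite ler_peMl ?(ltW lam_gt0) //; lra.
apply: divr_ge0; last lra.
by apply: addr_ge0; apply: mulr_ge0; rewrite ?sqr_ge0 //; lra.
Qed.

Lemma profile_coefE t : g t = let: (a0, a1, a2) := coef `|t| in
  a0 + a1 * `|t| - a2 / 2 * t ^+ 2.
Proof.
rewrite /gpen /profile_coef /profile_piece.
case: k mcp scad => [/(_ erefl) h _|_ /(_ erefl) h].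
  case: leP => _ /=; last by ring.
  by field; rewrite gt_eqF //; lra.
case: leP => _ /=; first by ring.
case: leP => _ /=; last by ring.
by field; rewrite gt_eqF //; lra.
Qed.

Lemma profile_coef2_ge0 i : 0 <= (profile_coef k lam gam i).2.
Proof.
rewrite /profile_coef; case: k mcp scad => [/(_ erefl) h _|_ /(_ erefl) h].
  by case: (val i) => [|?] //=; rewrite invr_ge0; lra.
by case: (val i) => [|[|?]] //=; rewrite invr_ge0; lra.
Qed.

(** Completing the square at the junction [lam], and in the next lemma at [gam * lam], shows how the
    middle SCAD piece departs from each neighbour. *)
Lemma mid_piece_lam x : 1 < gam ->
  - (x ^+ 2 - 2 * gam * lam * x + lam ^+ 2) / (2 * (gam - 1)) =
  lam * x - (2 * (gam - 1))^-1 * (x - lam) ^+ 2.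
Proof. by move=> g1; field; rewrite gt_eqF //; lra. Qed.

Lemma mid_piece_top x : 1 < gam ->
  - (x ^+ 2 - 2 * gam * lam * x + lam ^+ 2) / (2 * (gam - 1)) =
  (gam + 1) * lam ^+ 2 / 2 - (2 * (gam - 1))^-1 * (x - gam * lam) ^+ 2.
Proof. by move=> g1; field; rewrite gt_eqF //; lra. Qed.

Lemma sqr_le_same (q a b : R) : 0 <= q -> 0 <= a <= b -> q * a ^+ 2 <= q * b ^+ 2.
Proof.
by move=> q0 /andP[a0 ab]; rewrite ler_wpM2l // lerXn2r // nnegrE // (le_trans a0).
Qed.

(** The upper bound expresses concavity on the half-line, the lower one weak convexity. With every
    piece written through squares centred at the junctions, each pair of positions reduces to
    comparing squares of ordered distances. *)
Lemma profile_tangent x u : 0 <= x -> 0 <= u ->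
  let: (_, a1, a2) := coef x in
  - curvature k gam * (u - x) ^+ 2 <= g u - g x - (a1 - a2 * x) * (u - x) <= 0.
Proof.
move=> x0 u0; rewrite /gpen !ger0_norm //; have := curvature_ge0.
rewrite /profile_coef /profile_piece /curvature.
case: k mcp scad => [/(_ erefl) h _|_ /(_ erefl) h] q0.
  have gam0 : gam != 0 by rewrite gt_eqF //; lra.
  have qE : gam^-1 = 2 * (2 * gam)^-1 by field.
  have topE v : lam * v - v ^+ 2 / (2 * gam) =
      gam * lam ^+ 2 / 2 - (2 * gam)^-1 * (v - gam * lam) ^+ 2 by field.
  set q := (2 * gam)^-1 in q0 qE topE *; rewrite !topE.
  have sqx := mulr_ge0 q0 (sqr_ge0 (u - x)).
  case: (leP x (gam * lam)) => xg /=; case: (leP u (gam * lam)) => ug /=.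
  - have : lam - gam^-1 * x = 2 * q * (gam * lam - x) by rewrite -qE; field.
    by move=> ->; lra.
  - have : lam - gam^-1 * x = 2 * q * (gam * lam - x) by rewrite -qE; field.
    move=> ->; have := sqr_le_same q0 (a := u - gam * lam) (b := u - x).
    have := mulr_ge0 q0 (sqr_ge0 (u - gam * lam)).
    have -> : 0 <= u - gam * lam <= u - x by lra.
    by move=> h1 /(_ isT) h2; lra.
  - have := sqr_le_same q0 (a := gam * lam - u) (b := x - u).
    have := mulr_ge0 q0 (sqr_ge0 (u - gam * lam)).
    have -> : 0 <= gam * lam - u <= x - u by lra.
    by move=> h1 /(_ isT) h2; lra.
  - by have := mulr_ge0 q0 (sqr_ge0 (u - x)); lra.
have g1 : 1 < gam by lra.
have e0 : gam - 1 != 0 by rewrite gt_eqF //; lra.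
have qE : (gam - 1)^-1 = 2 * (2 * (gam - 1))^-1 by field.
have lE v := mid_piece_lam v g1; have tE v := mid_piece_top v g1.
have slopeE v : gam * lam / (gam - 1) - (gam - 1)^-1 * v =
    2 * (2 * (gam - 1))^-1 * (gam * lam - v) by field.
have slopeE' v : gam * lam / (gam - 1) - (gam - 1)^-1 * v =
    lam - 2 * (2 * (gam - 1))^-1 * (v - lam) by field.
set q := (2 * (gam - 1))^-1 in q0 qE lE tE slopeE slopeE' *.
have lg : lam <= gam * lam by rewrite ler_peMl ?(ltW lam_gt0) //; lra.
have sqx := mulr_ge0 q0 (sqr_ge0 (u - x)).
have sl := mulr_ge0 q0 (sqr_ge0 (u - lam)).
have st := mulr_ge0 q0 (sqr_ge0 (u - gam * lam)).
have same a b : 0 <= a <= b -> q * a ^+ 2 <= q * b ^+ 2 by exact: sqr_le_same.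
have lt := etrans (esym (lE u)) (tE u).
case: (leP x lam) => xl /=; last case: (leP x (gam * lam)) => xg /=.
- case: (leP u lam) => ul /=; last case: (leP u (gam * lam)) => ug /=.
  + by rewrite mul0r subr0; lra.
  + rewrite lE mul0r subr0; have := same (u - lam) (u - x).
    have -> : 0 <= u - lam <= u - x by lra.
    by move=> /(_ isT); lra.
  + rewrite mul0r subr0; have := same (u - lam) (u - x).
    have -> : 0 <= u - lam <= u - x by lra.
    move=> /(_ isT) h1; have := same (u - gam * lam) (u - lam).
    have -> : 0 <= u - gam * lam <= u - lam by lra.
    by move=> /(_ isT); lra.
- case: (leP u lam) => ul /=; last case: (leP u (gam * lam)) => ug /=.
  + rewrite lE slopeE'; have := same (lam - u) (x - u).
    have -> : 0 <= lam - u <= x - u by lra.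
    by move=> /(_ isT); lra.
  + by rewrite !tE slopeE; lra.
  + rewrite tE slopeE; have := same (u - gam * lam) (u - x).
    have -> : 0 <= u - gam * lam <= u - x by lra.
    by move=> /(_ isT); lra.
case: (leP u lam) => ul /=; last case: (leP u (gam * lam)) => ug /=.
- rewrite mul0r subr0; have := same (gam * lam - u) (x - u).
  have -> : 0 <= gam * lam - u <= x - u by lra.
  move=> /(_ isT) h1; have := same (lam - u) (gam * lam - u).
  have -> : 0 <= lam - u <= gam * lam - u by lra.
  by move=> /(_ isT); lra.
- rewrite tE mul0r subr0; have := same (gam * lam - u) (x - u).
  have -> : 0 <= gam * lam - u <= x - u by lra.
  by move=> /(_ isT); lra.
by rewrite mul0r subr0; lra.
Qed.

Lemma gpen0 : g 0 = 0.
Proof.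
have := profile_coefE 0; rewrite normr0 /profile_coef /profile_piece.
case: k mcp scad => [/(_ erefl) h _|_ /(_ erefl) h].
  by rewrite ifT ?mulr_ge0 ?(ltW lam_gt0) //=; [move=> ->; ring | lra].
by rewrite ifT ?(ltW lam_gt0) //= => ->; ring.
Qed.

Definition gpen_piece_of t : option (bool * 'I_3) :=
  if t == 0 then None else Some (0 < t, profile_piece k lam gam `|t|).

Definition gpen_coef (j : option (bool * 'I_3)) : R * R * R :=
  if j is Some (b, i) then
    let: (a0, a1, a2) := profile_coef k lam gam i in (a0, (if b then a1 else - a1), a2)
  else 0.

Lemma gpen_coef2_ge0 j : 0 <= (gpen_coef j).2.
Proof.
case: j => [[b i]|] //=; have := profile_coef2_ge0 i.
by case: profile_coef => [[? ?] ?].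
Qed.

Lemma gpen_coefE t : let c := gpen_coef (gpen_piece_of t) in
  g t = c.1.1 + c.1.2 * t - c.2 / 2 * t ^+ 2.
Proof.
rewrite /gpen_piece_of; case: eqVneq => [->|t0] /=; first by rewrite gpen0 /=; ring.
have := profile_coefE t; case: profile_coef => [[a0 a1] a2] /= ->.
have [t1|t1] := ltP 0 t; first by rewrite gtr0_norm.
by rewrite ler0_norm //; ring.
Qed.

Lemma gpen_tangent t u : t != 0 -> `|u - t| < `|t| ->
  let c := gpen_coef (gpen_piece_of t) in
  - curvature k gam * (u - t) ^+ 2 <= g u - g t - (c.1.2 - c.2 * t) * (u - t) <= 0.
Proof.
move=> t0; rewrite /gpen_piece_of (negbTE t0) /=.
have := profile_tangent (normr_ge0 t) (normr_ge0 u); rewrite !gpen_norm.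
case: profile_coef => [[a0 a1] a2] /=.
have [t1|t1] := ltP 0 t.
  rewrite (gtr0_norm t1) ltr_norml => + /andP[ut _].
  by rewrite gtr0_norm //; lra.
rewrite (ler0_norm t1) ltr_norml => + /andP[_ ut].
rewrite ler0_norm; last lra.
have -> : (- u - - t) ^+ 2 = (u - t) ^+ 2 by ring.
by have -> : (a1 - a2 * - t) * (- u - - t) = (- a1 - a2 * t) * (u - t) by ring.
Qed.

Lemma gpen_frozen0 t : gpen_piece_of t == None -> t = 0.
Proof. by rewrite /gpen_piece_of; have [|] := eqVneq t 0. Qed.

Lemma gpen_piece_tangent t : ~~ (gpen_piece_of t == None) ->
  let c := gpen_coef (gpen_piece_of t) in
  exists2 delta : R, 0 < delta & forall u, `|u - t| < delta ->
    g u <= g t + (c.1.2 - c.2 * t) * (u - t).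
Proof.
have [->|t0 _] := eqVneq t 0; first by rewrite /gpen_piece_of eqxx.
move=> c; exists `|t|; first by rewrite normr_gt0.
by move=> u /(gpen_tangent t0)/andP[_]; rewrite -/c; lra.
Qed.

Definition gpen_pieces : concave_pieces g := @ConcavePieces R g
  (option (bool * 'I_3)) gpen_piece_of (fun j => j == None)
  (fun j => (gpen_coef j).1.1) (fun j => (gpen_coef j).1.2) (fun j => (gpen_coef j).2)
  gpen_coef2_ge0 gpen_coefE gpen_frozen0 gpen_piece_tangent.

(** At 0 the slope 0 works because the penalty is nonnegative and vanishes there; elsewhere the
    tangent works as long as the sign does not change. *)
Lemma gpen_subgradient t : exists (a : R) (delta : R), 0 < delta /\
  forall h, `|h| < delta -> g t + a * h - curvature k gam * h ^+ 2 <= g (t + h).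
Proof.
have [->|t0] := eqVneq t 0.
  exists 0, 1; split=> // h _; rewrite gpen0 add0r mul0r !add0r.
  apply: le_trans (gpen_ge0 h); rewrite oppr_le0.
  by apply: mulr_ge0; [exact: curvature_ge0 | exact: sqr_ge0].
have := gpen_tangent t0; set c := gpen_coef _ => H.
exists (c.1.2 - c.2 * t), `|t|; split=> [|h ht]; first by rewrite normr_gt0.
have := H (t + h); rewrite [t + h - t]addrAC subrr add0r => /(_ ht)/andP[+ _]; lra.
Qed.

End OnePenalty.
End Penalties.

(** * The Euclidean norm and the regular subdifferential *)

Section Norm2.
Context {R : realType}.

Lemma norm2_sqr n (u : 'rV[R]_n) : norm2 u ^+ 2 = dotv u u.
Proof.
rewrite /norm2 sqr_sqrtr; first by apply: eq_bigr => i _; rewrite expr2.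
by apply: sumr_ge0 => i _; exact: sqr_ge0.
Qed.

Lemma norm2_ge0 n (u : 'rV[R]_n) : 0 <= norm2 u.
Proof. exact: sqrtr_ge0. Qed.

Lemma coord_le_norm2 n (u : 'rV[R]_n) i : `|u 0 i| <= norm2 u.
Proof.
apply: le_trans (coord_le_norm u 0 i) _.
by rewrite -(@ler_pXn2r _ 2%N) ?nnegrE ?norm2_ge0 // norm2_sqr sqr_norm_le_dotv.
Qed.

Lemma norm2_le n (u : 'rV[R]_n) : norm2 u <= n%:R * `|u|.
Proof.
rewrite -(@ler_pXn2r _ 2%N) ?nnegrE ?norm2_ge0 ?mulr_ge0 // norm2_sqr.
apply: le_trans (ler_norm _) _; apply: le_trans (norm_dotv_le u u) _.
rewrite exprMn -mulrA -expr2 ler_wpM2r ?sqr_ge0 // -natrX ler_nat.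
by case: n u => [|n] _ //; rewrite expnS expn1 leq_pmulr.
Qed.

Lemma frechet_subdiff_quadratic n (f : 'rV[R]_n -> R) (v s : 'rV[R]_n) (K delta : R) :
  0 <= K -> 0 < delta ->
  (forall h, norm2 h < delta -> f v + dotv s h - K * dotv h h <= f (v + h)) ->
  frechet_subdiff f v s.
Proof.
move=> K0 delta0 H eps eps0; exists (Num.min delta (eps / (K + 1))).
  by rewrite lt_min delta0 divr_gt0 // ltr_wpDl.
move=> u; rewrite lt_min => /andP[ud ue].
have := H (u - v) ud; rewrite [v + _]addrC subrK; apply: le_trans; rewrite lerD2l lerN2.
rewrite -norm2_sqr expr2 mulrA ler_wpM2r ?norm2_ge0 //.
move: ue; rewrite ltr_pdivlMr ?ltr_wpDl // => /ltW; apply: le_trans.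
by rewrite mulrC ler_wpM2l ?norm2_ge0 // lerDl.
Qed.

Lemma uniform_delta (I : finType) (D : I -> R) : (forall i, 0 < D i) ->
  exists2 delta : R, 0 < delta & forall i, delta <= D i.
Proof.
move=> D0; have S0 i : 0 <= (D i)^-1 by rewrite invr_ge0 ltW.
have T0 : 0 < 1 + \sum_i (D i)^-1 by rewrite ltr_wpDr // sumr_ge0.
exists (1 + \sum_i (D i)^-1)^-1 => [|i]; first by rewrite invr_gt0.
rewrite -[leRHS]invrK lef_pV2 ?posrE ?invr_gt0 // (bigD1 i) //= addrCA lerDl.
by rewrite addr_ge0 // sumr_ge0.
Qed.

End Norm2.

(** * Pooling the data of the clients *)

Section Data.
Context {R : realType} (P L : nat) (M : 'I_L -> nat)
  (y : forall l : 'I_L, 'I_(M l) -> R) (x : forall l : 'I_L, 'I_(M l) -> 'rV[R]_P).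

Arguments y : clear implicits.
Arguments x : clear implicits.

Notation T := {l : 'I_L & 'I_(M l)}.

Definition client_X l : 'M[R]_(P + 1, M l) := \matrix_(p, i) xbar (x l i) 0 p.
Definition client_y l : 'rV[R]_(M l) := \row_i y l i.
Definition pooled_y : 'rV[R]_#|{: T}| :=
  \row_j y (tag (enum_val (A := {: T}) j)) (tagged (enum_val (A := {: T}) j)).

Lemma sum_pooled (f : forall l, 'I_(M l) -> R) :
  \sum_(j < #|{: T}|) f (tag (enum_val (A := {: T}) j)) (tagged (enum_val (A := {: T}) j)) =
  \sum_l \sum_i f l i.
Proof.
rewrite sig_big_dep /=.
by rewrite -(big_enum_val (fun s : T => f (tag s) (tagged s))) /=; apply: eq_bigl => s.
Qed.

Lemma client_residual l w i :
  (client_y l - w *m client_X l) 0 i = y l i - dotv (xbar (x l i)) w.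
Proof.
rewrite !mxE; congr (_ - _); apply: eq_bigr => p _.
by rewrite mxE mulrC.
Qed.

Lemma pooled_residual w j (s := enum_val (A := {: T}) j) :
  (pooled_y - w *m Xbar x) 0 j = y (tag s) (tagged s) - dotv (xbar (x (tag s) (tagged s))) w.
Proof.
rewrite !mxE; congr (_ - _); apply: eq_bigr => p _.
by rewrite mxE mulrC.
Qed.

Lemma gtildeE tau l w mu :
  gtilde y x tau l w mu = smoothed_loss (client_X l) (client_y l) tau mu w.
Proof.
rewrite /gtilde /smoothed_loss [RHS]big_split /= !mulr_sumr; congr (_ + _);
  by apply: eq_bigr => i _; rewrite client_residual.
Qed.

Lemma sum_gtilde tau w mu :
  \sum_l gtilde y x tau l w mu = smoothed_loss (Xbar x) pooled_y tau mu w.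
Proof.
rewrite /smoothed_loss; under [RHS]eq_bigr do rewrite pooled_residual.
rewrite (sum_pooled (fun l i => 2^-1 * fsmooth (y l i - dotv (xbar (x l i)) w) mu +
  (tau - 2^-1) * (y l i - dotv (xbar (x l i)) w))).
apply: eq_bigr => l _; rewrite gtildeE; apply: eq_bigr => i _.
by rewrite client_residual.
Qed.

Lemma sum_client_gradient tau w mu h :
  \sum_l dotv (loss_gradient (client_X l) (client_y l) tau mu w) h =
  dotv (loss_gradient (Xbar x) pooled_y tau mu w) h.
Proof.
rewrite dotv_loss_gradient.
have hX l i : (h *m client_X l) 0 i = dotv (xbar (x l i)) h.
  by rewrite mxE; apply: eq_bigr => p _; rewrite mxE mulrC.
have hXb j (s := enum_val (A := {: T}) j) :
    (h *m Xbar x) 0 j = dotv (xbar (x (tag s) (tagged s))) h.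
  by rewrite mxE; apply: eq_bigr => p _; rewrite mxE mulrC.
under [in RHS]eq_bigr do rewrite pooled_residual hXb.
rewrite (sum_pooled (fun l i => (2^-1 * dsmooth (y l i - dotv (xbar (x l i)) w) mu +
  (tau - 2^-1)) * dotv (xbar (x l i)) h)) -sumrN.
apply: eq_bigr => l _; rewrite dotv_loss_gradient; congr (- _).
by apply: eq_bigr => i _; rewrite client_residual hX.
Qed.

Lemma Ppen_separable k lam gam (w : 'rV[R]_(P + 1)) :
  Ppen k lam gam w = separable (gpen k lam gam) (fun i : 'I_(P + 1) => (i < P)%N) w.
Proof.
rewrite /separable big_split_ord /= [X in _ = _ + X]big_pred0 => [|i]; last first.
  by rewrite ltnNge leq_addr.
rewrite addr0; apply: eq_big => [i|i _]; first by rewrite /= ltn_ord.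
by rewrite mxE.
Qed.

End Data.

(** Serves the case without observations, where the penalty has weight 0 in the subproblem and
    minimality provides no subgradient. *)
Lemma Ppen_subgradient (R : realType) P k (lam gam : R) (v : 'rV[R]_(P + 1)) :
  0 < lam -> (k = MCP -> 1 <= gam) -> (k = SCAD -> 2 <= gam) ->
  exists s, frechet_subdiff (Ppen k lam gam) v s.
Proof.
move=> lam0 mcp scad.
have [a Ha] := choice (gpen_subgradient lam0 mcp scad).
have [D HD] := choice Ha.
have [delta delta0 Hdelta] := uniform_delta (fun i => (HD (v 0 i)).1).
exists (\row_i ((i < P)%N%:R * a (v 0 i))).
have q0 := curvature_ge0 mcp scad.
apply: (@frechet_subdiff_quadratic _ _ _ _ _ (curvature k gam) delta) => // h hd.
rewrite !Ppen_separable /separable.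
have -> : dotv (\row_i ((i < P)%N%:R * a (v 0 i))) h =
    \sum_(i < P + 1 | (i < P)%N) a (v 0 i) * h 0 i.
  rewrite [RHS]big_mkcond; apply: eq_bigr => i _; rewrite mxE.
  by case: ifP; rewrite ?mul1r ?mul0r.
have : curvature k gam * \sum_(i < P + 1 | (i < P)%N) h 0 i ^+ 2 <=
    curvature k gam * dotv h h.
  rewrite ler_wpM2l // /dotv [leRHS](bigID (fun i : 'I_(P + 1) => (i < P)%N)) /=.
  under eq_bigr do rewrite expr2.
  by rewrite lerDl sumr_ge0 // => i _; rewrite -expr2 sqr_ge0.
rewrite mulr_sumr -(lerD2l (\sum_(i < P + 1 | (i < P)%N) gpen k lam gam (v 0 i) +
  \sum_(i < P + 1 | (i < P)%N) a (v 0 i) * h 0 i)).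
rewrite -lerBlDr -addrA => le1.
have le2 : \sum_(i < P + 1 | (i < P)%N) gpen k lam gam (v 0 i)
    + \sum_(i < P + 1 | (i < P)%N) a (v 0 i) * h 0 i
    - \sum_(i < P + 1 | (i < P)%N) curvature k gam * h 0 i ^+ 2 <=
    \sum_(i < P + 1 | (i < P)%N) gpen k lam gam ((v + h) 0 i).
  rewrite -big_split -sumrB; apply: ler_sum => i _; rewrite mxE.
  apply: (HD (v 0 i)).2; apply: lt_le_trans (Hdelta i).
  by apply: le_lt_trans hd; exact: coord_le_norm2.
lra.
Qed.

Theorem theorem2 (R : realType) (P L : nat) (M : 'I_L -> nat)
  (y : forall l : 'I_L, 'I_(M l) -> R) (x : forall l : 'I_L, 'I_(M l) -> 'rV[R]_P)
  (tau : R) (pk : penalty_kind) (lam gam : R) (c beta d rho : R)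
  (w : nat -> 'rV[R]_(P + 1)) :
  0 < tau < 1 ->
  0 < lam ->
  (pk = MCP -> 1 <= gam) ->
  (pk = SCAD -> 2 <= gam) ->
  0 < c -> 0 < beta -> 0 < d < 1 ->
  (forall a, eigenvalue ((Xbar x)^T *m Xbar x) a -> a / 2 <= beta * c) ->
  fspg_iterates y x tau pk lam gam c beta d w ->
  weak_convexity_param (@Ppen R P pk lam gam) rho ->
  (exists K : nat, forall k : nat, (K <= k)%N ->
     ((\sum_(l < L) M l)%N%:R * rho <= sigmak c d k.+1)) ->
  exists kappa : nat -> 'rV[R]_(P + 1),
    (forall k : nat, exists2 g : 'rV[R]_(P + 1),
       is_gradient (fun u => \sum_(l < L) gtilde y x tau l u (muk beta d k.+2))
         (w k.+1) g &
       exists2 s : 'rV[R]_(P + 1),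
         frechet_subdiff (Ppen pk lam gam) (w k.+1) s &
         kappa k.+1 = g + (\sum_(l < L) M l)%N%:R *: s) /\
    (forall eps : R, 0 < eps -> exists N : nat, forall k : nat, (N <= k)%N ->
       norm2 (kappa k.+1) <= eps * (k%:R `^ ((d - 1) / 2))).
Proof.
move=> tau01 lam0 mcp scad c0 beta0 d01 eig iter [rho0 conv] _.
have d0 : 0 < d by case/andP: d01.
pose nn : R := (\sum_(l < L) M l)%N%:R; have nn0 : 0 <= nn by [].
pose X := Xbar x; pose Y := pooled_y y.
pose pe := fun i : 'I_(P + 1) => (i < P)%N.
pose dG := loss_gradient X Y tau.
pose cp := gpen_pieces lam0 mcp scad.
have muE k : muk beta d k.+1 = beta * invpow d k.+1.
  by rewrite /muk invpowE // powRN.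
have sigmaE k : sigmak c d k.+1 = c / invpow d k.+1.
  by rewrite /sigmak invpowE // powRN invrK.
have mu_gt0 k : 0 < beta * invpow d k by rewrite mulr_gt0 // invpow_gt0.
have spectral h : dotv (h *m X) (h *m X) <= 2 * (beta * c) * dotv h h.
  apply: rayleigh => [|a /eig]; first by rewrite !mulr_gt0.
  by rewrite ler_pdivrMr // mulrC.
have conv' : convex_fun (fun v => separable (gpen pk lam gam) pe v + rho / 2 * dotv v v).
  by move=> a b t t01; have := conv a b t t01; rewrite !norm2_sqr !Ppen_separable.
have minimal k (u : 'rV[R]_(P + 1)) : (0 < k)%N ->
    dotv (dG (beta * invpow d k) (w k.-1)) (w k - w k.-1)
      + nn * separable (gpen pk lam gam) pe (w k)
      + c / invpow d k / 2 * dotv (w k - w k.-1) (w k - w k.-1)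
    <= dotv (dG (beta * invpow d k) (w k.-1)) (u - w k.-1)
      + nn * separable (gpen pk lam gam) pe u
      + c / invpow d k / 2 * dotv (u - w k.-1) (u - w k.-1).
  case: k => // k _ /=.
  pose v l := loss_gradient (client_X x l) (client_y y l) tau (beta * invpow d k.+1) (w k).
  have vgrad l : is_gradient (fun u => gtilde y x tau l u (muk beta d k.+1)) (w k) (v l).
    under eq_fun do rewrite gtildeE muE.
    exact: smoothed_loss_is_gradient.
  have := iter k v vgrad u; rewrite !sum_client_gradient !norm2_sqr !Ppen_separable.
  by rewrite sigmaE.
pose stat := stationarity X Y tau c beta d w.
(* The residual [stat j] contains the gradient for [mu] of index [j], whereas the claim at [w j]
   asks for index [j.+1]; the correction exchanges the two. *)
pose kappa j := stat j + (dG (beta * invpow d j.+1) (w j) - dG (beta * invpow d j) (w j)).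
have rate := stationarity_rate cp nn0 tau01 c0 beta0 d01 (gpen_ge0 lam0 mcp scad)
  spectral rho0 conv' minimal.
have proximal_subgradient k : exists2 s : 'rV[R]_(P + 1),
    frechet_subdiff (Ppen pk lam gam) (w k.+1) s &
    nn *: s = - (dG (beta * invpow d k.+1) (w k) + c / invpow d k.+1 *: (w k.+1 - w k)).
  have sg0 : 0 < c / invpow d k.+1 by rewrite divr_gt0 // invpow_gt0.
  have [v vE] : exists v, v = dG (beta * invpow d k.+1) (w k) by eexists.
  have [D DE] : exists D, D = w k.+1 - w k by eexists.
  have := minimal k.+1 ^~ isT; rewrite /= -vE -DE => min.
  (* Without observations the loss gradient is 0 and the subproblem is minimized only at the
     previous iterate, so the right-hand side is 0 and any subgradient fits. *)
  have [n0|nn1] := eqVneq nn 0.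
    have M0 l : M l = 0%N.
      by apply/eqP; move/eqP: n0; rewrite pnatr_eq0 sum_nat_eq0 => /forallP/(_ l)/implyP; exact.
    have v0 : v = 0.
      apply: dotv_eq0; rewrite {1}vE -sum_client_gradient big1 // => l _.
      rewrite dotv_loss_gradient big1 ?oppr0 // => i _.
      by have := ltn_ord i; rewrite [X in (_ < X)%N]M0.
    have D0 : D = 0.
      apply: dotv_eq0; apply/eqP; rewrite eq_le dotv_ge0 andbT.
      have := min (w k); rewrite subrr n0 v0 !mul0r !dotv0r !mulr0 !addr0.
      by rewrite dotvC dotv0r add0r pmulr_rle0 // divr_gt0.
    have [s sP] : exists s, frechet_subdiff (Ppen pk lam gam) (w k.+1) s.
      exact: Ppen_subgradient.
    by exists s => //; rewrite n0 v0 D0 scale0r scaler0 addr0 oppr0.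
  have nn_gt0 : 0 < nn by rewrite lt_def nn1.
  exists (- (nn^-1 *: (v + c / invpow d k.+1 *: D))); last first.
    by rewrite scalerN scalerA divff // scale1r vE DE.
  apply: (@frechet_subdiff_quadratic _ _ _ _ _ (c / invpow d k.+1 / (2 * nn)) 1) => //.
    apply: divr_ge0; first exact: ltW.
    by rewrite mulr_ge0.
  move=> h _; have := min (w k.+1 + h).
  have -> : w k.+1 + h - w k = D + h by rewrite DE addrAC.
  rewrite !Ppen_separable dotvNl dotvZl !(dotvDl, dotvDr, dotvZl) (dotvC h D).
  set p0 := separable _ _ _; set p1 := separable _ _ _.
  set sg := c / invpow d k.+1 in sg0 *.
  (* The proximal term is a quadratic around [w k]: recentred at [w k.+1], it leaves a linear term,
     which enters the subgradient, and a square, harmless for a regular subgradient. *)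
  move=> H; rewrite -(ler_pM2l nn_gt0).
  have -> : nn * (p0 - nn^-1 * (dotv v h + sg * dotv D h) - sg / (2 * nn) * dotv h h) =
    nn * p0 - (dotv v h + sg * dotv D h) - sg / 2 * dotv h h by field.
  lra.
exists kappa; split=> [k|eps eps0].
  exists (dG (beta * invpow d k.+2) (w k.+1)).
    under eq_fun do rewrite sum_gtilde muE.
    exact: smoothed_loss_is_gradient.
  have [s sP sE] := proximal_subgradient k.
  exists s => //; rewrite -/nn sE /kappa /stat /stationarity /= -/dG.
  by rewrite opprD addrC !addrA subrK.
pose m : R := (P + 1)%N%:R; have m0 : 0 < m by rewrite ltr0n addn1.
pose eps' := eps / (2 * m); have eps'0 : 0 < eps' by rewrite divr_gt0 // mulr_gt0.
have [C C0 HC] := loss_gradient_mu X Y tau.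
have [Q [_ _ /(_ _ beta0) Smu]] := power_scales d01.
have [N _ HN] : \forall k \near \oo%classic, norm2 (kappa k) <= eps * invpow ((1 - d) / 2) k.
  near=> k.
  have k0 : (0 < k)%N by near: k; exact: nbhs_infty_gt.
  have k2 : 2 <= k%:R :> R by near: k; exact: nbhs_infty_ger.
  have mm : beta * invpow d k.+1 <= beta * invpow d k.
    by near: k; exact: (smoothing_decr Smu).
  have ms : beta * invpow d k - beta * invpow d k.+1 <= beta * invpow d k / k%:R.
    by near: k; exact: (smoothing_step Smu).
  have r1 : `|stat k| <= eps' * invpow ((1 - d) / 2) k by near: k; exact: rate.
  have r2 : invpow ((1 + d) / 2) k <= eps' / (2 * C + 1).
    near: k; apply: invpow_small; first lra.
    by rewrite divr_gt0 // ltr_wpDl // mulr_ge0.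
  have i0 := invpow_gt0 ((1 - d) / 2) k.
  (* Changing the index of [mu] costs [O(1/k)], and [1/k] is [k^(-(1-d)/2)] times the vanishing
     factor [k^(-(1+d)/2)]. *)
  have r3 : C * (2 / k%:R) <= eps' * invpow ((1 - d) / 2) k.
    have -> : k%:R^-1 = invpow ((1 + d) / 2) k * invpow ((1 - d) / 2) k.
      rewrite /invpow -expRD -mulrDl (_ : _ + _ = -1); last by field.
      by rewrite mulN1r expRN lnK // posrE ltr0n.
    rewrite !mulrA ler_pM2r //.
    move: r2; rewrite ler_pdivlMr ?ltr_wpDl ?mulr_ge0 // => r2.
    have := invpow_gt0 ((1 + d) / 2) k; lra.
  apply: le_trans (norm2_le _) _.
  have -> : eps * invpow ((1 - d) / 2) k = m * (2 * (eps' * invpow ((1 - d) / 2) k)).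
    by rewrite /eps'; field; rewrite gt_eqF.
  rewrite ler_pM2l //; apply: le_trans (ler_normD _ _) _.
  have h1 := HC _ _ (w k) (mu_gt0 k.+1) mm.
  have h2 := ler_wpM2l C0 (relative_step (mu_gt0 k.+1) mm k2 ms).
  rewrite -/dG in h1; rewrite mulr_natl mulr2n; apply: lerD => //.
  exact: le_trans h1 (le_trans h2 r3).
(* The bound is obtained at [k.+1] and weakened to [k], since the power decreases; [N.+1] keeps [k]
   positive, where [invpow] agrees with [powR]. *)
exists N.+1 => k Nk; apply: le_trans (HN k.+1 _) _; first exact: leqW (ltnW Nk).
rewrite ler_pM2l //.
have k0 : (0 < k)%N by exact: leq_trans Nk.
have -> : (d - 1) / 2 = - ((1 - d) / 2) by field.
rewrite -invpowE // (invpow_ratio _ k0) ger_pMr ?invpow_gt0 //.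
rewrite -[leRHS]expR0 ler_expR mulr_le0_ge0 //; first lra.
by rewrite ln_ge0 // ler_pdivlMr ?ltr0n // mul1r ler_nat.
Unshelve. all: by end_near. Qed.
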